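(* Suppose that the family of source terms $\{g_{T,\ell}\mid T\in\mathcal T_H\}$ is a Riesz basis of $\mathbb P^0(\mathcal T_H)$, i.e. there is $C_{\mathrm{rb}}(H,\ell)>0$, depending polynomially on $H,\ell$ (possibly with negative powers of $H$), such that for all real coefficients $(c_T)_{T\in\mathcal T_H}$ $$C_{\mathrm{rb}}^{-1}(H,\ell)\sum_{T\in\mathcal T_H}c_T^2\le\Big\|\sum_{T\in\mathcal T_H}c_T\,g_{T,\ell}\Big\|_{L^2(\Omega)}^2\le C_{\mathrm{rb}}(H,\ell)\sum_{T\in\mathcal T_H}c_T^2 .$$ Then there are constants $C,C'>0$ independent of $H$ and $\ell$ such that, for any $s\in[0,1]$ and all $f\in H^s(\Omega)$, $$\|\mathcal A^{-1}f-\mathcal A_{H,\ell}^{-1}f\|_{a,\Omega}\le C\big(H\|f-\Pi_Hf\|_{L^2(\Omega)}+C_{\mathrm{rb}}^{1/2}(H,\ell)\,\ell^{d/2}\,\sigma(H,\ell)\,\|f\|_{L^2(\Omega)}\big)$$ $$\le C'\big(H^{1+s}+C_{\mathrm{rb}}^{1/2}(H,\ell)\,\ell^{d/2}\,\sigma(H,\ell)\big)\|f\|_{H^s(\Omega)} .$$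
   Context: Model problem. $\Omega\subset\mathbb R^d$ is a polygonal (polyhedral) Lipschitz domain with diameter of order one. $A\in L^\infty(\Omega,\mathbb R^{d\times d})$ is symmetric and satisfies $\alpha|\eta|^2\le (A(x)\eta)\cdot\eta\le\beta|\eta|^2$ for almost all $x\in\Omega$ and all $\eta\in\mathbb R^d$, with $0<\alpha\le\beta<\infty$. Put $\mathcal V=H^1_0(\Omega)$, $a(u,v)=\int_\Omega (A\nabla u)\cdot\nabla v\,dx$, $\|v\|_{a,\Omega}=\sqrt{a(v,v)}$. For $f\in L^2(\Omega)$, $\mathcal A^{-1}f\in\mathcal V$ is the unique $u\in\mathcal V$ with $a(u,v)=(f,v)_{L^2(\Omega)}$ for all $v\in\mathcal V$. Mesh. $\mathcal T_H$ is taken from a quasi-uniform family of finite subdivisions of $\Omega$ into closed, convex, shape-regular elements of diameter at most $H>0$. $\mathbb P^0(\mathcal T_H)$ is the space of $\mathcal T_H$-piecewise constant functions and $\Pi_H$ the $L^2(\Omega)$-orthogonal projection onto it. For a union of elements $S$, $\mathsf N^1(S)=\bigcup\{T\in\mathcal T_H\mid T\cap S\ne\emptyset\}$, and $\mathsf N^\ell(T)=\mathsf N^1(\mathsf N^{\ell-1}(T))$ for $\ell\ge2$. Local construction. Fix $\ell\in\mathbb N$ and, for $T\in\mathcal T_H$, let $\omega=\mathsf N^\ell(T)$; it is assumed that $\omega$ does not coincide with $\Omega$. Let $\mathcal T_{H,\omega}$ be the submesh of elements contained in $\omega$, $a_\omega(u,v)=\int_\omega(A\nabla u)\cdot\nabla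 v\,dx$, $\mathcal V_\omega=\{v|_\omega\mid v\in\mathcal V\}\subset H^1(\omega)$, and let $$Y=\{v\in\mathcal V_\omega\mid a_\omega(v,w)=0\ \text{for all } w\in H^1_0(\omega)\}$$ be the space of $A$-harmonic functions on $\omega$ vanishing on $\partial\Omega\cap\partial\omega$. The source term $g_{T,\ell}$ is a chosen minimizer $$g_{T,\ell}\in\operatorname*{argmin}_{g\in\mathbb P^0(\mathcal T_{H,\omega}):\ \|g\|_{L^2(\omega)}=1}\ \sup_{v\in Y:\ \|v\|_{H^1(\omega)}=1}(g,v)_{L^2(\omega)}$$ (equivalently, a left singular vector for the smallest of the $\#\mathcal T_{H,\omega}$ singular values of the $L^2(\omega)$-orthogonal projection onto $\mathbb P^0(\mathcal T_{H,\omega})$ restricted to $(Y,\|\cdot\|_{H^1(\omega)})$), extended by zero to $\Omega$. Set $$\sigma_T(H,\ell)=\sup_{v\in Y:\ \|v\|_{H^1(\omega)}=1}(g_{T,\ell},v)_{L^2(\omega)},\qquad \sigma(H,\ell)=\max_{T\in\mathcal T_H}\sigma_T(H,\ell).$$ The localized basis function $\varphi^{\mathrm{loc}}_{T,\ell}\in H^1_0(\omega)$ (extended by zero to $\Omega$) is the unique solution of $a_\omega(\varphi^{\mathrm{loc}}_{T,\ell},v)=(g_{T,\ell},v)_{L^2(\omega)}$ for all $v\in H^1_0(\omega)$. Localized method. $\mathcal V_{H,\ell}=\operatorname{span}\{\varphi^{\mathrm{loc}}_{T,\ell}\mid T\in\mathcal T_H\}\subset\mathcal V$, and $\mathcal A_{H,\ell}^{-1}f=u_{H,\ell}\in\mathcal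 V_{H,\ell}$ is the Galerkin solution: $a(u_{H,\ell},v)=(f,v)_{L^2(\Omega)}$ for all $v\in\mathcal V_{H,\ell}$. Constants. The constants $C,C'$ may depend on $\alpha,\beta$ (and on $d$, $\Omega$ and the mesh regularity parameters) but not on variations of $A$. *)

(* Defs.v *)
From HB Require Import structures.
From mathcomp Require Import all_boot all_order all_algebra.
From mathcomp Require Import all_classical all_reals all_analysis.
Set Implicit Arguments.
Unset Strict Implicit.
Unset Printing Implicit Defensive.
Import Order.TTheory GRing.Theory Num.Theory.
Import numFieldNormedType.Exports.

Local Open Scope classical_set_scope.
Local Open Scope ring_scope.

(* MathComp-Analysis has no Lebesgue measure on 'rV[R]_n. We equip 'rV[R]_n   *)
(* with the sigma-algebra generated by the coordinates and build the measure  *)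
(* as the n-fold product of lebesgue_measure; lebesgue_rV_box gives its value *)
(* on boxes.                                                                  *)

Definition rV_display : measure_display.
Proof. exact: default_measure_display. Qed.

Section measurable_rV.
Context {R : realType} {n : nat}.

Definition coordV (i : 'I_n) (x : 'rV[R]_n) : R := x 0 i.

Let rV_set0 : g_sigma_preimage coordV set0.
Proof. exact: sigma_algebra0. Qed.

Let rV_setC A : g_sigma_preimage coordV A -> g_sigma_preimage coordV (~` A).
Proof. exact: sigma_algebraC. Qed.

Let rV_bigcup (F : (set 'rV[R]_n)^nat) :
  (forall i, g_sigma_preimage coordV (F i)) ->
  g_sigma_preimage coordV (\bigcup_i (F i)).
Proof. exact: sigma_algebra_bigcup. Qed.

HB.instance Definition _ := @isMeasurable.Build rV_display
  'rV[R]_n (g_sigma_preimage coordV) rV_set0 rV_setC rV_bigcup.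

Lemma measurable_coord (i : 'I_n) : measurable_fun [set: 'rV[R]_n] (coordV i).
Proof.
move=> _ Y mY; rewrite setTI; apply: sub_sigma_algebra => /=.
rewrite -bigcup_seq/=; exists i => /=; first by rewrite mem_index_enum.
by exists Y => //; rewrite setTI.
Qed.

Lemma measurable_fun_coordP d (T : measurableType d) (f : T -> 'rV[R]_n) :
  (forall i, measurable_fun [set: T] (coordV i \o f)) ->
  measurable_fun [set: T] f.
Proof.
move=> mf _ A mA; rewrite setTI.
have : g_sigma_preimage (fun i => coordV i \o f) (f @^-1` A).
  by rewrite g_sigma_preimage_comp; exists A => //; rewrite setTI.
apply: smallest_sub; first exact: sigma_algebra_measurable.
rewrite -bigcup_seq/=; apply: bigcup_sub => i _.
by move=> B [C mC <-]; exact: mf.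
Qed.

End measurable_rV.

Section lebesgue_rV.
Context {R : realType}.

Definition consrV n (p : R * 'rV[R]_n) : 'rV[R]_n.+1 := row_mx p.1%:M p.2.

Lemma coord_consrV0 n p : coordV ord0 (@consrV n p) = p.1.
Proof.
rewrite /coordV /consrV (_ : @ord0 n = lshift n (@ord0 0)); last exact/val_inj.
by rewrite (@row_mxEl _ _ 1%N) mxE eqxx mulr1n.
Qed.

Lemma coord_consrVS n p (i : 'I_n) :
  coordV (lift ord0 i) (@consrV n p) = coordV i p.2.
Proof.
rewrite /coordV /consrV (_ : lift ord0 i = rshift 1 i); last exact/val_inj.
by rewrite (@row_mxEr _ _ 1%N).
Qed.

Lemma measurable_consrV n : measurable_fun setT (@consrV n).
Proof.
apply: measurable_fun_coordP => i.
case: (unliftP ord0 i) => [j|] ->.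
- rewrite (_ : _ \o _ = coordV j \o snd).
    by apply: measurableT_comp => //; exact: measurable_coord.
  by apply/funext => p /=; exact: coord_consrVS.
- rewrite (_ : _ \o _ = fst) => //.
  by apply/funext => p /=; exact: coord_consrV0.
Qed.

Section next.
Variables (n : nat) (m : {sigma_finite_measure set 'rV[R]_n -> \bar R}).

Definition lebesgue_next : set 'rV[R]_n.+1 -> \bar R :=
  pushforward (@lebesgue_measure R \x m)%E (@consrV n).

Let next0 : lebesgue_next set0 = 0%E.
Proof. by rewrite /lebesgue_next /pushforward preimage_set0 measure0. Qed.

Let next_ge0 A : (0 <= lebesgue_next A)%E.
Proof. by rewrite /lebesgue_next /pushforward; exact: measure_ge0. Qed.

Let next_sigma_additive : semi_sigma_additive lebesgue_next.
Proof.
move=> F mF tF mUF; rewrite /lebesgue_next /pushforward preimage_bigcup.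
have mc A : measurable A -> measurable (@consrV n @^-1` A).
  by move=> mA; rewrite -[X in measurable X]setTI; exact: measurable_consrV.
apply: measure_semi_sigma_additive => [k||]; first exact: mc.
- apply/trivIsetP => /= i j _ _ ij; rewrite -preimage_setI.
  by move/trivIsetP : tF => /(_ _ _ _ _ ij) ->//; rewrite preimage_set0.
- by rewrite -preimage_bigcup; exact: mc.
Qed.

HB.instance Definition _ := isMeasure.Build _ _ _ lebesgue_next
  next0 next_ge0 next_sigma_additive.


Let next_sigma_finite : sigma_finite setT lebesgue_next.
Proof.
pose u (x : 'rV[R]_n.+1) : R * 'rV[R]_n :=
  (coordV ord0 x, \row_i coordV (lift ord0 i) x).
have uK : cancel (@consrV n) u.
  move=> p; rewrite /u coord_consrV0 [RHS]surjective_pairing; congr pair.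
  by apply/rowP => i; rewrite mxE coord_consrVS.
have mu : measurable_fun setT u.
  apply: measurable_fun_pair; first exact: measurable_coord.
  apply: measurable_fun_coordP => i.
  rewrite (_ : _ \o _ = coordV (lift ord0 i)); first exact: measurable_coord.
  by apply/funext => x /=; rewrite /coordV mxE.
have mpre A : measurable A -> measurable (u @^-1` A).
  by move=> mA; rewrite -[X in measurable X]setTI; exact: mu.
have /sigma_finiteP[F [TF ndF Foo]] := sigma_finiteT (@lebesgue_measure R).
have /sigma_finiteP[G [TG ndG Goo]] := sigma_finiteT m.
exists (fun k => u @^-1` (F k `*` G k)) => [|k].
  rewrite -preimage_bigcup; apply/seteqP; split => // x _ /=.
  have [i _ Fi] : (\bigcup_i F i) (u x).1 by rewrite -TF.
  have [j _ Gj] : (\bigcup_i G i) (u x).2 by rewrite -TG.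
  exists (maxn i j) => //; split.
    by move: Fi; exact/subsetPset/ndF/leq_maxl.
  by move: Gj; exact/subsetPset/ndG/leq_maxr.
have [mF Fk] := Foo k; have [mG Gk] := Goo k.
split; first by apply: mpre; exact: measurableX.
rewrite /lebesgue_next /pushforward (_ : _ @^-1` _ = F k `*` G k).
  by rewrite product_measure1E// lte_mul_pinfty// ge0_fin_numE.
by apply/funext => p; rewrite /preimage /mkset uK.
Qed.

HB.instance Definition _ := Measure_isSigmaFinite.Build _ _ _ lebesgue_next
  next_sigma_finite.

End next.

Fixpoint lebesgue_rV n : {sigma_finite_measure set 'rV[R]_n -> \bar R} :=
  match n with
  | 0 => [the {sigma_finite_measure set _ -> \bar R} of \d_ (0 : 'rV[R]_0)]
  | k.+1 => [the {sigma_finite_measure set _ -> \bar R} of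
               lebesgue_next (lebesgue_rV k)]
  end.

Lemma lebesgue_rV_box n (a b : 'rV[R]_n) : (forall i, a 0 i <= b 0 i) ->
  lebesgue_rV n [set x | forall i, a 0 i <= x 0 i <= b 0 i] =
  (\prod_i (b 0 i - a 0 i))%:E.
Proof.
elim: n a b => [|n IHn] a b ab.
  by rewrite big_ord0 /= diracE mem_set// => -[].
pose tl (c : 'rV[R]_n.+1) : 'rV[R]_n := \row_i c 0 (lift ord0 i).
rewrite big_ord_recl /= /lebesgue_next /pushforward.
have pre : (@consrV n @^-1` [set x | forall i, a 0 i <= x 0 i <= b 0 i]) =
    `[a 0 ord0, b 0 ord0]%classic `*`
    [set x : 'rV[R]_n | forall i, tl a 0 i <= x 0 i <= tl b 0 i].
  apply/seteqP; split => [p /= pab|p [/= p0 pab] i].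
    split => /= [|i].
      have := pab ord0; rewrite -[consrV p _ _]/(coordV _ (consrV p)).
      by rewrite coord_consrV0 in_itv.
    have := pab (lift ord0 i); rewrite -[consrV p _ _]/(coordV _ (consrV p)).
    by rewrite coord_consrVS !mxE.
  rewrite -[consrV p _ _]/(coordV _ (consrV p)).
  case: (unliftP ord0 i) => [j|] ->.
    by rewrite coord_consrVS; have := pab j; rewrite !mxE.
  by rewrite coord_consrV0; move: p0; rewrite in_itv.
transitivity ((@lebesgue_measure R \x lebesgue_rV n)%E
    (`[a 0 ord0, b 0 ord0]%classic `*`
     [set x : 'rV[R]_n | forall i, tl a 0 i <= x 0 i <= tl b 0 i])).
  exact: (congr1 (@lebesgue_measure R \x lebesgue_rV n)%E pre).
rewrite product_measure1E//=; last first.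
  rewrite (_ : mkset _ = \big[setI/setT]_(i < n)
      (@coordV R n i @^-1` `[tl a 0 i, tl b 0 i]%classic)).
    apply: bigsetI_measurable => i _.
    by rewrite -[X in measurable X]setTI; exact: measurable_coord.
  rewrite -bigcap_seq; apply/seteqP; split => x /= xab i.
    by move=> _; rewrite /= in_itv; exact: xab.
  by have := xab i (mem_index_enum i); rewrite /= in_itv.
rewrite IHn => [|i]; last by rewrite !mxE.
rewrite lebesgue_measure_itv/= lte_fin EFinM; congr (_ * _)%E.
  have := ab ord0; rewrite le_eqVlt => /predU1P[->|->//].
  by rewrite ltxx subrr.
by congr EFin; apply: eq_bigr => i _; rewrite !mxE.
Qed.

End lebesgue_rV.
Arguments lebesgue_rV R n : clear implicits.

(* Functions on a subset of R^n are total functions 'rV[R]_n -> R of which    *)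
(* only the values on that subset matter; elements of L^2, H^1, ... are       *)
(* represented by such functions instead of classes modulo a.e. equality.     *)

Section euclidean.
Context {R : realType} {n : nat}.
Implicit Types (x y : 'rV[R]_n) (D : set 'rV[R]_n).

Definition dotv x y : R := \sum_i x 0 i * y 0 i.

(* The norm `|x| of the library on 'rV[R]_n is the maximum norm. *)
Definition enorm x : R := Num.sqrt (dotv x x).

Definition diam D : R := sup [set enorm (x - y) | x in D & y in D].

Definition polyhedral D : Prop :=
  exists (m k : nat) (a : 'I_m -> 'I_k -> 'rV[R]_n) (b : 'I_m -> 'I_k -> R),
    closure D = \bigcup_i [set x | forall j, dotv (a i j) x <= b i j].

(* Near each boundary point, D lies strictly above a Lipschitz graph in some  *)
(* unit direction e. The graph function is given on the whole space as a      *)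
(* Lipschitz function that is constant along e.                               *)
Definition lipschitz_boundary D : Prop :=
  forall p, closure D p -> ~ D p ->
  exists (e : 'rV[R]_n) (r L : R) (gam : 'rV[R]_n -> R),
    [/\ enorm e = 1, 0 < r,
        forall x t, gam (x + t *: e) = gam x,
        forall x y, `|gam x - gam y| <= L * enorm (x - y) &
        forall x, enorm (x - p) < r -> (D x <-> gam x < dotv x e)].

Definition polyhedral_lipschitz_domain D : Prop :=
  [/\ D !=set0 /\ open D, connected D, bounded_set D,
      polyhedral D & lipschitz_boundary D].

End euclidean.

Section sobolev.
Context {R : realType} {n : nat}.
Implicit Types (D : set 'rV[R]_n) (u v f g phi : 'rV[R]_n -> R).
Let mu := lebesgue_rV R n.

Definition L2 D f : Prop :=
  measurable_fun D f /\ mu.-integrable D (fun x => (f x ^+ 2)%:E).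

Definition l2dot D f g : R := \int[mu]_(x in D) (f x * g x).

Definition l2norm D f : R := Num.sqrt (l2dot D f f).

Definition partial (i : 'I_n) f : 'rV[R]_n -> R :=
  fun x => 'D_(delta_mx 0 i) f x.

Definition smooth f : Prop := forall s : seq 'I_n,
  continuous (foldr partial f s) /\
  forall i x, derivable (foldr partial f s) x (delta_mx 0 i).

Definition test_fun D phi : Prop :=
  [/\ smooth phi, compact (closure [set x | phi x != 0]) &
      closure [set x | phi x != 0] `<=` D].

Definition weak_grad D u (G : 'rV[R]_n -> 'rV[R]_n) : Prop :=
  (forall i, L2 D (fun x => G x 0 i)) /\
  forall phi, test_fun D phi -> forall i,
    \int[mu]_(x in D) (u x * partial i phi x) =
    - \int[mu]_(x in D) (G x 0 i * phi x).

Definition H1 D u : Prop := L2 D u /\ exists G, weak_grad D u G.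

(* A weak gradient is determined only a.e.; one of them is chosen. *)
Definition grad D u : 'rV[R]_n -> 'rV[R]_n :=
  xget (fun=> 0) [set G | weak_grad D u G].

Definition h1norm D u : R :=
  Num.sqrt (l2norm D u ^+ 2 + \int[mu]_(x in D) enorm (grad D u x) ^+ 2).

Definition H10 D u : Prop :=
  H1 D u /\
  forall eps, 0 < eps -> exists2 phi, test_fun D phi & h1norm D (u \- phi) < eps.

Definition slobodeckij D (s : R) f : \bar R :=
  (\int[mu]_(x in D) \int[mu]_(y in D)
     ((f x - f y) ^+ 2 / enorm (x - y) `^ (n%:R + 2 * s))%:E)%E.

Definition Hs D (s : R) f : Prop :=
  [/\ L2 D f, s = 1 -> H1 D f & 0 < s < 1 -> (slobodeckij D s f < +oo)%E].

Definition hsnorm D (s : R) f : R :=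
  if s == 0 then l2norm D f
  else if s == 1 then h1norm D f
  else Num.sqrt (l2norm D f ^+ 2 + fine (slobodeckij D s f)).

End sobolev.

Section model_problem.
Context {R : realType} {d : nat}.
Implicit Types (Omega D : set 'rV[R]_d) (A : 'rV[R]_d -> 'M[R]_d).
Implicit Types (f u v w : 'rV[R]_d -> R).
Let mu := lebesgue_rV R d.

Definition coefficient Omega (alpha beta : R) A : Prop :=
  [/\ forall i j, measurable_fun Omega (fun x => A x i j),
      exists M : R, {ae mu, forall x, Omega x -> forall i j, `|A x i j| <= M},
      {ae mu, forall x, Omega x -> (A x)^T = A x} &
      {ae mu, forall x, Omega x -> forall eta : 'rV[R]_d,
        alpha * enorm eta ^+ 2 <= (eta *m A x *m eta^T) 0 0
          <= beta * enorm eta ^+ 2}].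

Definition energy A D u v : R :=
  \int[mu]_(x in D) (grad D v x *m A x *m (grad D u x)^T) 0 0.

Definition energy_norm A D v : R := Num.sqrt (energy A D v v).

Definition solution A Omega f u : Prop :=
  H10 Omega u /\ forall v, H10 Omega v -> energy A Omega u v = l2dot Omega f v.

End model_problem.

Section mesh.
Context {R : realType} {d N : nat}.
Implicit Types (Omega S : set 'rV[R]_d) (f p q : 'rV[R]_d -> R).
Variable T : 'I_N -> set 'rV[R]_d.

(* rho is the shape regularity parameter, tau the quasi-uniformity parameter. *)
Definition mesh Omega (H rho tau : R) : Prop :=
  [/\ forall i, closed (T i),
      forall i x y t, T i x -> T i y -> 0 <= t <= 1 ->
        T i ((1 - t) *: x + t *: y),
      closure Omega = \bigcup_i T i /\
        (forall i j, i != j -> (T i)° `&` (T j)° = set0),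
      forall i x y, T i x -> T i y -> enorm (x - y) <= H &
      forall i, tau * H <= diam (T i) /\
        exists (c : 'rV[R]_d) (r : R), [/\ 0 < r, rho * diam (T i) <= r &
          forall x, enorm (x - c) <= r -> T i x]].

Definition neighborhood S : set 'rV[R]_d :=
  \bigcup_(i in [set i | T i `&` S !=set0]) T i.

Definition elt_patch (l : nat) (i : 'I_N) : set 'rV[R]_d :=
  iter l neighborhood (T i).

(* Piecewise constants on the elements contained in S, extended by zero; the  *)
(* representatives vanish on the element boundaries, which are null sets.     *)
Definition P0 S : set ('rV[R]_d -> R) :=
  [set p | exists2 c : 'I_N -> R, forall i, ~ T i `<=` S -> c i = 0 &
    p = fun x => \sum_i c i * \1_((T i)°) x].

Definition l2proj Omega f p : Prop :=
  P0 (closure Omega) p /\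
  forall q, P0 (closure Omega) q -> l2dot Omega (f \- p) q = 0.

End mesh.

(* A patch omega is a closed set; integrals and Sobolev spaces over omega are *)
(* taken over its interior, written W, which differs from omega by a null set.*)
Section local_problems.
Context {R : realType} {d N : nat}.
Variables (A : 'rV[R]_d -> 'M[R]_d) (Omega : set 'rV[R]_d).
Variable T : 'I_N -> set 'rV[R]_d.
Implicit Types (W omega : set 'rV[R]_d) (f g u v w phi : 'rV[R]_d -> R).

Definition restricted W : set ('rV[R]_d -> R) :=
  [set v \_ W | v in H10 Omega].

Definition harmonic_space W : set ('rV[R]_d -> R) :=
  [set v | restricted W v /\ forall w, H10 W w -> energy A W v w = 0].

Definition harmonic_sup W g : R :=
  sup [set l2dot W g v | v in [set v | harmonic_space W v /\ h1norm W v = 1]].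

Definition source_term omega g : Prop :=
  [/\ P0 T omega g, l2norm omega° g = 1 &
      forall g', P0 T omega g' -> l2norm omega° g' = 1 ->
        harmonic_sup omega° g <= harmonic_sup omega° g'].

Definition local_basis omega g phi : Prop :=
  [/\ H10 omega° phi, phi = phi \_ omega° &
      forall v, H10 omega° v -> energy A omega° phi v = l2dot omega° g v].

Definition sigma (l : nat) (g : 'I_N -> 'rV[R]_d -> R) : R :=
  \big[Num.max/0]_i harmonic_sup (elt_patch T l i)° (g i).

Definition lincomb (g : 'I_N -> 'rV[R]_d -> R) (c : 'I_N -> R) :
  'rV[R]_d -> R := fun x => \sum_i c i * g i x.

Definition riesz (C : R) (g : 'I_N -> 'rV[R]_d -> R) : Prop :=
  forall c : 'I_N -> R,
    C^-1 * \sum_i c i ^+ 2 <= l2norm Omega (lincomb g c) ^+ 2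
      <= C * \sum_i c i ^+ 2.

Definition galerkin (phi : 'I_N -> 'rV[R]_d -> R) f u : Prop :=
  range (lincomb phi) u /\
  forall v, range (lincomb phi) v -> energy A Omega u v = l2dot Omega f v.

End local_problems.

(* Polynomial dependence on H, H^-1 and l, as a growth condition. *)
Definition polynomially_bounded {R : realType} (P : set (R * nat))
    (C : R -> nat -> R) : Prop :=
  exists (K : R) (p q : nat), forall H l, P (H, l) ->
    C H l <= K * (H ^+ p + H ^- p) * l%:R ^+ q.

(* Main.v *)
(* Write e = u - u_{H,l} and a(v, w) for the energy form. By Galerkin orthogonality,
   a(e, e) = a(u - v, e) for every v in the discrete space. The Riesz bound makes the
   source terms a basis of the piecewise constants, so Pi_H f = sum_i c_i g_i with
   sum_i c_i^2 <= Crb |f|^2; choosing v = sum_i c_i phi_i gives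
     a(e, e) = (f - Pi_H f, e) + sum_i c_i [(g_i, e) - a(phi_i, e)].
   In the first term e may be replaced by e minus a piecewise constant, and the
   Poincare inequality on the convex elements yields the factor H. In the i-th bracket,
   split e on the patch of i into its energy projection onto H10, which cancels by the
   definition of phi_i, and an A-harmonic rest, which a(phi_i, .) annihilates; what
   remains is at most sigma times the H1 norm of e on the patch, up to a constant.
   The patches overlap at most const * l^d times, and Friedrichs' inequality bounds the
   H1 norm by the energy norm.

   Elements are compared through double integrals of (u x - u y)^2: for u in H1 they are
   bounded by integrating u(x + h) - u(x) = int_0^1 h . grad u(x + t h) dt, for
   fractional s directly by the Slobodeckij seminorm. *)

Require Import Defs.
From mathcomp Require Import all_boot all_order all_algebra.
From mathcomp Require Import all_classical all_reals all_analysis.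
From mathcomp Require Import measurable_realfun ring lra.
Set Implicit Arguments.
Unset Strict Implicit.
Unset Printing Implicit Defensive.
Import Order.TTheory GRing.Theory Num.Theory.
Import numFieldNormedType.Exports.

Local Open Scope classical_set_scope.
Local Open Scope ring_scope.

(** * Lebesgue measure on boxes *)

Section boxes.
Context {R : realType} {n : nat}.
Implicit Types (a b c x y : 'rV[R]_n).

(** The constants have to be fixed before the coefficient, the mesh, [H] and [l]. Compactness
    arguments are therefore avoided, and every inequality comes with an explicit constant in d,
    alpha, beta, rho, tau and the half-width M of one cube that contains Omega and hence all
    patches. This shapes the Poincare inequality, whose constant is a quotient of volumes of boxes,
    and Friedrichs' inequality, whose constant is a multiple of M. The patches may have rough
    boundaries, so traces are avoided as well: [H10] is handled only as the closure of the test
    functions, and extension by zero is verified on test functions. Nor are functions of H1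
    approximated by smooth ones. The formula for u(x + h) - u(x) is first proved tested against
    bumps and then becomes an almost-everywhere identity. Bumps that are products of one-variable
    functions built from exp(-c/x) suffice for this, because boxes generate the sigma-algebra.
    Convexity of an element keeps the segment from x to x + h inside it. *)

Definition box a b : set 'rV[R]_n := [set x | forall i, a 0 i < x 0 i < b 0 i].

Definition cbox a b : set 'rV[R]_n :=
  [set x | forall i, a 0 i <= x 0 i <= b 0 i].

Lemma bigsetI_coord (P : 'I_n -> set R) :
  [set x : 'rV[R]_n | forall i, P i (x 0 i)] =
  \big[setI/setT]_(i < n) (@coordV R n i @^-1` P i).
Proof.
rewrite -bigcap_seq; apply/seteqP; split => x /= xab i.
  by move=> _; exact: xab.
exact: (xab i (mem_index_enum i)).
Qed.

Lemma measurable_forall_coord (P : 'I_n -> set R) :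
  (forall i, measurable (P i)) ->
  measurable [set x : 'rV[R]_n | forall i, P i (x 0 i)].
Proof.
move=> mP; rewrite bigsetI_coord; apply: bigsetI_measurable => i _.
by rewrite -[X in measurable X]setTI; exact: measurable_coord.
Qed.

Lemma box_itv a b :
  box a b = [set x | forall i, `]a 0 i, b 0 i[%classic (x 0 i)].
Proof.
by apply/seteqP; split => x /= h i; have := h i; rewrite in_itv.
Qed.

Lemma cbox_itv a b :
  cbox a b = [set x | forall i, `[a 0 i, b 0 i]%classic (x 0 i)].
Proof.
by apply/seteqP; split => x /= h i; have := h i; rewrite in_itv.
Qed.

Lemma measurable_box a b : measurable (box a b).
Proof.
rewrite box_itv.
by apply: (@measurable_forall_coord (fun i => `]a 0 i, b 0 i[%classic)) => i.
Qed.

Lemma measurable_cbox a b : measurable (cbox a b).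
Proof.
rewrite cbox_itv.
by apply: (@measurable_forall_coord (fun i => `[a 0 i, b 0 i]%classic)) => i.
Qed.

Lemma box_cbox a b : box a b `<=` cbox a b.
Proof. by move=> x /= h i; have /andP[/ltW-> /ltW->] := h i. Qed.

Lemma boxI a b c (e : 'rV[R]_n) :
  box a b `&` box c e =
  box (\row_i Num.max (a 0 i) (c 0 i)) (\row_i Num.min (b 0 i) (e 0 i)).
Proof.
apply/seteqP; split => [x [/= h1 h2] i|x /= h].
  have /andP[p1 p2] := h1 i; have /andP[q1 q2] := h2 i.
  by rewrite !mxE gt_max lt_min p1 p2 q1 q2.
by split => i; move: (h i); rewrite !mxE gt_max lt_min
  => /andP[/andP[p1 q1] /andP[p2 q2]]; apply/andP.
Qed.

Definition boxes : set (set 'rV[R]_n) :=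
  [set B | exists p : 'rV[R]_n * 'rV[R]_n, B = box p.1 p.2].

Lemma boxes_setI : setI_closed boxes.
Proof. by move=> A B [[a b] ->] [[c e] ->]; rewrite boxI; eexists (_, _). Qed.

Lemma bigcup_box : \bigcup_k box (const_mx (- k%:R)) (const_mx k%:R) = setT.
Proof.
apply/seteqP; split => // x _; exists (Num.bound `|x|) => //= i.
rewrite !mxE -ltr_norml; apply: le_lt_trans (archi_boundP (normr_ge0 x)).
rewrite [leRHS]mx_normrE; apply/bigmax_geP; right => /=.
by exists (0, i).
Qed.

(** The sigma-algebra is generated by coordinate preimages, and there it is enough to treat rays:
    the half-space x_i > t is the union of boxes whose i-th side starts at t while all other sides
    grow. *)
Lemma measurable_rV_boxes : @measurable _ 'rV[R]_n = <<s boxes >>.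
Proof.
apply/seteqP; split => [|A]; last first.
  apply: smallest_sub; first exact: sigma_algebra_measurable.
  by move=> _ [[a b] ->]; exact: measurable_box.
apply: smallest_sub; first exact: smallest_sigma_algebra.
rewrite -bigcup_seq/=; apply: bigcup_sub => i _.
move=> B [C mC <-]; rewrite setTI {B}.
have : (@RGenOInfty.G R).-sigma.-measurable C by rewrite -RGenOInfty.measurableE.
pose S : set (set R) := [set Y | <<s boxes >> (@coordV R n i @^-1` Y)].
suff : <<s (@RGenOInfty.G R) >> `<=` S by move=> h mC'; exact: h.
apply: smallest_sub.
  split => [|A|F mF].
  - by rewrite /S /= preimage_set0; exact: sigma_algebra0.
  - by rewrite /S /= setTD preimage_setC => ?; exact: sigma_algebraC.
  - by rewrite /S /= preimage_bigcup; exact: sigma_algebra_bigcup.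
move=> _ [x ->]; rewrite /S /=.
rewrite (_ : _ @^-1` _ =
    \bigcup_k box (\row_j if j == i then x else - k%:R) (const_mx k%:R)).
  apply: sigma_algebra_bigcup => k; apply: sub_sigma_algebra.
  by eexists (_, _).
apply/seteqP; split => [y /=|y [k _ /= /(_ i)]]; last first.
  by rewrite !mxE eqxx in_itv/= andbT /coordV => /andP[].
rewrite /coordV in_itv/= andbT => xy.
have : (\bigcup_k box (const_mx (- k%:R)) (const_mx k%:R)) y by rewrite bigcup_box.
move=> [k _ /= h]; exists k => //= j; have := h j; rewrite !mxE.
by case: eqVneq => // -> /andP[_ ->]; rewrite xy.
Qed.

Lemma measure_unique_box (m1 m2 : {measure set 'rV[R]_n -> \bar R}) :
  (forall a b, m1 (box a b) = m2 (box a b)) ->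
  (forall a b, (m1 (box a b) < +oo)%E) ->
  forall A, measurable A -> m1 A = m2 A.
Proof.
move=> h1 h2 A mA; apply: (measure_unique boxes
  (fun k => box (const_mx (- k%:R)) (const_mx k%:R))) => //.
- exact: measurable_rV_boxes.
- exact: boxes_setI.
- by move=> k; eexists (_, _).
- exact: bigcup_box.
- by move=> _ [[a b] ->].
Qed.

End boxes.

(** The truncation at 0 covers empty boxes too; they belong to the intersection-stable family on
    which measures are compared. *)
Lemma lebesgue_rV_obox {R : realType} n (a b : 'rV[R]_n) :
  lebesgue_rV R n (box a b) = (\prod_i Num.max 0 (b 0 i - a 0 i))%:E.
Proof.
elim: n a b => [|n IHn] a b.
  by rewrite big_ord0 /= diracE mem_set// => -[].
pose tl (c : 'rV[R]_n.+1) : 'rV[R]_n := \row_i c 0 (lift ord0 i).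
rewrite big_ord_recl /= /lebesgue_next /pushforward.
have pre : (@consrV R n @^-1` box a b) =
    `]a 0 ord0, b 0 ord0[%classic `*` box (tl a) (tl b).
  apply/seteqP; split => [p /= pab|p [/= p0 pab] i].
    split => /= [|i].
      have := pab ord0; rewrite -[consrV p _ _]/(coordV _ (consrV p)).
      by rewrite coord_consrV0 in_itv.
    have := pab (lift ord0 i); rewrite -[consrV p _ _]/(coordV _ (consrV p)).
    by rewrite coord_consrVS !mxE.
  rewrite -[consrV p _ _]/(coordV _ (consrV p)).
  case: (unliftP ord0 i) => [j|] ->.
    by rewrite coord_consrVS; have := pab j; rewrite !mxE.
  by rewrite coord_consrV0; move: p0; rewrite in_itv.
transitivity ((@lebesgue_measure R \x lebesgue_rV R n)%E
    (`]a 0 ord0, b 0 ord0[%classic `*` box (tl a) (tl b))).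
  exact: (congr1 (@lebesgue_measure R \x lebesgue_rV R n)%E pre).
rewrite product_measure1E//=; last exact: measurable_box.
rewrite IHn lebesgue_measure_itv/= lte_fin EFinM; congr (_ * _)%E; last first.
  by congr EFin; apply: eq_bigr => i _; rewrite !mxE.
case: ltP => h; first by rewrite max_r// subr_ge0 ltW.
by rewrite max_l// subr_le0.
Qed.

(** * Translations and dilations *)

Section affine.
Context {R : realType} {n : nat}.
Local Notation mu := (lebesgue_rV R n).
Implicit Types (a b c x y : 'rV[R]_n) (t : R).

Lemma lebesgue_rV_box_lty a b : (mu (box a b) < +oo)%E.
Proof. by rewrite lebesgue_rV_obox ltry. Qed.

Lemma measurable_affine t c :
  measurable_fun setT (fun x : 'rV[R]_n => t *: x + c).
Proof.
apply: measurable_fun_coordP => i.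
rewrite (_ : _ \o _ = fun x => t * coordV i x + c 0 i).
  apply: measurable_funD => //; apply: measurable_funM => //.
  exact: measurable_coord.
by apply/funext => x; rewrite /coordV /= !mxE.
Qed.

(** Both sides are measures in [A]. On a box they agree, since its preimage is a box with sides
    divided by [t], and boxes determine the measure. *)
Lemma lebesgue_rV_affine t c A : 0 < t -> measurable A ->
  mu ((fun x => t *: x + c) @^-1` A) = ((t ^- n)%:E * mu A)%E.
Proof.
move=> t0 mA; have tn0 : 0 <= t ^- n by rewrite invr_ge0 exprn_ge0// ltW.
have mm : measurable_fun setT (fun x : 'rV[R]_n => t *: x + c).
  exact: measurable_affine.
pose m1 := [the {measure set _ -> \bar R} of pushforward mu (fun x => t *: x + c)].
pose m2 := [the {measure set _ -> \bar R} of mscale (NngNum tn0) mu].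
suff : m1 mm A = m2 A by [].
apply: (@measure_unique_box _ _ (m1 mm) m2) => // a b.
  rewrite /= /pushforward /mscale /=.
  rewrite (_ : _ @^-1` _ = box (t^-1 *: (a - c)) (t^-1 *: (b - c))).
    rewrite !lebesgue_rV_obox -EFinM; congr EFin.
    rewrite -exprVn -[in t^-1 ^+ n](card_ord n) -prodr_const -big_split/=.
    apply: eq_bigr => i _; rewrite !mxE -mulrBr maxr_pMr ?invr_ge0 ?ltW//.
    by rewrite mulr0; congr (Num.max _ (_ * _)); ring.
  apply/seteqP; split => x /= h i; have := h i; rewrite !mxE.
    by move=> /andP[h1 h2]; rewrite mulrC ltr_pdivrMr// mulrC ltr_pdivlMl//;
      apply/andP; split; lra.
  by rewrite mulrC ltr_pdivrMr// mulrC ltr_pdivlMl// => /andP[h1 h2];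
    apply/andP; split; lra.
rewrite /= /pushforward.
apply: (@le_lt_trans _ _ (mu (box (t^-1 *: (a - c)) (t^-1 *: (b - c))))).
  apply: le_measure; rewrite ?inE; last 1 first.
  - move=> x /= h i; have := h i; rewrite !mxE.
    by move=> /andP[h1 h2]; rewrite mulrC ltr_pdivrMr// mulrC ltr_pdivlMl//;
      apply/andP; split; lra.
  - by rewrite -[X in measurable X]setTI; apply: mm => //; exact: measurable_box.
  - exact: measurable_box.
exact: lebesgue_rV_box_lty.
Qed.

Lemma ge0_integral_affine t c (f : 'rV[R]_n -> \bar R) : 0 < t ->
  measurable_fun setT f -> (forall x, 0 <= f x)%E ->
  (\int[mu]_x f (t *: x + c)%R = (t ^- n)%:E * \int[mu]_x f x)%E.
Proof.
move=> t0 mf f0; have tn0 : 0 <= t ^- n by rewrite invr_ge0 exprn_ge0// ltW.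
have mm : measurable_fun setT (fun x : 'rV[R]_n => t *: x + c).
  exact: measurable_affine.
have := ge0_integral_pushforward mm mu measurableT mf (fun x _ => f0 x).
rewrite preimage_setT => <-.
have := @ge0_integral_mscale _ _ R mu setT measurableT (NngNum tn0) f.
move=> <-//.
apply: eq_measure_integral => A mA _.
exact: lebesgue_rV_affine.
Qed.

Lemma ge0_integral_translate c (f : 'rV[R]_n -> \bar R) :
  measurable_fun setT f -> (forall x, 0 <= f x)%E ->
  (\int[mu]_x f (x + c)%R = \int[mu]_x f x)%E.
Proof.
move=> mf f0; have := @ge0_integral_affine 1 c f ltr01 mf f0.
by rewrite expr1n invr1 mul1e => <-; apply: eq_integral => x _; rewrite scale1r.
Qed.

Lemma integral_translate c (f : 'rV[R]_n -> \bar R) :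
  measurable_fun setT f ->
  (\int[mu]_x f (x + c)%R = \int[mu]_x f x)%E.
Proof.
move=> mf; rewrite [LHS]integralE [RHS]integralE; congr (_ - _)%E.
  have h := measurable_funepos mf.
  have h' := (@ge0_integral_translate c (f^\+)%E h (funepos_ge0 _)).
  by rewrite -h'; apply: eq_integral => x _; rewrite !funeposE.
have h := measurable_funeneg mf.
have h' := (@ge0_integral_translate c (f^\-)%E h (funeneg_ge0 _)).
by rewrite -h'; apply: eq_integral => x _; rewrite !funenegE.
Qed.

End affine.

(** * Open, closed and compact sets in terms of boxes *)

Section open_rV.
Context {R : realType} {n : nat}.
Local Notation mu := (lebesgue_rV R n).

(** An enumeration of the boxes with rational corners; numbers that code no pair of corners receive
    a default value. *)
Definition qbox (k : nat) : 'rV[R]_n * 'rV[R]_n :=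
  if (unpickle k : option ('rV[rat]_n * 'rV[rat]_n)) is Some p
  then (map_mx ratr p.1, map_mx ratr p.2) else (0, 0).

(** The closed boxes are required to lie in [D], because only then are the bumps on them test
    functions of [D]. *)
Lemma open_bigcup_box (D : set 'rV[R]_n) : open D ->
  D = \bigcup_(k in [set k | cbox (qbox k).1 (qbox k).2 `<=` D])
        box (qbox k).1 (qbox k).2.
Proof.
move=> oD; apply/seteqP; split => [x Dx|x [k /= kD /box_cbox /kD]//].
have /nbhs_ballP[e /= e0 eD] : nbhs x D by exact: open_nbhs_nbhs.
have [lo Hlo] : {lo : 'rV[rat]_n |
    forall i, x 0 i - e < ratr (lo 0 i) < x 0 i}.
  have h i : exists q : rat, x 0 i - e < ratr q < x 0 i.
    have : x 0 i - e < x 0 i by rewrite ltrBlDr ltrDl.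
    by move=> /rat_in_itvoo[q]; rewrite in_itv/= => ?; exists q.
  by exists (\row_i projT1 (cid (h i))) => i; rewrite mxE; case: cid.
have [hi Hhi] : {hi : 'rV[rat]_n |
    forall i, x 0 i < ratr (hi 0 i) < x 0 i + e}.
  have h i : exists q : rat, x 0 i < ratr q < x 0 i + e.
    have : x 0 i < x 0 i + e by rewrite ltrDl.
    by move=> /rat_in_itvoo[q]; rewrite in_itv/= => ?; exists q.
  by exists (\row_i projT1 (cid (h i))) => i; rewrite mxE; case: cid.
exists (pickle (lo, hi)); rewrite /= /qbox pickleK /=.
  move=> y /= hy; apply: eD; split => // i j; rewrite ord1.
  rewrite /ball /=; have := hy j; rewrite !mxE => /andP[y1 y2].
  have /andP[l1 l2] := Hlo j; have /andP[h1 h2] := Hhi j.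
  by rewrite ltr_norml; apply/andP; split; lra.
by move=> i; rewrite !mxE; have /andP[_ ->] := Hlo i; have /andP[-> _] := Hhi i.
Qed.

Lemma open_measurable_rV (D : set 'rV[R]_n) : open D -> measurable D.
Proof.
move=> /open_bigcup_box ->; apply: bigcup_measurable => k _.
exact: measurable_box.
Qed.

Lemma closed_measurable_rV (D : set 'rV[R]_n) : closed D -> measurable D.
Proof.
move=> cD; rewrite -[D]setCK; apply: measurableC; apply: open_measurable_rV.
exact: closed_openC.
Qed.

Lemma open_box (a b : 'rV[R]_n) : open (box a b).
Proof.
have -> := etrans (box_itv a b)
  (bigsetI_coord (fun i => `]a 0 i, b 0 i[%classic)).
elim/big_ind : _ => [|A B|i _]; [exact: openT|exact: openI|].
apply: open_comp; last exact: interval_open.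
by move=> x _; exact: coord_continuous.
Qed.

Lemma compact_cbox (a b : 'rV[R]_n) : compact (cbox a b).
Proof.
rewrite cbox_itv; apply: (@rV_compact R n (fun i => `[a 0 i, b 0 i]%classic)).
by move=> i; exact: segment_compact.
Qed.

Lemma closed_cbox (a b : 'rV[R]_n) : closed (cbox a b).
Proof. exact: compact_closed (@norm_hausdorff _ _) (@compact_cbox a b). Qed.

Lemma compact_sub_box (K : set 'rV[R]_n) : compact K ->
  exists M : R, K `<=` box (const_mx (- M)) (const_mx M).
Proof.
move=> cK; have [M [_ h]] := compact_bounded cK.
exists (`|M| + 2) => x Kx i; rewrite !mxE -ltr_norml.
have /h /(_ x Kx) xM : M < `|M| + 1 by rewrite ltr_pwDr// ler_norm.
apply: (@le_lt_trans _ _ `|x|); last by apply: le_lt_trans xM _; rewrite ltrD2l ltr1n.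
rewrite [leRHS]mx_normrE; apply/bigmax_geP; right => /=.
by exists (0, i).
Qed.

End open_rV.

(** * Smooth bump functions and the fundamental lemma *)

Section bump1.
Context {R : realType}.
Implicit Types (p q : {poly R}) (a b c x t : R) (f g : R -> R).

(* The polynomial factor makes the family closed under differentiation. *)
Definition ebump p c x : R := if 0 < x then p.[x^-1] * expR (- (c / x)) else 0.

(* [e^y] dominates every power of [y], so [ebump p c] vanishes at [0] to first
   order, whatever [p] is. *)
Lemma ebump_le p c : 0 < c ->
  exists2 K : R, 0 <= K & forall x, x < 1 -> `|ebump p c x| <= K * `|x|.
Proof.
move=> c0; pose m := size p.
pose S : R := \sum_(i < m) `|p`_i|.
have S0 : 0 <= S by apply: sumr_ge0.
have cm0 : 0 < c ^+ m.+1 by rewrite exprn_gt0.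
exists (S * (m.+1)`!%:R / c ^+ m.+1) => [|x x1].
  by rewrite divr_ge0 ?mulr_ge0// ltW.
rewrite /ebump; case: ltP => x0; last by rewrite normr0 mulr_ge0// divr_ge0 ?mulr_ge0// ltW.
have y1 : 1 <= x^-1 by rewrite invf_ge1 ?ltW.
have y0 : 0 < x^-1 by rewrite invr_gt0.
rewrite (gtr0_norm x0) normrM (gtr0_norm (expR_gt0 _)) expRN.
have h1 : `|p.[x^-1]| <= S * x^-1 ^+ m.
  rewrite horner_coef (le_trans (ler_norm_sum _ _ _))// mulr_suml ler_sum// => i _.
  rewrite normrM ler_wpM2l// normrX (gtr0_norm y0) ler_weXn2l//.
  exact: ltnW.
have h2 : (c / x) ^+ m.+1 / (m.+1)`!%:R <= expR (c / x).
  by apply: le_trans (expR_ge1Dxn m _); [rewrite lerDr | rewrite divr_ge0// ltW].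
rewrite ler_pdivrMr ?expR_gt0// (le_trans h1)//.
have K0 : 0 <= S * (m.+1)`!%:R / c ^+ m.+1 * x.
  by apply: mulr_ge0; [rewrite divr_ge0 ?mulr_ge0//|]; exact: ltW.
apply: le_trans (ler_wpM2l K0 h2).
rewrite le_eqVlt; apply/orP; left; apply/eqP.
rewrite expr_div_n !exprSr exprVn.
by field; rewrite !lt0r_neq0 ?exprn_gt0 ?ltr0n ?fact_gt0.
Qed.

(** With y = 1/x, the function p(y) exp(-c y) has the x-derivative y^2 (c p(y) - p'(y)) exp(-c y),
    which is again of this form. *)
Lemma ebump_is_derive p c x : 0 < c ->
  is_derive x 1 (ebump p c) (ebump ('X ^+ 2 * (c *: p - p^`())) c x).
Proof.
move=> c0; have [x0|x0|->] := ltgtP x 0.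
- have -> : ebump ('X ^+ 2 * (c *: p - p^`())) c x = 0.
    by rewrite /ebump ltNge (ltW x0).
  apply: (@near_eq_is_derive _ _ _ (cst 0)).
  near=> y; rewrite /ebump ltNge ifF//; apply/negbF/ltW; near: y.
  exact: lt_nbhsl.
- apply: (@near_eq_is_derive _ _ _ (fun x => p.[x^-1] * expR (- (c / x)))).
    near=> y; rewrite /ebump ifT//; near: y; exact: lt_nbhsr.
  have xn0 : x != 0 by rewrite gt_eqF.
  have d1 : is_derive x 1 (fun y : R => y^-1) (- x ^- 2 *: 1).
    exact: (@is_deriveV _ id).
  have d2 : is_derive x 1 (fun y => p.[y^-1]) (p^`().[x^-1] * (- x ^- 2 *: 1)).
    exact: (is_derive1_comp (is_derive_poly p x^-1)).
  have d3 : is_derive x 1 (fun y : R => - (c / y)) (- (c *: (- x ^- 2 *: 1))).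
    exact: (is_deriveN (is_deriveZ c d1)).
  have d4 : is_derive x 1 (fun y : R => expR (- (c / y)))
      (expR (- (c / x)) * (- (c *: (- x ^- 2 *: 1)))).
    exact: (is_derive1_comp (is_derive_expR _) d3).
  apply: is_derive_eq (is_deriveM d2 d4) _.
  rewrite /ebump x0 !hornerE /= /GRing.scale /=.
  by rewrite exprVn; ring.
- have -> : ebump ('X ^+ 2 * (c *: p - p^`())) c 0 = 0 by rewrite /ebump ltxx.
  (* The difference quotient of [ebump p c] at 0 is [ebump ('X * p) c], to which the linear bound
     applies. *)
  have [K K0 hK] := ebump_le ('X * p) c0.
  have lim0 : (fun h : R => h^-1 *: ((ebump p c \o shift 0) (h *: 1) - ebump p c 0))
      @ 0^' --> (0 : R).
    apply/cvgrPdist_le => /= e e0; near=> h.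
    rewrite sub0r normrN /= addr0 [h *: 1]mulr1.
    have -> : ebump p c 0 = 0 by rewrite /ebump ltxx.
    rewrite subr0.
    have -> : h^-1 *: ebump p c h = ebump ('X * p) c h.
      rewrite /ebump; case: ifPn => _; last by rewrite scaler0.
      by rewrite !hornerE -mulrA.
    apply: le_trans (hK _ _) _.
      near: h; apply: nbhs_dnbhs; exact: (lt_nbhsl ltr01).
    apply: (@le_trans _ _ ((K + 1) * `|h|)); first by rewrite ler_wpM2r// lerDl.
    have K1 : 0 < K + 1 by rewrite ltr_wpDl.
    rewrite -ler_pdivlMl//; near: h; apply: dnbhs0_le.
    by rewrite mulr_gt0 ?invr_gt0 ?ltr_wpDl.
  apply: DeriveDef; first by apply/cvg_ex; exists 0.
  exact: cvg_lim lim0.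
Unshelve. all: by end_near. Qed.

Lemma ebump_ge0 c x : 0 <= ebump 1 c x.
Proof. by rewrite /ebump; case: ifP => // _; rewrite hornerC mul1r expR_ge0. Qed.

Lemma ebump_le1 c x : 0 < c -> ebump 1 c x <= 1.
Proof.
move=> c0; rewrite /ebump; case: ifPn => // x0; rewrite hornerC mul1r.
by rewrite expR_le1 oppr_le0 divr_ge0// ltW.
Qed.

Lemma ebump_eq0 c x : (ebump 1 c x != 0) = (0 < x).
Proof.
rewrite /ebump; case: ifPn => [x0|]; last by rewrite eqxx.
by rewrite hornerC mul1r gt_eqF// expR_gt0.
Qed.

Lemma ebump_cvg1 x : 0 < x -> ebump 1 (k.+1%:R^-1) x @[k --> \oo] --> (1 : R).
Proof.
move=> x0; rewrite /ebump x0 hornerC.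
under eq_fun do rewrite mul1r.
have h : - (k.+1%:R^-1 / x) @[k --> \oo] --> - (0 * x^-1 : R).
  by apply: cvgN; apply: cvgM; [exact: cvg_harmonic|exact: cvg_cst].
have := @continuous_cvg _ _ _ _ _ _ _ _ (@continuous_expR R (- (0 / x))) h.
by rewrite mul0r oppr0 expR0 => H; exact: H.
Qed.

(** A class that is closed under differentiation by construction, so that derivatives of all orders
    exist as soon as the first one stays in the class. Sums enter through the product rule; the
    affine substitution provides both ends of a bump. *)
Inductive smooth1 : (R -> R) -> Prop :=
| Smooth1_ebump p c s t : 0 < c -> smooth1 (fun x => ebump p c (s * x + t))
| Smooth1_mul f g : smooth1 f -> smooth1 g -> smooth1 (fun x => f x * g x)
| Smooth1_add f g : smooth1 f -> smooth1 g -> smooth1 (fun x => f x + g x).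

Lemma smooth1_is_derive f : smooth1 f ->
  exists2 f', smooth1 f' & forall x, is_derive x 1 f (f' x).
Proof.
elim=> {f} [p c s t c0|f g sf [f' sf' df] sg [g' sg' dg]|
  f g sf [f' sf' df] sg [g' sg' dg]].
- exists (fun x => ebump (s *: ('X ^+ 2 * (c *: p - p^`()))) c (s * x + t)).
    exact: Smooth1_ebump.
  move=> x.
  have d1 : is_derive x 1 (fun y => s * y + t) (s *: 1 + 0).
    exact: (is_deriveD (is_deriveZ s (is_derive_id _ _)) (is_derive_cst _ _ _)).
  apply: is_derive_eq (is_derive1_comp (ebump_is_derive p _ c0) d1) _.
  rewrite addr0 [s *: 1]mulr1 /ebump; case: ifP => _; last by rewrite mul0r.
  by rewrite hornerZ; ring.
- exists (fun x => f x * g' x + g x * f' x); last by move=> x; exact: is_deriveM.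
  by apply: Smooth1_add; exact: Smooth1_mul.
- exists (fun x => f' x + g' x); last by move=> x; exact: is_deriveD.
  exact: Smooth1_add.
Qed.

Definition bump1 c a b x : R := ebump 1 c (x - a) * ebump 1 c (b - x).

Lemma smooth1_bump1 c a b : 0 < c -> smooth1 (bump1 c a b).
Proof.
move=> c0; rewrite /bump1; apply: Smooth1_mul.
  rewrite (_ : (fun x : R => _) = (fun x => ebump 1 c (1 * x + - a))).
    exact: Smooth1_ebump.
  by apply/funext => x; rewrite mul1r.
rewrite (_ : (fun x : R => _) = (fun x => ebump 1 c (-1 * x + b))).
  exact: Smooth1_ebump.
by apply/funext => x; rewrite mulN1r addrC.
Qed.

Lemma bump1_ge0 c a b x : 0 <= bump1 c a b x.
Proof. by rewrite mulr_ge0 ?ebump_ge0. Qed.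

Lemma bump1_le1 c a b x : 0 < c -> bump1 c a b x <= 1.
Proof. by move=> c0; rewrite /bump1 mulr_ile1 ?ebump_ge0 ?ebump_le1. Qed.

Lemma bump1_neq0 c a b x : (bump1 c a b x != 0) = (a < x < b).
Proof. by rewrite /bump1 mulf_eq0 negb_or !ebump_eq0 !subr_gt0. Qed.

Lemma bump1_cvg1 a b x : a < x < b ->
  bump1 (k.+1%:R^-1) a b x @[k --> \oo] --> (1 : R).
Proof.
move=> /andP[ax xb]; suff : bump1 (k.+1%:R^-1) a b x @[k --> \oo] --> (1 * 1 : R).
  by rewrite mulr1.
by apply: cvgM; apply: ebump_cvg1; rewrite subr_gt0.
Qed.

Lemma bump1_shift c a b x t : bump1 c a b (x - t) = bump1 c (a + t) (b + t) x.
Proof. by rewrite /bump1; congr (ebump _ _ _ * ebump _ _ _); ring. Qed.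

End bump1.

Lemma is_derive_prod1 {R : realType} (I : eqType) (r : seq I)
    (F : I -> R -> R) (dF : I -> R) (t : R) :
  uniq r -> (forall i, is_derive t 1 (F i) (dF i)) ->
  is_derive t 1 (fun h => \prod_(i <- r) F i h)
    (\sum_(j <- r) \prod_(i <- r) (if i == j then dF i else F i t)).
Proof.
move=> + dF1; elim: r => [_|k r IH /= /andP[kr ur]].
  rewrite (_ : (fun h : R => _) = cst 1); last by apply/funext => h; rewrite big_nil.
  by rewrite big_nil; exact: is_derive_cst.
rewrite (_ : (fun h : R => _) = (F k * (fun h => \prod_(i <- r) F i h))); last first.
  by apply/funext => h; rewrite big_cons.
apply: is_derive_eq (is_deriveM (dF1 k) (IH ur)) _.
rewrite big_cons addrC; congr (_ + _).
  rewrite big_cons eqxx mulrC; congr (_ * _).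
  by apply: eq_big_seq => i ir; rewrite ifN//; apply: contraNneq kr => <-.
rewrite [_ *: _]mulr_sumr; apply: eq_big_seq => j jr.
by rewrite big_cons ifN//; apply: contraNneq kr => ->.
Qed.

Section prod_fun.
Context {R : realType} {n : nat}.
Implicit Types (psi : 'I_n -> R -> R) (a b c x v h : 'rV[R]_n).

Definition prodf psi x : R := \prod_i psi i (x 0 i).

Lemma is_derive_line (f : 'rV[R]_n -> R) x v df :
  is_derive (0 : R) 1 (fun h : R => f (h *: v + x)) df -> is_derive x v f df.
Proof.
case=> ex dv; split; first exact: (derivable1P f x v).2 ex.
rewrite -dv /derive; set g1 := fun h : R => h^-1 *: _; set g2 := fun h : R => h^-1 *: _.
suff -> : g1 = g2 by [].
apply/funext => h; rewrite /g1 /g2 /=.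
by rewrite addr0 scale0r add0r [_%:A]mulr1.
Qed.

Lemma is_derive_prodf_line psi psi' x v (t : R) :
  (forall i (s : R), is_derive s 1 (psi i) (psi' i s)) ->
  is_derive (t : R) 1 (fun h : R => prodf psi (h *: v + x))
    (\sum_j v 0 j * prodf (fun i => if i == j then psi' i else psi i) (t *: v + x)).
Proof.
move=> d1.
have d2 i : is_derive t 1 (fun h : R => psi i ((h *: v + x) 0 i))
    (psi' i ((t *: v + x) 0 i) * v 0 i).
  rewrite (_ : (fun h : R => _) = psi i \o (fun h : R => h * v 0 i + x 0 i)); last first.
    by apply/funext => h; rewrite /= !mxE.
  apply: is_derive1_comp; first by rewrite !mxE; exact: d1.
  have : is_derive t 1 (fun h : R => h * v 0 i + x 0 i) ((t *: 0 + v 0 i *: 1) + 0).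
    apply: is_deriveD; apply: is_deriveM.
  by rewrite scaler0 add0r addr0 [_ *: 1]mulr1.
apply: is_derive_eq (is_derive_prod1 (index_enum_uniq _) d2) _.
apply: eq_bigr => j _; rewrite /prodf (bigD1 j)//= eqxx [in RHS](bigD1 j)//= eqxx.
rewrite mulrA [v 0 j * _]mulrC; congr (_ * _).
by apply: eq_bigr => i /negbTE ->.
Qed.

Lemma is_derive_prodf psi psi' x v :
  (forall i (s : R), is_derive s 1 (psi i) (psi' i s)) ->
  is_derive x v (prodf psi)
    (\sum_j v 0 j * prodf (fun i => if i == j then psi' i else psi i) x).
Proof.
move=> d1; apply: is_derive_line.
by have := is_derive_prodf_line x v 0 d1; rewrite scale0r add0r.
Qed.

Lemma continuous_prodf psi : (forall i, continuous (psi i)) ->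
  continuous (prodf psi).
Proof.
move=> cpsi; rewrite /prodf; elim: (index_enum _) => [|k r IH].
  rewrite (_ : (fun x => _) = cst 1); first exact: cst_continuous.
  by apply/funext => x; rewrite big_nil.
rewrite (_ : (fun x => _) = (fun x => psi k (x 0 k) * \prod_(i <- r) psi i (x 0 i))).
  move=> x; apply: (@continuousM R _ (fun x => psi k (x 0 k))); last exact: IH.
  exact: (@continuous_comp _ _ _ (fun y : 'rV[R]_n => y 0 k) (psi k) x
    (@coord_continuous _ _ _ 0 k x) (cpsi k (x 0 k))).
by apply/funext => x; rewrite big_cons.
Qed.

Lemma smooth1_choice psi : (forall i, smooth1 (psi i)) ->
  exists2 psi', forall i, smooth1 (psi' i) &
    forall i (s : R), is_derive s 1 (psi i) (psi' i s).
Proof.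
move=> h; have /choice[psi' h'] i : exists f', smooth1 f' /\
    forall s : R, is_derive s 1 (psi i) (f' s).
  by have [f' ? ?] := smooth1_is_derive (h i); exists f'.
by exists psi' => i; have [] := h' i.
Qed.

Lemma sum_delta (j : 'I_n) (F : 'I_n -> R) :
  \sum_k (delta_mx 0 j : 'rV[R]_n) 0 k * F k = F j.
Proof.
rewrite (bigD1 j)//= big1 => [|k kj]; first by rewrite mxE !eqxx mul1r addr0.
by rewrite mxE (negbTE kj) mul0r.
Qed.

Lemma partial_prodf psi psi' (j : 'I_n) :
  (forall i (s : R), is_derive s 1 (psi i) (psi' i s)) ->
  partial j (prodf psi) = prodf (fun i => if i == j then psi' i else psi i).
Proof.
move=> d1; apply/funext => x; rewrite /partial.
by have [_ ->] := is_derive_prodf x (delta_mx 0 j) d1; rewrite sum_delta.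
Qed.

(** A partial derivative of a product of one-variable functions is again such a product, with one
    factor differentiated. Hence all iterated partials keep this shape and smoothness reduces to one
    variable. *)
Lemma smooth_prodf psi : (forall i, smooth1 (psi i)) -> smooth (prodf psi).
Proof.
move=> spsi s.
have [chi schi ->] : exists2 chi, (forall i, smooth1 (chi i)) &
    foldr partial (prodf psi) s = prodf chi.
  elim: s => [|j s [chi schi IH]] /=; first by exists psi.
  have [chi' schi' dchi] := smooth1_choice schi.
  rewrite IH (partial_prodf j dchi).
  exists (fun i => if i == j then chi' i else chi i) => // i.
  by case: ifP.
have [chi' schi' dchi] := smooth1_choice schi.
split => [|i x]; last by case: (is_derive_prodf x (delta_mx 0 i) dchi).
apply: continuous_prodf => i s'; apply: differentiable_continuous.
by apply/derivable1_diffP; case: (dchi i s').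
Qed.

Definition bump (c : R) a b : 'rV[R]_n -> R :=
  prodf (fun i => bump1 c (a 0 i) (b 0 i)).

Lemma bump_neq0 (c : R) a b : [set x | bump c a b x != 0] = box a b.
Proof.
apply/seteqP; split => x /=; rewrite /bump /prodf.
  by move=> /prodf_neq0 h i; rewrite -(bump1_neq0 c); exact: h.
by move=> h; apply/prodf_neq0 => i _; rewrite bump1_neq0.
Qed.

Lemma test_fun_bump (D : set 'rV[R]_n) (c : R) a b : 0 < c ->
  cbox a b `<=` D -> test_fun D (bump c a b).
Proof.
move=> c0 abD; rewrite /test_fun bump_neq0.
have cl : closure (box a b) `<=` cbox a b.
  rewrite [X in _ `<=` X]((closure_id _).1 (@closed_cbox _ _ a b)).
  by apply: closure_subset; exact: box_cbox.
split; last exact: subset_trans cl abD.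
  by apply: smooth_prodf => i; exact: smooth1_bump1.
by apply: subclosed_compact (@compact_cbox _ _ a b) cl; exact: closed_closure.
Qed.

Lemma bump_ge0 (c : R) a b x : 0 <= bump c a b x.
Proof. by apply: prodr_ge0 => i _; exact: bump1_ge0. Qed.

Lemma bump_le1 (c : R) a b x : 0 < c -> bump c a b x <= 1.
Proof.
move=> c0; apply: prodr_ile1 => i _.
by rewrite bump1_ge0 bump1_le1.
Qed.

Lemma bump_cvg a b x : bump (k.+1%:R^-1) a b x @[k --> \oo] --> (\1_(box a b) x : R).
Proof.
rewrite indicE; case: (boolP (x \in box a b)) => [/set_mem xab|xab].
  rewrite /bump /prodf; elim: (index_enum _) => [|j r IH].
    by under eq_fun do rewrite big_nil; exact: cvg_cst.
  under eq_fun do rewrite big_cons.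
  rewrite -[nbhs _](congr1 nbhs (mulr1 (1 : R))); apply: cvgM => //.
  by apply: bump1_cvg1; exact: xab.
rewrite (_ : (fun k => _) = cst 0); first exact: cvg_cst.
apply/funext => k /=; apply/eqP/negP => /negP h; move/negP: xab; apply.
by apply/mem_set; rewrite -(bump_neq0 k.+1%:R^-1).
Qed.

End prod_fun.

Lemma derivable_ext_at {R : realType} (f : R -> R) (x : R) :
  derivable f x 1 -> {for x, continuous f}.
Proof. by move=> /derivable1_diffP /differentiable_continuous. Qed.

Lemma integrable_Rintegral_eq0 d (T : measurableType d) (R : realType)
    (mu : {measure set T -> \bar R}) (D : set T) (f : T -> R) :
  measurable D -> mu.-integrable D (EFin \o f) ->
  \int[mu]_(x in D) f x = 0 -> (\int[mu]_(x in D) (f x)%:E = 0)%E.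
Proof.
move=> mD fi f0; rewrite -(fineK (integrable_fin_num mD fi)).
by congr EFin; rewrite -[RHS]f0.
Qed.

Lemma is_derive_line_at {R : realType} {n : nat} (f : 'rV[R]_n -> R) x v (t : R) :
  derivable f (t *: v + x) v ->
  is_derive t 1 (fun s : R => f (s *: v + x)) ('D_v f (t *: v + x)).
Proof.
pose g1 (h : R) := h^-1 *: (f (h *: v + (t *: v + x)) - f (t *: v + x)).
pose g2 (h : R) := h^-1 *: (f ((h *: 1 + t) *: v + x) - f (t *: v + x)).
have g12 : g1 = g2.
  by apply/funext => h; rewrite /g1 /g2 scalerDl addrA [h *: 1]mulr1.
move=> df; apply: DeriveDef.
  by rewrite /derivable /= -/g2 -g12.
by rewrite /derive /= -/g2 -g12.
Qed.

Lemma cvg_harmonic_dnbhs {R : realType} :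
  (fun k : nat => k.+1%:R^-1 : R) @ \oo --> (0 : R)^'.
Proof.
move=> A A0; suff : \forall k \near \oo, A (k.+1%:R^-1 : R) by [].
have h : \forall k \near \oo, (k.+1%:R^-1 : R) != 0 -> A k.+1%:R^-1.
  exact: (@cvg_harmonic R _ A0).
by apply: filterS h => k; apply; rewrite invr_neq0 ?pnatr_eq0.
Qed.

(** * Continuous functions of bounded support *)

Section continuous_rV.
Context {R : realType} {n : nat}.
Local Notation mu := (lebesgue_rV R n).
Implicit Types (D : set 'rV[R]_n) (f g F : 'rV[R]_n -> R) (M : R).

Lemma continuous_measurable_rV f D : continuous f -> measurable_fun D f.
Proof.
move=> cf; apply: (@measurable_funS _ _ _ _ setT) => //.
apply: (measurability _ (RGenOInfty.measurableE R)) => // _ [_ [x ->] <-].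
rewrite setTI; apply: open_measurable_rV; apply: open_comp.
  by move=> y _; exact: cf.
exact: interval_open.
Qed.

Definition cube M : set 'rV[R]_n := box (const_mx (- M)) (const_mx M).

(** The support is controlled by a numeric cube instead of a compact closure, which makes dominating
    functions explicit. *)
Definition ccont f : Prop :=
  continuous f /\ exists M : R, forall x : 'rV[R]_n, ~ cube M x -> f x = 0.

Lemma cube_subset M M' : M <= M' -> cube M `<=` cube M'.
Proof.
move=> MM' x /= h i; have := h i; rewrite !mxE => /andP[h1 h2].
by apply/andP; split; lra.
Qed.

Lemma continuous_cube_bounded f M : continuous f ->
  exists2 C : R, 0 <= C & forall x, cube M x -> `|f x| <= C.
Proof.
move=> cf; have := @compact_cbox R n (const_mx (- M)) (const_mx M).
move=> /(continuous_compact (continuous_subspaceT cf)) /compact_bounded.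
move=> [C [_ hC]]; exists (`|C| + 1) => [|x xM]; first by rewrite addr_ge0.
apply: (hC (`|C| + 1)); first by rewrite ltr_pwDr// ler_norm.
by exists x => //; exact: box_cbox.
Qed.

Lemma ccont_bounded f : ccont f -> exists2 C : R, 0 <= C & forall x, `|f x| <= C.
Proof.
move=> [cf [M fM]]; have [C C0 hC] := continuous_cube_bounded M cf.
exists C => // x; have [xM|xM] := pselect (cube M x); first exact: hC.
by rewrite fM// normr0.
Qed.

Lemma ccontM f g : ccont f -> continuous g -> ccont (fun x => f x * g x).
Proof.
move=> [cf [M fM]] cg; split; last by exists M => x /fM ->; rewrite mul0r.
by move=> x; apply: (@continuousM R _ f g x (cf x) (cg x)).
Qed.

Lemma ccontD f g : ccont f -> ccont g -> ccont (fun x => f x + g x).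
Proof.
move=> [cf [M fM]] [cg [M' gM]]; split.
  by move=> x; exact: (@continuousD R _ _ f g x (cf x) (cg x)).
exists (Num.max M M') => x h; rewrite fM ?gM ?addr0// => hx; apply: h.
  by apply: cube_subset hx; rewrite le_max lexx orbT.
by apply: cube_subset hx; rewrite le_max lexx.
Qed.

Lemma ccont_integrable f : ccont f -> mu.-integrable setT (EFin \o f).
Proof.
move=> cf; have [C C0 fC] := ccont_bounded cf; have [cont [M fM]] := cf.
have mM : measurable (cube M) by exact: measurable_box.
apply: (@eq_integrable _ _ _ _ _ _ ((EFin \o f) \_ (cube M))) => // [x _|].
  rewrite patchE; case: ifPn => // /negP xM; rewrite /= fM// => h.
  by apply: xM; exact/mem_set.
apply/(integrable_mkcond _ mM).1; apply: measurable_bounded_integrable => //.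
- exact: lebesgue_rV_box_lty.
- exact: continuous_measurable_rV.
- exists C; split; first exact: num_real.
  by move=> x Cx y _; exact: le_trans (fC y) (ltW Cx).
Qed.

(** By translation invariance every difference quotient of [F] has integral zero. The quotients are
    bounded by the mean value theorem and vanish outside a common cube, so dominated convergence
    carries the value zero over to the derivative. *)
Lemma integral_ccont_partial F (i : 'I_n) : ccont F -> ccont (partial i F) ->
  (forall x, derivable F x (delta_mx 0 i)) -> \int[mu]_x partial i F x = 0.
Proof.
move=> cF cdF dF; have [C C0 hC] := ccont_bounded cdF.
have [contF [M FM]] := cF.
pose h k : 'rV[R]_n := k.+1%:R^-1 *: delta_mx 0 i.
pose q k (x : 'rV[R]_n) := k.+1%:R * (F (x + h k) - F x).
have mF : measurable_fun setT (EFin \o F).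
  by apply/measurable_EFinP; exact: continuous_measurable_rV.
have mFh k : measurable_fun setT (fun x : 'rV[R]_n => F (x + h k)).
  apply: continuous_measurable_rV => x.
  apply: (@continuous_comp _ _ _ (fun y : 'rV[R]_n => y + h k) F); last exact: contF.
  apply: (@continuousD R _ 'rV[R]_n id (cst (h k)) x); first exact: cvg_id.
  exact: cst_continuous.
have iF := ccont_integrable cF.
have iFh k : mu.-integrable setT (EFin \o (fun x : 'rV[R]_n => F (x + h k))).
  apply/integrableP; split; first exact/measurable_EFinP.
  rewrite (ge0_integral_translate (h k) (f := fun x => `|(F x)%:E|%E))//.
    by case/integrableP : iF.
  exact: measurableT_comp.
have q0 k : (\int[mu]_x (q k x)%:E = 0)%E.
  rewrite /q; under eq_integral do rewrite EFinM.
  rewrite integralZl//; last exact: (integrableB measurableT (iFh k) iF).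
  rewrite integralB_EFin// (integral_translate (h k) mF).
  by rewrite subee ?mule0// integrable_fin_num.
have hk0 k : 0 < k.+1%:R^-1 :> R by rewrite invr_gt0.
have line (x : 'rV[R]_n) (t : R) : is_derive t 1
    (fun s : R => F (s *: delta_mx 0 i + x)) (partial i F (t *: delta_mx 0 i + x)).
  exact: is_derive_line_at.
have qC k x : `|q k x| <= C.
  have [c _ e] := @MVT R (fun s : R => F (s *: delta_mx 0 i + x))
    (fun s => partial i F (s *: delta_mx 0 i + x)) 0 k.+1%:R^-1 (hk0 k)
    (fun t _ => line x t)
    (continuous_subspaceT (fun t => derivable_ext_at (@ex_derive _ _ _ _ _ _ _ (line x t)))).
  move: e; rewrite scale0r add0r subr0 [_ + x]addrC -/(h k) => e.
  by rewrite /q e [_ * k.+1%:R^-1]mulrC mulrA divff// mul1r; exact: hC.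
have qcvg x : q k x @[k --> \oo] --> partial i F x.
  have := cvg_comp _ _ (@cvg_harmonic_dnbhs R) (dF x).
  rewrite -[lim _]/(partial i F x); apply: cvg_trans.
  apply: near_eq_cvg; apply: nearW => k.
  by rewrite /q /= invrK [_ *: _ + x]addrC.
(* The steps 1/(k+1) are at most 1, so all difference quotients vanish outside [cube (M + 1)]. *)
have mB : measurable (cube (M + 1)) by exact: measurable_box.
have [|||||_ _ H] := @dominated_convergence _ _ _ mu setT measurableT
  (fun k => EFin \o q k) (EFin \o partial i F) ((cst C%:E) \_ (cube (M + 1))).
- move=> k; apply/measurable_EFinP; apply: measurable_funM => //.
  by apply: measurable_funB => //; exact/measurable_EFinP.
- by apply/measurable_EFinP; apply: continuous_measurable_rV; case: cdF.
- by apply: aeW => x _; apply: cvg_EFin; [exact: nearW|exact: qcvg].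
- apply/(integrable_mkcond _ mB).1.
  apply: (@measurable_bounded_integrable _ _ _ _ (cst C)) => //.
    exact: lebesgue_rV_box_lty.
  exists C; split; first exact: num_real.
  by move=> x Cx y _ /=; rewrite (ger0_norm C0) ltW.
- apply: aeW => x k _; rewrite patchE; case: ifPn => xM /=; first by rewrite lee_fin.
  have xM1 : ~ cube (M + 1) x by move/mem_set; exact/negP.
  rewrite lee_fin /q FM; last first.
    move=> xh; apply: xM1 => j; have := xh j; rewrite !mxE.
    set e : R := (_ && _)%:R; move=> /andP[h1 h2].
    have e0 : 0 <= k.+1%:R^-1 * e by rewrite mulr_ge0.
    have e1 : k.+1%:R^-1 * e <= 1.
      by apply: mulr_ile1 => //; rewrite ?invf_le1 ?ler1n// /e; case: (_ && _).
    move: (k.+1%:R^-1 * e) e0 e1 h1 h2 => t e0 e1 h1 h2.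
    by apply/andP; split; lra.
  rewrite FM; first by rewrite subrr mulr0 normr0.
  by move=> xM'; apply: xM1; apply: cube_subset xM'; rewrite lerDl.
have : (\int[mu]_x (partial i F x)%:E = 0)%E.
  rewrite -(cvg_lim _ H)//; apply: lim_near_cst => //.
  by apply: nearW => k; exact: q0.
by rewrite /Rintegral => ->.
Qed.

End continuous_rV.

(** * The fundamental lemma of the calculus of variations *)

Section fundamental.
Context {R : realType} {n : nat}.
Local Notation mu := (lebesgue_rV R n).
Implicit Types (D : set 'rV[R]_n) (a b x : 'rV[R]_n) (f g : 'rV[R]_n -> R).

Lemma continuous_bump (c : R) a b : 0 < c -> continuous (bump c a b).
Proof.
by move=> c0; case: (@smooth_prodf R n _ (fun i => smooth1_bump1 (a 0 i) (b 0 i) c0) [::]).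
Qed.

Lemma integrableM_bump D g (c : R) a b : 0 < c -> measurable D ->
  mu.-integrable D (EFin \o g) ->
  mu.-integrable D (EFin \o (fun x => g x * bump c a b x)).
Proof.
move=> c0 mD gi; apply: (le_integrable mD _ _ gi).
  apply/measurable_EFinP; apply: measurable_funM.
    by apply/measurable_EFinP; exact: measurable_int gi.
  by apply: continuous_measurable_rV; exact: continuous_bump.
move=> x _ /=; rewrite lee_fin normrM ler_piMr// ger0_norm ?bump_ge0//.
exact: bump_le1.
Qed.

Lemma integral_bump_box D g (c : R) a b : cbox a b `<=` D ->
  \int[mu]_(x in D) (g x * bump c a b x) =
  \int[mu]_(x in box a b) (g x * bump c a b x).
Proof.
move=> abD; rewrite Rintegral_mkcond [RHS]Rintegral_mkcond.
congr (Rintegral _ _ _); apply/funext => x; rewrite !patchE.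
case: ifPn => xD; case: ifPn => xab //.
- apply/eqP; rewrite mulf_eq0; apply/orP; right; apply/negPn/negP => h.
  by move/negP: xab; apply; apply/mem_set; rewrite -(bump_neq0 c).
- move/negP: xD; case; apply/mem_set/abD/box_cbox; exact: set_mem xab.
Qed.

Lemma integral_box_eq0 D g : measurable D ->
  (forall a b, cbox a b `<=` D -> mu.-integrable (cbox a b) (EFin \o g)) ->
  (forall (c : R) a b, 0 < c -> cbox a b `<=` D ->
    \int[mu]_(x in D) (g x * bump c a b x) = 0) ->
  forall a b, cbox a b `<=` D -> (\int[mu]_(x in box a b) (g x)%:E = 0)%E.
Proof.
move=> mD gi g0 a b abD; have mab := @measurable_box R n a b.
have gab : mu.-integrable (box a b) (EFin \o g).
  by apply: integrableS (gi _ _ abD) => //; [exact: measurable_cbox|exact: box_cbox].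
have mg : measurable_fun (box a b) g.
  by apply/measurable_EFinP; exact: measurable_int gab.
have k0 k : 0 < k.+1%:R^-1 :> R by rewrite invr_gt0.
have [||||| _ _ H] := @dominated_convergence _ _ _ mu (box a b) mab
  (fun k => EFin \o (fun x => g x * bump k.+1%:R^-1 a b x)) (EFin \o g)
  (abse \o (EFin \o g)).
- by move=> k; apply: measurable_int (integrableM_bump a b (k0 k) mab gab).
- exact/measurable_EFinP.
- apply: aeW => x xab; apply: cvg_EFin; first exact: nearW.
  rewrite /comp /=.
  have hg : g x @[_ --> \oo] --> g x by exact: cvg_cst.
  have hb := @bump_cvg R n a b x; rewrite indicE mem_set//= in hb.
  by have := cvgM hg hb; rewrite mulr1; apply.
- exact: integrable_abse.
- apply: aeW => x k _ /=; rewrite lee_fin normrM ler_piMr// ger0_norm ?bump_ge0//.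
  exact: bump_le1.
rewrite -(cvg_lim _ H)//; apply: lim_near_cst => //; apply: nearW => k /=.
apply: integrable_Rintegral_eq0 => //; first exact: integrableM_bump.
by rewrite -(integral_bump_box _ _ abD) g0.
Qed.

(** The sets E for which [g] has integral zero over the part of E in the box form a Dynkin system.
    It contains the boxes, which are stable under intersection, hence all measurable sets. *)
Lemma integral_box_ae0 g a b : mu.-integrable (box a b) (EFin \o g) ->
  (forall a' b', box a' b' `<=` box a b ->
    (\int[mu]_(x in box a' b') (g x)%:E = 0)%E) ->
  {ae mu, forall x, box a b x -> g x = 0}.
Proof.
move=> gi g0; have mab := @measurable_box R n a b.
have int0 E : measurable E -> (\int[mu]_(x in box a b `&` E) (g x)%:E = 0)%E.
  rewrite measurable_rV_boxes => mE.
  apply: (@dynkin_induction _ _ (@boxes R n)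
    (fun E => \int[mu]_(x in box a b `&` E) (g x)%:E = 0)%E) mE.
  - exact: measurable_rV_boxes.
  - exact: boxes_setI.
  - by rewrite setIT; exact: g0.
  - by move=> _ [[a' b'] ->] /=; rewrite boxI; apply: g0; rewrite -boxI; exact: subIsetl.
  - move=> S mS S0.
    have : (\int[mu]_(x in (box a b `&` S) `|` (box a b `&` ~` S)) (g x)%:E = 0)%E.
      by rewrite -setIUr setUv setIT; exact: g0.
    rewrite integral_setU//.
    + by rewrite S0 add0e.
    + exact: measurableI.
    + by apply: measurableI => //; exact: measurableC.
    + rewrite -setIUr setUv setIT; exact: measurable_int gi.
    + by rewrite disj_set2E -setIIr setICr setI0.
  - move=> F mF tF F0; rewrite setI_bigcupr integral_bigcup.
    + by rewrite eseries0// => k _ _; exact: F0.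
    + by apply: trivIset_setIl.
    + by move=> k; exact: measurableI.
    + apply: integrableS gi => //; last by rewrite -setI_bigcupr; exact: subIsetl.
      by apply: bigcupT_measurable => k; exact: measurableI.
have : ae_eq mu (box a b) (EFin \o g) (cst 0%E).
  apply: integral_ae_eq => // E Eab mE; rewrite integral0.
  by rewrite -(int0 E mE) setIidr.
by apply: filterS => x h /h [].
Qed.

(** Only countably many rational boxes are needed to fill [D], so the exceptional sets add up to a
    null set. *)
Lemma ae_open D (P : 'rV[R]_n -> Prop) : open D ->
  (forall a b, cbox a b `<=` D -> {ae mu, forall x, box a b x -> P x}) ->
  {ae mu, forall x, D x -> P x}.
Proof.
move=> oD h.
have : {ae mu, forall x, forall k, cbox (@qbox R n k).1 (qbox k).2 `<=` D ->
    box (@qbox R n k).1 (qbox k).2 x -> P x}.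
  apply/ae_foralln => k.
  have [kD|kD] := pselect (cbox (@qbox R n k).1 (qbox k).2 `<=` D).
    by apply: filterS (h _ _ kD) => x.
  by apply: aeW => x /kD.
apply: filterS => x hx; rewrite {1}(open_bigcup_box oD) => -[k kD xk].
exact: hx kD xk.
Qed.

(* As c tends to 0, the bumps converge to the indicators of their boxes. *)
Lemma fundamental_lemma D g : open D ->
  (forall a b, cbox a b `<=` D -> mu.-integrable (cbox a b) (EFin \o g)) ->
  (forall (c : R) a b, 0 < c -> cbox a b `<=` D ->
    \int[mu]_(x in D) (g x * bump c a b x) = 0) ->
  {ae mu, forall x, D x -> g x = 0}.
Proof.
move=> oD gi g0; have mD := open_measurable_rV oD.
apply: ae_open => // a b abD; apply: integral_box_ae0.
  by apply: integrableS (gi _ _ abD);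
    [exact: measurable_cbox|exact: measurable_box|exact: box_cbox].
move=> a' b' ab'.
rewrite -(setIidl ab') boxI; apply: (integral_box_eq0 mD gi g0).
apply: subset_trans abD => x /= h i; have := h i; rewrite !mxE.
by rewrite ge_max le_min => /andP[/andP[_ ->] /andP[_ ->]].
Qed.

End fundamental.

(** * The space L2 *)

Lemma Rintegral_ae_eq d (T : measurableType d) (R : realType)
    (mu : {measure set T -> \bar R}) (D : set T) (f g : T -> R) :
  measurable D -> measurable_fun D f -> measurable_fun D g ->
  {ae mu, forall x, D x -> f x = g x} ->
  \int[mu]_(x in D) f x = \int[mu]_(x in D) g x.
Proof.
move=> mD mf mg fg; congr fine; apply: ae_eq_integral => //.
- exact/measurable_EFinP.
- exact/measurable_EFinP.
- by apply: filterS fg => x h Dx; congr EFin; exact: h.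
Qed.

(** Replacing [g] by the maximum of [f] and [g], which equals [g] almost everywhere, turns the
    hypothesis into an inequality at every point. *)
Lemma ae_le_Rintegral d (T : measurableType d) (R : realType)
    (mu : {measure set T -> \bar R}) (D : set T) (f g : T -> R) :
  measurable D -> mu.-integrable D (EFin \o f) -> mu.-integrable D (EFin \o g) ->
  {ae mu, forall x, D x -> f x <= g x} ->
  \int[mu]_(x in D) f x <= \int[mu]_(x in D) g x.
Proof.
move=> mD fi gi fg.
have mf : measurable_fun D f by apply/measurable_EFinP; exact: measurable_int fi.
have mg : measurable_fun D g by apply/measurable_EFinP; exact: measurable_int gi.
have mh : measurable_fun D (fun x => Num.max (f x) (g x)) by exact: measurable_maxr.
have -> : \int[mu]_(x in D) g x = \int[mu]_(x in D) Num.max (f x) (g x).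
  apply: Rintegral_ae_eq => //.
  by apply: filterS fg => x h Dx; rewrite max_r// h.
apply: le_Rintegral => //; last by move=> x _; rewrite le_max lexx.
apply: (le_integrable mD (g := (abse \o (EFin \o f)) \+ (abse \o (EFin \o g)))%E).
- exact/measurable_EFinP.
- move=> x _ /=; rewrite lee_fin [leRHS]ger0_norm ?addr_ge0//.
  by have [_|_] := leP (f x) (g x); rewrite ?lerDr ?lerDl normr_ge0.
- by apply: integrableD => //; exact: integrable_abse.
Qed.

(** The common source of the Cauchy-Schwarz inequalities for [l2dot], [form] and [dotv], and of the
    near orthogonality of a minimizing sequence. *)
Lemma quadratic_ge0_discr {R : realFieldType} (a b c : R) : 0 <= b ->
  (forall t, 0 <= a + t * c *+ 2 + t ^+ 2 * b) -> c ^+ 2 <= a * b.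
Proof.
move=> b0 h; have [b00|bn0] := eqVneq b 0.
  rewrite b00 mulr0; have [->|c0] := eqVneq c 0; first by rewrite expr0n.
  (* For [b = 0] and [c] nonzero, this argument makes the affine function equal to -1. *)
  have := h (- (a + 1) / (c *+ 2)); rewrite b00 mulr0 addr0 -mulrnAr.
  by rewrite divfK ?mulrn_eq0// => ?; lra.
have bp : 0 < b by rewrite lt_neqAle eq_sym bn0.
have := h (- (c / b)); have -> : a + - (c / b) * c *+ 2 + (- (c / b)) ^+ 2 * b = a - c ^+ 2 / b.
  by field.
by rewrite subr_ge0 ler_pdivrMr.
Qed.

Section L2_theory.
Context {R : realType} {n : nat}.
Local Notation mu := (lebesgue_rV R n).
Variable D : set 'rV[R]_n.
Hypothesis mD : measurable D.
Implicit Types (f g h : 'rV[R]_n -> R) (k : R).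

Lemma le_L2 f (F : 'rV[R]_n -> R) : measurable_fun D f ->
  mu.-integrable D (EFin \o F) -> (forall x, D x -> f x ^+ 2 <= F x) -> L2 D f.
Proof.
move=> mf iF fF; split => //; apply: (le_integrable mD _ _ iF).
  by apply/measurable_EFinP; exact: measurable_funX.
move=> x Dx /=; rewrite lee_fin ger0_norm ?sqr_ge0//.
by apply: le_trans (fF x Dx) _; exact: ler_norm.
Qed.

Lemma L2_mul_integrable f g : L2 D f -> L2 D g ->
  mu.-integrable D (EFin \o (fun x => f x * g x)).
Proof.
move=> [mf fi] [mg gi]; apply: (le_integrable mD _ _ (integrableD mD fi gi)).
  by apply/measurable_EFinP; exact: measurable_funM.
move=> x _ /=; rewrite lee_fin [leRHS]ger0_norm ?addr_ge0 ?sqr_ge0//.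
rewrite normrM -(real_normK (num_real (f x))) -(real_normK (num_real (g x))).
have := sqr_ge0 (`|f x| - `|g x|); have := sqr_ge0 `|f x|; have := sqr_ge0 `|g x|.
by nra.
Qed.

Lemma L2D f g : L2 D f -> L2 D g -> L2 D (fun x => f x + g x).
Proof.
move=> Lf Lg; have [mf fi] := Lf; have [mg gi] := Lg.
apply: (@le_L2 _ (fun x => (f x ^+ 2 + g x ^+ 2) * 2)).
- exact: measurable_funD.
- have := integrableZr mD 2 (integrableD mD fi gi).
  by apply: eq_integrable.
- by move=> x _; have := sqr_ge0 (f x - g x); nra.
Qed.

Lemma L2Z k f : L2 D f -> L2 D (fun x => k * f x).
Proof.
move=> [mf fi]; apply: (@le_L2 _ (fun x => k ^+ 2 * f x ^+ 2)).
- exact: measurable_funM.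
- exact: (integrableZl mD (k ^+ 2) fi).
- by move=> x _; rewrite exprMn.
Qed.

Lemma L2N f : L2 D f -> L2 D (fun x => - f x).
Proof. by move=> /(L2Z (-1)); under eq_fun do rewrite mulN1r. Qed.

Lemma L2B f g : L2 D f -> L2 D g -> L2 D (fun x => f x - g x).
Proof. by move=> Lf /L2N; exact: L2D. Qed.

Lemma L20 : L2 D (fun=> 0).
Proof.
apply: (@le_L2 _ (fun=> 0)) => //.
  by apply: (@eq_integrable _ _ _ mu D mD (cst 0%E)) => //; exact: integrable0.
by move=> x _; rewrite expr0n.
Qed.

Lemma L2_sum (I : Type) (r : seq I) (f : I -> 'rV[R]_n -> R) :
  (forall i, L2 D (f i)) -> L2 D (fun x => \sum_(i <- r) f i x).
Proof.
move=> Lf; elim: r => [|i r IH].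
  by under eq_fun do rewrite big_nil; exact: L20.
by under eq_fun do rewrite big_cons; exact: L2D.
Qed.

Lemma eq_L2 f g : (forall x, D x -> f x = g x) -> L2 D f -> L2 D g.
Proof.
move=> fg [mf fi]; split.
  by apply: eq_measurable_fun mf => x /set_mem /fg.
by apply: eq_integrable fi => // x /set_mem /fg /= ->.
Qed.

Lemma L2_dominated f g : measurable_fun D f -> L2 D g ->
  (forall x, D x -> `|f x| <= `|g x|) -> L2 D f.
Proof.
move=> mf [mg gi] fg; apply: (@le_L2 _ (fun x => g x ^+ 2)) => // x Dx.
by rewrite -(real_normK (num_real (f x))) -(real_normK (num_real (g x))) lerXn2r ?nnegrE ?fg.
Qed.

Lemma L2_bounded_mul k f g : measurable_fun D f -> (forall x, D x -> `|f x| <= k) ->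
  L2 D g -> L2 D (fun x => f x * g x).
Proof.
move=> mf fk Lg; apply: (L2_dominated _ (L2Z `|k| Lg)).
  by apply: measurable_funM => //; case: Lg.
move=> x Dx; rewrite !normrM normr_id ler_wpM2r//.
exact: le_trans (fk x Dx) (ler_norm _).
Qed.

Lemma l2dotC f g : l2dot D f g = l2dot D g f.
Proof. by rewrite /l2dot; apply: eq_Rintegral => x _; rewrite mulrC. Qed.

Lemma l2dotDl f g h : L2 D f -> L2 D g -> L2 D h ->
  l2dot D (fun x => f x + g x) h = l2dot D f h + l2dot D g h.
Proof.
move=> Lf Lg Lh; rewrite /l2dot -RintegralD//; try exact: L2_mul_integrable.
by apply: eq_Rintegral => x _; rewrite mulrDl.
Qed.

Lemma l2dotZl k f h : L2 D f -> L2 D h ->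
  l2dot D (fun x => k * f x) h = k * l2dot D f h.
Proof.
move=> Lf Lh; rewrite /l2dot -RintegralZl//; last exact: L2_mul_integrable.
by apply: eq_Rintegral => x _; rewrite mulrA.
Qed.

Lemma l2dotBl f g h : L2 D f -> L2 D g -> L2 D h ->
  l2dot D (fun x => f x - g x) h = l2dot D f h - l2dot D g h.
Proof.
move=> Lf Lg Lh; rewrite /l2dot -RintegralB//; try exact: L2_mul_integrable.
by apply: eq_Rintegral => x _; rewrite mulrBl.
Qed.

Lemma l2dotDr f g h : L2 D f -> L2 D g -> L2 D h ->
  l2dot D h (fun x => f x + g x) = l2dot D h f + l2dot D h g.
Proof. by move=> Lf Lg Lh; rewrite l2dotC l2dotDl// l2dotC [l2dot _ g h]l2dotC. Qed.

Lemma l2dotBr f g h : L2 D f -> L2 D g -> L2 D h ->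
  l2dot D h (fun x => f x - g x) = l2dot D h f - l2dot D h g.
Proof. by move=> Lf Lg Lh; rewrite l2dotC l2dotBl// l2dotC [l2dot _ g h]l2dotC. Qed.

Lemma l2dotZr k f h : L2 D f -> L2 D h ->
  l2dot D h (fun x => k * f x) = k * l2dot D h f.
Proof. by move=> Lf Lh; rewrite l2dotC l2dotZl// l2dotC. Qed.

Lemma l2dot_suml (I : Type) (r : seq I) (f : I -> 'rV[R]_n -> R) h :
  (forall i, L2 D (f i)) -> L2 D h ->
  l2dot D (fun x => \sum_(i <- r) f i x) h = \sum_(i <- r) l2dot D (f i) h.
Proof.
move=> Lf Lh; elim: r => [|i r IH].
  rewrite [RHS]big_nil; transitivity (0 * l2dot D h h); last by rewrite mul0r.
  by rewrite -l2dotZl//; apply: eq_Rintegral => x _; rewrite big_nil !mul0r.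
rewrite big_cons -IH -l2dotDl//; last exact: L2_sum.
by apply: eq_Rintegral => x _; rewrite big_cons.
Qed.

Lemma l2dot_ge0 f : 0 <= l2dot D f f.
Proof. by apply: Rintegral_ge0 => x _; rewrite -expr2 sqr_ge0. Qed.

Lemma l2norm_ge0 f : 0 <= l2norm D f.
Proof. exact: sqrtr_ge0. Qed.

Lemma l2norm_sqr f : l2norm D f ^+ 2 = l2dot D f f.
Proof. by rewrite sqr_sqrtr// l2dot_ge0. Qed.

Lemma l2norm_sqrE f : l2norm D f ^+ 2 = \int[mu]_(x in D) f x ^+ 2.
Proof. by rewrite l2norm_sqr; apply: eq_Rintegral => x _; rewrite expr2. Qed.

Lemma l2dot_sqr f g t : L2 D f -> L2 D g ->
  l2dot D (fun x => f x + t * g x) (fun x => f x + t * g x) =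
  l2dot D f f + t * l2dot D f g *+ 2 + t ^+ 2 * l2dot D g g.
Proof.
move=> Lf Lg; have Ltg := L2Z t Lg; have Lh := L2D Lf Ltg.
rewrite l2dotDl// !l2dotDr// !(l2dotZl, l2dotZr)// (l2dotC g f); ring.
Qed.

Lemma cauchy_schwarz f g : L2 D f -> L2 D g ->
  `|l2dot D f g| <= l2norm D f * l2norm D g.
Proof.
move=> Lf Lg; rewrite -(@ler_pXn2r _ 2)// ?nnegrE ?mulr_ge0 ?l2norm_ge0//.
rewrite exprMn !l2norm_sqr real_normK ?num_real//.
apply: quadratic_ge0_discr; first exact: l2dot_ge0.
by move=> t; rewrite -l2dot_sqr//; exact: l2dot_ge0.
Qed.

Lemma l2dot_le f g : L2 D f -> L2 D g -> l2dot D f g <= l2norm D f * l2norm D g.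
Proof. by move=> Lf Lg; exact: le_trans (ler_norm _) (cauchy_schwarz Lf Lg). Qed.

Lemma l2normD f g : L2 D f -> L2 D g ->
  l2norm D (fun x => f x + g x) <= l2norm D f + l2norm D g.
Proof.
move=> Lf Lg; rewrite -(@ler_pXn2r _ 2)// ?nnegrE ?addr_ge0 ?l2norm_ge0//.
rewrite sqrrD !l2norm_sqr.
have := l2dot_sqr 1 Lf Lg; under eq_fun do rewrite mul1r.
move=> ->; rewrite mul1r expr1n mul1r lerD2r lerD2l lerMn2r /=.
exact: l2dot_le.
Qed.

Lemma l2norm_sqrD f g : L2 D f -> L2 D g ->
  l2norm D (fun x => f x + g x) ^+ 2 <= 2 * (l2norm D f ^+ 2 + l2norm D g ^+ 2).
Proof.
move=> Lf Lg; have := l2normD Lf Lg; have := l2norm_ge0 (fun x => f x + g x).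
have := sqr_ge0 (l2norm D f - l2norm D g).
have := l2norm_ge0 f; have := l2norm_ge0 g.
by nra.
Qed.

Lemma l2normN f : l2norm D (fun x => - f x) = l2norm D f.
Proof.
by rewrite /l2norm; congr Num.sqrt; apply: eq_Rintegral => x _; rewrite mulrNN.
Qed.

Lemma eq_l2norm f g : (forall x, D x -> f x = g x) -> l2norm D f = l2norm D g.
Proof.
move=> fg; congr Num.sqrt; apply: eq_Rintegral => x /set_mem Dx.
by rewrite fg.
Qed.

Lemma l2norm_ae f g : measurable_fun D f -> measurable_fun D g ->
  {ae mu, forall x, D x -> f x = g x} -> l2norm D f = l2norm D g.
Proof.
move=> mf mg fg; congr Num.sqrt; apply: Rintegral_ae_eq => //.
- exact: measurable_funM.
- exact: measurable_funM.
- by apply: filterS fg => x h Dx; rewrite h.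
Qed.

Lemma ccont_L2 f : ccont f -> L2 D f.
Proof.
move=> cf; split; first by apply: continuous_measurable_rV; case: cf.
have [c _] := cf.
have := ccont_integrable (ccontM cf c).
apply: integrableS => //.
Qed.

End L2_theory.

Section L2_subset.
Context {R : realType} {n : nat}.
Local Notation mu := (lebesgue_rV R n).
Implicit Types (D E : set 'rV[R]_n) (f g : 'rV[R]_n -> R).

Lemma L2S D E f : measurable D -> measurable E -> E `<=` D -> L2 D f -> L2 E f.
Proof.
move=> mD mE ED [mf fi]; split; first exact: measurable_funS mf.
exact: integrableS fi.
Qed.

Lemma L2_mkcond D E f : measurable D -> measurable E -> E `<=` D ->
  L2 E f -> L2 D (f \_ E).
Proof.
move=> mD mE ED [mf fi]; split.
  apply: (@measurable_funS _ _ _ _ setT) => //.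
  exact: (measurable_restrictT f mE).1 mf.
apply: (@integrableS _ _ _ _ setT) => //.
have := (integrable_mkcond _ mE).1 fi.
apply: eq_integrable => // x _; rewrite !patchE.
by case: ifP => // _; rewrite expr0n.
Qed.

Lemma l2dot_mkcondl D E f g : E `<=` D -> l2dot D (f \_ E) g = l2dot E f g.
Proof.
move=> ED; rewrite /l2dot Rintegral_mkcond [RHS]Rintegral_mkcond.
congr (Rintegral _ _ _); apply/funext => x; rewrite !patchE.
case: (boolP (x \in E)) => xE; last by rewrite mul0r; case: ifP.
by rewrite ifT//; apply/mem_set/ED/set_mem.
Qed.

End L2_subset.

(** Telescoping. The bound 2S/2^k - 2S/2^(k+m) is the exact geometric sum, which lets the induction
    on m close. *)
Lemma geometric_cauchy {R : realType} (u : nat -> R) (S : R) : 0 <= S ->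
  (forall k, `|u k.+1 - u k| <= S / 2 ^+ k) ->
  exists2 l, u @ \oo --> l & forall k, `|l - u k| <= 2 * S / 2 ^+ k.
Proof.
move=> S0 hu.
have p2 k : 0 < 2 ^+ k :> R by rewrite exprn_gt0.
have tel k m : `|u (k + m)%N - u k| <= 2 * S / 2 ^+ k - 2 * S / 2 ^+ (k + m).
  elim: m => [|m IH]; first by rewrite addn0 !subrr normr0.
  rewrite addnS; have -> : u (k + m).+1 - u k =
    (u (k + m).+1 - u (k + m)%N) + (u (k + m)%N - u k) by ring.
  apply: le_trans (ler_normD _ _) _; apply: le_trans (lerD (hu _) IH) _.
  rewrite exprS invfM; have := p2 (k + m)%N; move: (2 ^+ (k + m)) => q q0.
  rewrite le_eqVlt; apply/orP; left; apply/eqP; field.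
  by rewrite !gt_eqF ?exprn_gt0.
have tel' k m : (k <= m)%N -> `|u m - u k| <= 2 * S / 2 ^+ k.
  move=> km; rewrite -(subnKC km); apply: le_trans (tel _ _) _.
  by rewrite gerBl divr_ge0 ?mulr_ge0// ltW.
have c0 k : 0 <= 2 * S / 2 ^+ k by rewrite divr_ge0 ?mulr_ge0// ltW.
have lim0 : (fun k => 2 * S / 2 ^+ k) @ \oo --> (0 : R).
  have := @cvg_geometric R (2 * S) 2^-1.
  rewrite ger0_norm ?invr_ge0// invf_lt1 ?ltr1n// => /(_ isT).
  by apply: cvg_trans; apply: near_eq_cvg; apply: nearW => k; rewrite /geometric /= exprVn.
have cu : cvg (u @ \oo).
  apply/cauchy_cvgP; apply: cauchy_exP => e e0.
  move/cvgrPdist_lt : lim0 => /(_ e e0) [k _ /(_ k (leqnn k)) /=].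
  rewrite sub0r normrN ger0_norm ?c0// => ke.
  exists (u k); exists k => // m /= km; rewrite /ball /= distrC.
  exact: le_lt_trans (tel' _ _ km) ke.
exists (lim (u @ \oo)) => // k.
have c : (fun m => `|u m - u k|) @ \oo --> `|lim (u @ \oo) - u k|.
  by apply: cvg_norm; apply: cvgB => //; exact: cvg_cst.
rewrite -(cvg_lim _ c)//; apply: limr_le; first by apply/cvg_ex; eexists; exact: c.
by exists k => // m /= km; exact: tel'.
Qed.

(** * Completeness of L2 *)

Section riesz_fischer.
Context {R : realType} {n : nat}.
Local Notation mu := (lebesgue_rV R n).

(** The rate 8^-k leaves room for the weight 4^k: the sum g of 4^k (f_{k+1} - f_k)^2 is integrable,
    its terms having integrals at most K/2^k. Where g is finite, consecutive terms differ by at most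
    sqrt(g)/2^k, so the sequence converges there and (f - f_k)^2 <= 4 g/4^k; integrating gives the
    stated rate. *)
Lemma riesz_fischer (D : set 'rV[R]_n) (f_ : nat -> 'rV[R]_n -> R) (K : R) :
  measurable D -> (forall k, L2 D (f_ k)) ->
  (forall k, l2norm D (f_ k.+1 \- f_ k) ^+ 2 <= K / 8 ^+ k) ->
  exists f, L2 D f /\
    exists2 C : R, 0 <= C & forall k, l2norm D (f \- f_ k) ^+ 2 <= C / 4 ^+ k.
Proof.
move=> mD Lf hf.
have K0 : 0 <= K by have := le_trans (sqr_ge0 _) (hf 0%N); rewrite expr0 divr1.
pose d k x := 4 ^+ k * (f_ k.+1 x - f_ k x) ^+ 2.
have d0 k x : 0 <= d k x by rewrite mulr_ge0 ?sqr_ge0 ?exprn_ge0.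
have mf k : measurable_fun D (f_ k) by case: (Lf k).
have md k : measurable_fun D (d k).
  by apply: measurable_funM => //; apply: measurable_funX; exact: measurable_funB.
pose g x := (\sum_(0 <= k <oo) (d k x)%:E)%E.
have g0 x : (0 <= g x)%E by apply: nneseries_ge0 => k _ _; rewrite lee_fin.
have mg : measurable_fun D g.
  by apply: ge0_emeasurable_sum => [k x _ _|k _]; [rewrite lee_fin|exact/measurable_EFinP].
have gi : mu.-integrable D g.
  apply/integrableP; split => //.
  under eq_integral do rewrite gee0_abs//.
  rewrite integral_nneseries//; last 2 first.
    by move=> k; exact/measurable_EFinP.
    by move=> k x _; rewrite lee_fin.
  apply: (@le_lt_trans _ _ (\sum_(0 <= k <oo) (2 * K / (2 ^ (k + 1))%:R)%:E)%E).
    apply: lee_nneseries => [k _ _|k _].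
      by apply: integral_ge0 => x _; rewrite lee_fin.
    have -> : (\int[mu]_(x in D) (d k x)%:E =
        (4 ^+ k * l2norm D (f_ k.+1 \- f_ k) ^+ 2)%:E)%E.
      rewrite l2norm_sqrE /Rintegral EFinM fineK; last first.
        apply: integrable_fin_num => //.
        by case: (L2B mD (Lf k.+1) (Lf k)).
      rewrite -ge0_integralZl_EFin//.
      - by move=> x _; rewrite lee_fin sqr_ge0.
      - by apply/measurable_EFinP; apply: measurable_funX; exact: measurable_funB.
    rewrite lee_fin; apply: le_trans (ler_wpM2l _ (hf k)) _; first by rewrite exprn_ge0.
    rewrite addn1 natrX exprS (_ : (8 : R) = 4 * 2); last by ring.
    rewrite exprMn le_eqVlt; apply/orP; left; apply/eqP; field.
    by rewrite !expf_neq0.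
  by rewrite (cvg_lim _ (@cvg_geometric_eseries_half R (2 * K) 0))// ltry.
pose E := D `&` [set x | g x \is a fin_num].
have mE : measurable E by exact: emeasurable_fin_num.
have aeE : {ae mu, forall x, D x -> E x}.
  by have := integrable_ae mD gi; apply: filterS => x h Dx; split => //; exact: h.
have dE k x : E x -> `|f_ k.+1 x - f_ k x| <= Num.sqrt (fine (g x)) / 2 ^+ k.
  move=> [Dx gx]; rewrite ler_pdivlMr ?exprn_gt0//.
  rewrite -(ler_sqr) ?nnegrE ?mulr_ge0 ?exprn_ge0 ?sqrtr_ge0//.
  rewrite sqr_sqrtr ?fine_ge0// exprMn real_normK ?num_real// exprAC.
  rewrite -lee_fin fineK//.
  apply: le_trans (nneseries_lim_ge k.+1 (P := xpredT) (m := 0%N) _); last first.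
    by move=> j _ _; rewrite lee_fin d0.
  rewrite big_nat_recr//= (_ : (2 : R) ^+ 2 = 4); last by ring.
  rewrite mulrC; apply: leeDr; apply: sume_ge0 => j _; by rewrite lee_fin.
have lE x : exists l, E x -> f_ k x @[k --> \oo] --> l /\
    forall k, `|l - f_ k x| <= 2 * Num.sqrt (fine (g x)) / 2 ^+ k.
  have [Ex|nEx] := pselect (E x); last by exists 0.
  by have [l l1 l2] := geometric_cauchy (sqrtr_ge0 _) (fun k => dE k x Ex); exists l.
have [f0 hf0] := choice lE.
(* Outside [E] the limit is set to zero, so that [f] is an everywhere limit of measurable
   functions. *)
pose f := f0 \_ E.
have fk x k : E x -> (f x - f_ k x) ^+ 2 <= 4 * fine (g x) / 4 ^+ k.
  move=> Ex; have [_ /(_ k)] := hf0 x Ex; rewrite /f patchE mem_set// => h.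
  rewrite -(real_normK (num_real _)); apply: le_trans (lerXn2r 2 _ _ h) _.
  - by rewrite nnegrE.
  - by rewrite nnegrE divr_ge0 ?mulr_ge0 ?exprn_ge0 ?sqrtr_ge0.
  rewrite expr_div_n exprMn sqr_sqrtr ?fine_ge0// exprAC.
  by rewrite (_ : (2 : R) ^+ 2 = 4)//; ring.
have mf' : measurable_fun D f.
  apply: (@measurable_fun_cvg _ _ _ _ (fun k => f_ k \_ E)) => [k|x Dx].
    apply: (@measurable_funS _ _ _ _ setT) => //.
    apply: (measurable_restrictT _ mE).1; apply: measurable_funS (mf k) => //.
    exact: subIsetl.
  rewrite /f patchE; case: ifPn => [/set_mem Ex|nEx].
    under eq_fun do rewrite patchE mem_set//.
    by have [] := hf0 x Ex.
  under eq_fun do rewrite patchE (negbTE nEx); exact: cvg_cst.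
have fgi : mu.-integrable D (EFin \o (fine \o g)).
  apply: le_integrable gi => //; first by apply/measurable_EFinP; exact: measurableT_comp.
  move=> x _ /=; rewrite gee0_abs// ger0_norm ?fine_ge0//.
  by have [gx|] := boolP (g x \is a fin_num); [rewrite fineK|move: (g0 x); case: (g x)].
have Lff : L2 D f.
  (* On [E] this is f^2 <= 2 (f - f_0)^2 + 2 f_0^2 with the pointwise bound at k = 0; elsewhere the
     left side is zero. *)
  apply: (@le_L2 _ _ _ mD _ (fun x => 8 * fine (g x) + 2 * f_ 0%N x ^+ 2)) => //.
    have h1 := integrableZl mD 8 fgi.
    have h2 := integrableZl mD 2 (Lf 0%N).2.
    exact: (integrableD mD h1 h2).
  move=> x Dx; have [Ex|nEx] := pselect (E x); last first.
    rewrite /f patchE memNset// expr0n /=.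
    by apply: addr_ge0; apply: mulr_ge0; rewrite ?sqr_ge0 ?fine_ge0 ?ler0n.
  have := fk x 0%N Ex; rewrite expr0 divr1.
  by have := sqr_ge0 (f x - 2 * f_ 0%N x); nra.
exists f; split => //.
exists (4 * \int[mu]_(x in D) fine (g x)) => [|k].
  by rewrite mulr_ge0 ?Rintegral_ge0// => x _; rewrite fine_ge0.
rewrite l2norm_sqrE mulrAC -RintegralZl//.
apply: ae_le_Rintegral => //.
- by case: (L2B mD Lff (Lf k)).
- exact: (integrableZl mD (4 / 4 ^+ k) fgi).
- by apply: filterS aeE => x h Dx; rewrite mulrAC; exact: fk (h Dx).
Qed.

End riesz_fischer.

(** * Weak gradients and H10 *)

Section test_functions.
Context {R : realType} {n : nat}.
Local Notation mu := (lebesgue_rV R n).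
Implicit Types (D W : set 'rV[R]_n) (phi psi : 'rV[R]_n -> R) (i : 'I_n).

Lemma smooth_continuous phi : smooth phi -> continuous phi.
Proof. by move=> /(_ [::]) []. Qed.

Lemma smooth_continuous_partial phi i : smooth phi -> continuous (partial i phi).
Proof. by move=> /(_ [:: i]) []. Qed.
Arguments smooth_continuous_partial {phi} i.

Lemma smooth_derivable phi i x : smooth phi -> derivable phi x (delta_mx 0 i).
Proof. by move=> /(_ [::]) [_]; exact. Qed.

Lemma partialM phi psi i x : smooth phi -> smooth psi ->
  partial i (fun y => phi y * psi y) x = phi x * partial i psi x + psi x * partial i phi x.
Proof.
by move=> sphi spsi; rewrite /partial deriveM//; exact: smooth_derivable.
Qed.

Lemma test_fun_subset D W phi : W `<=` D -> test_fun W phi -> test_fun D phi.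
Proof. by move=> WD [s c sub]; split => //; exact: subset_trans WD. Qed.

Lemma test_fun_eq0 D phi x : test_fun D phi -> ~ D x -> phi x = 0.
Proof.
move=> [_ _ sub] nDx; apply: contrapT => /eqP h; apply: nDx; apply: sub.
exact: subset_closure.
Qed.

Lemma partial_eq0 phi i x : ~ closure [set x | phi x != 0] x -> partial i phi x = 0.
Proof.
move=> nc; have : \forall y \near x, phi y = 0.
  have : nbhs x (~` closure [set x | phi x != 0]).
    by apply: open_nbhs_nbhs; split => //; apply: closed_openC; exact: closed_closure.
  apply: filterS => y hy; apply: contrapT => /eqP h; apply: hy.
  exact: subset_closure.
move=> h; rewrite /partial (@near_eq_derive _ _ _ phi (cst 0)); last first.
  by apply: filterS h => y ->.
exact: derive_cst.
Qed.

Lemma test_fun_partial_eq0 D phi i x : test_fun D phi -> ~ D x -> partial i phi x = 0.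
Proof. by move=> [_ _ sub] nDx; apply: partial_eq0 => /sub. Qed.
Arguments test_fun_partial_eq0 {D phi} i {x}.

Lemma test_fun_ccont D phi : test_fun D phi -> ccont phi.
Proof.
move=> [s c sub]; split; first exact: smooth_continuous.
have [M KM] := compact_sub_box c; exists M => x nx; apply: contrapT => /eqP h.
by apply: nx; apply: KM; exact: subset_closure.
Qed.

Lemma test_fun_partial_ccont D phi i : test_fun D phi -> ccont (partial i phi).
Proof.
move=> [s c sub]; split; first exact: smooth_continuous_partial.
have [M KM] := compact_sub_box c; exists M => x nx; apply: partial_eq0.
by move=> /KM.
Qed.
Arguments test_fun_partial_ccont {D phi} i.

Lemma Rintegral_support D (f : 'rV[R]_n -> R) : (forall x, ~ D x -> f x = 0) ->
  \int[mu]_(x in D) f x = \int[mu]_x f x.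
Proof.
move=> f0; rewrite Rintegral_mkcond; congr (Rintegral _ _ _).
apply/funext => x; rewrite patchE; case: ifPn => // /negP nx.
by rewrite f0// => Dx; apply: nx; exact/mem_set.
Qed.

(** Only [phi] has compact support, which is enough for the product [phi * psi]: its partial
    derivative has integral zero over the whole space, and both integrals extend there because [phi]
    and its partial vanish off [W]. *)
Lemma test_fun_by_parts W phi psi i : measurable W -> test_fun W phi -> smooth psi ->
  \int[mu]_(x in W) (phi x * partial i psi x) =
  - \int[mu]_(x in W) (partial i phi x * psi x).
Proof.
move=> mW tphi spsi; have [sphi _ _] := tphi.
have c1 := ccontM (test_fun_ccont tphi) (smooth_continuous_partial i spsi).
have c2 := ccontM (test_fun_partial_ccont i tphi) (smooth_continuous spsi).
have e : partial i (fun y => phi y * psi y) =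
    (fun x => phi x * partial i psi x + partial i phi x * psi x).
  by apply/funext => x; rewrite partialM// [psi x * _]mulrC.
apply/eqP; rewrite -addr_eq0; apply/eqP.
rewrite !(@Rintegral_support W); [|by move=> x nx; rewrite (test_fun_partial_eq0 i tphi nx) mul0r
  |by move=> x nx; rewrite (test_fun_eq0 tphi nx) mul0r].
rewrite -RintegralD//; [|exact: ccont_integrable..].
rewrite -e; apply: integral_ccont_partial.
- exact: ccontM (test_fun_ccont tphi) (smooth_continuous spsi).
- by rewrite e; exact: ccontD.
- by move=> x; apply: derivableM; exact: smooth_derivable.
Qed.

Lemma test_fun_L2 D W phi : measurable D -> test_fun W phi -> L2 D phi.
Proof. by move=> mD /test_fun_ccont; exact: ccont_L2. Qed.

Lemma test_fun_partial_L2 D W phi i : measurable D -> test_fun W phi ->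
  L2 D (partial i phi).
Proof. by move=> mD /(test_fun_partial_ccont i); exact: ccont_L2. Qed.
Arguments test_fun_partial_L2 {D W phi} i.

(* Integrating [partial i (x_i * phi^2)] bounds [phi] by its [i]-th partial. *)
Lemma test_fun_friedrichs D (M : R) phi i : measurable D -> D `<=` cube M -> 0 <= M ->
  test_fun D phi -> l2norm D phi <= 2 * M * l2norm D (partial i phi).
Proof.
move=> mD DM M0 tphi; have [sphi _ _] := tphi.
have cphi := smooth_continuous sphi.
have cd := smooth_continuous_partial i sphi.
have Lphi := test_fun_L2 mD tphi.
have Ld := test_fun_partial_L2 i mD tphi.
have cx : continuous (fun x : 'rV[R]_n => x 0 i) by exact: coord_continuous.
have dx (x : 'rV[R]_n) : is_derive x (delta_mx 0 i : 'rV[R]_n) (fun y : 'rV[R]_n => y 0 i) (1 : R).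
  apply: is_derive_line.
  rewrite (_ : (fun h : R => _) = (fun h : R => h + x 0 i)); last first.
    by apply/funext => h; rewrite !mxE !eqxx mulr1.
  rewrite -[X in is_derive _ _ _ X]addr0.
  exact: (is_deriveD (is_derive_id _ _) (is_derive_cst _ _ _)).
pose F x := phi x * (phi x * x 0 i).
have dp x : is_derive x (delta_mx 0 i) phi (partial i phi x).
  by apply/derivableP; exact: smooth_derivable.
have dF x : is_derive x (delta_mx 0 i) F
    (phi x * phi x + 2 * (phi x * (x 0 i * partial i phi x))).
  apply: is_derive_eq (is_deriveM (dp x) (is_deriveM (dp x) (dx x))) _.
  rewrite /GRing.scale /= (_ : (phi * _) x = phi x * x 0 i)//; ring.
have pF : partial i F = (fun x => phi x * phi x + 2 * (phi x * (x 0 i * partial i phi x))).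
  by apply/funext => x; rewrite /partial (derive_val (is_derive := dF x)).
have c1 : ccont (fun x => phi x * phi x) := ccontM (test_fun_ccont tphi) cphi.
have cxd : continuous (fun x : 'rV[R]_n => x 0 i * partial i phi x).
  by move=> x; exact: (@continuousM R _ _ _ x (cx x) (cd x)).
have c2 : ccont (fun x => phi x * (x 0 i * partial i phi x)) :=
  ccontM (test_fun_ccont tphi) cxd.
have c22 : ccont (fun x => 2 * (phi x * (x 0 i * partial i phi x))).
  by rewrite [X in ccont X](_ : _ = (fun x => (phi x * (x 0 i * partial i phi x)) * 2));
    [apply: ccontM => //; exact: cst_continuous | apply/funext => x; rewrite mulrC].
have I0 : \int[mu]_x partial i F x = 0.
  apply: integral_ccont_partial.
  - apply: ccontM (test_fun_ccont tphi) _ => x.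
    exact: (@continuousM R _ _ _ x (cphi x) (cx x)).
  - by rewrite pF; exact: ccontD.
  - by move=> x; case: (dF x).
move: I0; rewrite pF RintegralD//; [|exact: ccont_integrable..].
rewrite RintegralZl//; last exact: ccont_integrable.
rewrite -!(@Rintegral_support D); [|by move=> x nx; rewrite (test_fun_eq0 tphi nx) mul0r
  |by move=> x nx; rewrite (test_fun_eq0 tphi nx) mul0r].
have mx : measurable_fun D (fun x : 'rV[R]_n => x 0 i) by exact: continuous_measurable_rV.
have xM x : D x -> `|x 0 i| <= M.
  by move=> /DM /(_ i); rewrite !mxE => /andP[h1 h2]; rewrite ler_norml !ltW.
have Lxd := L2_bounded_mul mD mx xM Ld.
rewrite -/(l2dot D phi phi) -/(l2dot D phi (fun x => x 0 i * partial i phi x)).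
rewrite -l2norm_sqr => /eqP; rewrite addr_eq0 => /eqP e.
have h := cauchy_schwarz mD Lphi Lxd.
have h2 : l2norm D (fun x => x 0 i * partial i phi x) <= M * l2norm D (partial i phi).
  rewrite -(@ler_pXn2r _ 2)// ?nnegrE ?mulr_ge0 ?l2norm_ge0//.
  rewrite exprMn !l2norm_sqrE -RintegralZl//; last by case: Ld.
  apply: le_Rintegral => //.
  - by case: Lxd.
  - by have := integrableZl mD (M ^+ 2) Ld.2.
  - move=> x Dx; rewrite exprMn ler_wpM2r ?sqr_ge0//.
    by rewrite -(real_normK (num_real _)) lerXn2r ?nnegrE ?xM.
have [p0|p0] := eqVneq (l2norm D phi) 0; first by rewrite p0 !mulr_ge0 ?l2norm_ge0.
have pp : 0 < l2norm D phi by rewrite lt_neqAle eq_sym p0 l2norm_ge0.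
rewrite -(ler_pM2l pp) -expr2 e; move: h; rewrite ler_norml => /andP[h _].
have := ler_wpM2l (ltW pp) h2; nra.
Qed.

End test_functions.

(** * Weak gradients *)

Section weak_gradient.
Context {R : realType} {n : nat}.
Local Notation mu := (lebesgue_rV R n).
Implicit Types (D W : set 'rV[R]_n) (u v phi psi : 'rV[R]_n -> R) (i : 'I_n).
Implicit Types (G : 'rV[R]_n -> 'rV[R]_n).

Definition L2v D G : Prop := forall i, L2 D (fun x => G x 0 i).

(** The squared L2 norm of a vector field, summed over components so that estimates reduce to scalar
    ones; [vnorm2E] relates it to the Euclidean norm. *)
Definition vnorm2 D G : R := \sum_i l2norm D (fun x => G x 0 i) ^+ 2.

Definition classical_grad phi : 'rV[R]_n -> 'rV[R]_n :=
  fun x => \row_i partial i phi x.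

Lemma L2v_weak D u G : weak_grad D u G -> L2v D G.
Proof. by case. Qed.

Lemma L2vD D G G' : measurable D -> L2v D G -> L2v D G' -> L2v D (fun x => G x + G' x).
Proof.
move=> mD LG LG' i; rewrite (_ : (fun x => _) = (fun x => G x 0 i + G' x 0 i)).
  exact: L2D.
by apply/funext => x; rewrite mxE.
Qed.

Lemma L2vZ D (k : R) G : measurable D -> L2v D G -> L2v D (fun x => k *: G x).
Proof.
move=> mD LG i; rewrite (_ : (fun x => _) = (fun x => k * G x 0 i)).
  exact: L2Z.
by apply/funext => x; rewrite mxE.
Qed.

Lemma L2vB D G G' : measurable D -> L2v D G -> L2v D G' -> L2v D (fun x => G x - G' x).
Proof.
move=> mD LG LG'; have := L2vD mD LG (L2vZ (-1) mD LG').
by under eq_fun do rewrite scaleN1r.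
Qed.

Lemma vnorm2_ge0 D G : 0 <= vnorm2 D G.
Proof. by apply: sumr_ge0 => i _; exact: sqr_ge0. Qed.

Lemma le_vnorm2 D G i : l2norm D (fun x => G x 0 i) ^+ 2 <= vnorm2 D G.
Proof. by rewrite /vnorm2 (bigD1 i)//= lerDl sumr_ge0// => j _; exact: sqr_ge0. Qed.

Lemma enorm_sqr (x : 'rV[R]_n) : enorm x ^+ 2 = \sum_i x 0 i ^+ 2.
Proof.
rewrite sqr_sqrtr; first by apply: eq_bigr => i _; rewrite expr2.
by apply: sumr_ge0 => i _; rewrite -expr2 sqr_ge0.
Qed.

Lemma Rintegral_sum D (I : Type) (r : seq I) (F : I -> 'rV[R]_n -> R) : measurable D ->
  (forall k, mu.-integrable D (EFin \o F k)) ->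
  mu.-integrable D (EFin \o (fun x => \sum_(k <- r) F k x)) /\
  \int[mu]_(x in D) \sum_(k <- r) F k x = \sum_(k <- r) \int[mu]_(x in D) F k x.
Proof.
move=> mD iF; elim: r => [|k r [IH1 IH2]].
  have e : (fun x => \sum_(k <- [::]) F k x) = cst 0.
    by apply/funext => x; rewrite big_nil.
  rewrite e; split.
    by apply: (@eq_integrable _ _ _ _ D mD (cst 0%E)) => //; exact: integrable0.
  by rewrite big_nil Rintegral_cst// mul0r.
have e : (fun x => \sum_(j <- k :: r) F j x) = (fun x => F k x + \sum_(j <- r) F j x).
  by apply/funext => x; rewrite big_cons.
rewrite e; split; first exact: (integrableD mD (iF k) IH1).
by rewrite RintegralD// big_cons IH2.
Qed.

Lemma vnorm2E D G : measurable D -> L2v D G ->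
  vnorm2 D G = \int[mu]_(x in D) enorm (G x) ^+ 2.
Proof.
move=> mD LG; under eq_Rintegral do rewrite enorm_sqr.
have [_ ->] := Rintegral_sum (index_enum _) mD (fun i => (LG i).2).
by apply: eq_bigr => i _; rewrite l2norm_sqrE.
Qed.

Lemma vnorm2_ae D G G' : measurable D -> L2v D G -> L2v D G' ->
  {ae mu, forall x, D x -> G x = G' x} -> vnorm2 D G = vnorm2 D G'.
Proof.
move=> mD LG LG' h; apply: eq_bigr => i _; congr (_ ^+ 2).
apply: l2norm_ae => //; [by case: (LG i)|by case: (LG' i)|].
by apply: filterS h => x hx /hx ->.
Qed.

Lemma L2_cst_fin D (k : R) : measurable D -> (mu D < +oo)%E -> L2 D (fun=> k).
Proof.
move=> mD fD; split => //.
apply: (measurable_bounded_integrable mD fD (f := cst (k ^+ 2))) => //.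
exists `|k ^+ 2|; split; first exact: num_real.
by move=> x kx y _ /=; exact: ltW.
Qed.

Lemma L2_integrable_sub D W u : measurable D -> measurable W -> W `<=` D ->
  (mu W < +oo)%E -> L2 D u -> mu.-integrable W (EFin \o u).
Proof.
move=> mD mW WD fW Lu.
have := L2_mul_integrable mW (L2S mD mW WD Lu) (L2_cst_fin 1 mW fW).
by under eq_fun do rewrite mulr1.
Qed.

Lemma lebesgue_rV_cbox_lty (a b : 'rV[R]_n) : (mu (cbox a b) < +oo)%E.
Proof.
have [M hM] := compact_sub_box (@compact_cbox R n a b).
apply: le_lt_trans (@lebesgue_rV_box_lty R n (const_mx (- M)) (const_mx M)).
by apply: le_measure; rewrite ?inE//; [exact: measurable_cbox|exact: measurable_box].
Qed.

Lemma fundamental_lemma_L2 D u : open D -> L2 D u ->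
  (forall phi, test_fun D phi -> \int[mu]_(x in D) (u x * phi x) = 0) ->
  {ae mu, forall x, D x -> u x = 0}.
Proof.
move=> oD Lu h; apply: fundamental_lemma => //.
  move=> a b abD; apply: L2_integrable_sub abD _ Lu.
  - exact: open_measurable_rV.
  - exact: measurable_cbox.
  - exact: lebesgue_rV_cbox_lty.
by move=> c a b c0 abD; apply: h; exact: test_fun_bump.
Qed.

Lemma weak_grad_unique D u G G' : open D -> weak_grad D u G -> weak_grad D u G' ->
  {ae mu, forall x, D x -> G x = G' x}.
Proof.
move=> oD [LG hG] [LG' hG']; have mD := open_measurable_rV oD.
have h i : {ae mu, forall x, D x -> G x 0 i = G' x 0 i}.
  have : {ae mu, forall x, D x -> G x 0 i - G' x 0 i = 0}.
    apply: fundamental_lemma_L2 => // [|phi tphi]; first exact: L2B.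
    have Lp := test_fun_L2 mD tphi.
    have := hG phi tphi i; rewrite (hG' phi tphi i) => /oppr_inj e.
    by have := l2dotBl mD (LG i) (LG' i) Lp; rewrite /l2dot => ->; rewrite e subrr.
  by apply: filterS => x h /h /eqP; rewrite subr_eq0 => /eqP.
have : {ae mu, forall x, forall i, D x -> G x 0 i = G' x 0 i}.
  exact: filter_forall.
by apply: filterS => x hx Dx; apply/rowP => i; exact: hx.
Qed.

Lemma weak_grad_lin D (k : R) u v G G' : open D -> L2 D u -> L2 D v ->
  weak_grad D u G -> weak_grad D v G' ->
  weak_grad D (fun x => u x + k * v x) (fun x => G x + k *: G' x).
Proof.
move=> oD Lu Lv [LG hG] [LG' hG']; have mD := open_measurable_rV oD; split.
  by apply: L2vD => //; exact: L2vZ.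
move=> phi tphi i.
have Lp := test_fun_L2 mD tphi; have Ld := test_fun_partial_L2 i mD tphi.
have h1 := l2dotDl mD Lu (L2Z mD k Lv) Ld.
rewrite (l2dotZl mD k Lv Ld) in h1.
have h2 := l2dotDl mD (LG i) (L2Z mD k (LG' i)) Lp.
rewrite (l2dotZl mD k (LG' i) Lp) in h2.
rewrite /l2dot in h1, h2; rewrite h1 hG// hG'//.
under [in RHS]eq_Rintegral do rewrite !mxE.
by rewrite h2 opprD mulrN.
Qed.

Lemma weak_gradB D u v G G' : open D -> L2 D u -> L2 D v ->
  weak_grad D u G -> weak_grad D v G' ->
  weak_grad D (fun x => u x - v x) (fun x => G x - G' x).
Proof.
move=> oD Lu Lv wu wv.
have -> : (fun x => u x - v x) = (fun x => u x + -1 * v x).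
  by apply/funext => x; rewrite mulN1r.
have -> : (fun x => G x - G' x) = (fun x => G x + -1 *: G' x).
  by apply/funext => x; rewrite scaleN1r.
exact: weak_grad_lin.
Qed.

Lemma weak_grad_subset D W u G : open D -> open W -> W `<=` D ->
  weak_grad D u G -> weak_grad W u G.
Proof.
move=> oD oW WD [LG hG]; have mD := open_measurable_rV oD.
have mW := open_measurable_rV oW; split => [i|phi tphi i].
  exact: L2S (LG i).
have := hG phi (test_fun_subset WD tphi) i.
have sub (f g : 'rV[R]_n -> R) : (forall x, ~ W x -> g x = 0) ->
    \int[mu]_(x in D) (f x * g x) = \int[mu]_(x in W) (f x * g x).
  move=> g0; rewrite [RHS](Rintegral_support (f := fun x => f x * g x)).
    rewrite (Rintegral_support (f := fun x => f x * g x))// => x nD.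
    by rewrite g0 ?mulr0// => /WD.
  by move=> x /g0 ->; rewrite mulr0.
rewrite !sub// => x nW; first exact: (test_fun_eq0 tphi).
exact: (test_fun_partial_eq0 i tphi).
Qed.

Lemma weak_grad_test D W phi : open D -> test_fun W phi ->
  weak_grad D phi (classical_grad phi).
Proof.
move=> oD tphi; have mD := open_measurable_rV oD; split => [i|psi tpsi i].
  under eq_fun do rewrite mxE; exact: test_fun_partial_L2 tphi.
have [spsi _ _] := tpsi; have [sphi _ _] := tphi.
under [in RHS]eq_Rintegral do rewrite mxE.
have := test_fun_by_parts i mD tpsi sphi.
under eq_Rintegral do rewrite mulrC.
move=> ->; rewrite opprK.
by apply: eq_Rintegral => x _; rewrite mulrC.
Qed.

Lemma H1_weak_grad D u : H1 D u -> weak_grad D u (grad D u).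
Proof. by move=> [_ [G hG]]; apply: (@xgetPex _ _ [set G | weak_grad D u G]); exists G. Qed.

Lemma H1_L2 D u : H1 D u -> L2 D u.
Proof. by case. Qed.

Lemma weak_grad_H1 D u G : L2 D u -> weak_grad D u G -> H1 D u.
Proof. by move=> Lu wG; split => //; exists G. Qed.

(** This lets any explicit weak gradient replace the one selected by [grad] inside [h1norm] and
    [energy]. *)
Lemma grad_ae D u G : open D -> weak_grad D u G ->
  {ae mu, forall x, D x -> grad D u x = G x}.
Proof.
move=> oD wG; apply: (weak_grad_unique oD _ wG).
by apply: (@xgetPex _ _ [set G | weak_grad D u G]); exists G.
Qed.

Lemma h1norm_sqr D u G : open D -> L2 D u -> weak_grad D u G ->
  h1norm D u ^+ 2 = l2norm D u ^+ 2 + vnorm2 D G.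
Proof.
move=> oD Lu wG; have mD := open_measurable_rV oD.
have wg := H1_weak_grad (weak_grad_H1 Lu wG).
rewrite -(vnorm2_ae mD (L2v_weak wg) (L2v_weak wG) (grad_ae oD wG)).
rewrite vnorm2E//; last exact: L2v_weak wg.
rewrite sqr_sqrtr// addr_ge0 ?sqr_ge0// Rintegral_ge0// => x _.
exact: sqr_ge0.
Qed.

Lemma h1norm_ge0 D u : 0 <= h1norm D u.
Proof. exact: sqrtr_ge0. Qed.

Lemma H1_subset D W u : open D -> open W -> W `<=` D -> H1 D u -> H1 W u.
Proof.
move=> oD oW WD Hu.
apply: weak_grad_H1; last exact: weak_grad_subset WD (H1_weak_grad Hu).
by apply: L2S (H1_L2 Hu) => //; exact: open_measurable_rV.
Qed.

Lemma H10_approx D u G : open D -> H10 D u -> weak_grad D u G ->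
  forall eps : R, 0 < eps -> exists phi, [/\ test_fun D phi,
    l2norm D (fun x => u x - phi x) <= eps &
    vnorm2 D (fun x => G x - classical_grad phi x) <= eps ^+ 2].
Proof.
move=> oD [Hu hu] wG eps e0; have [phi tphi hphi] := hu eps e0.
have mD := open_measurable_rV oD.
exists phi; split => //.
  rewrite -(@ler_pXn2r _ 2)// ?nnegrE ?l2norm_ge0 ?(ltW e0)//.
  apply: le_trans (lerXn2r 2 _ _ (ltW hphi)); rewrite ?nnegrE ?h1norm_ge0 ?(ltW e0)//.
  have wB := weak_gradB oD (H1_L2 Hu) (test_fun_L2 mD tphi) wG (weak_grad_test oD tphi).
  by rewrite (h1norm_sqr oD _ wB) ?lerDl ?vnorm2_ge0//;
    exact: L2B (H1_L2 Hu) (test_fun_L2 mD tphi).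
apply: le_trans (lerXn2r 2 _ _ (ltW hphi)); rewrite ?nnegrE ?h1norm_ge0 ?(ltW e0)//.
have wB := weak_gradB oD (H1_L2 Hu) (test_fun_L2 mD tphi) wG (weak_grad_test oD tphi).
by rewrite (h1norm_sqr oD _ wB) ?lerDr ?sqr_ge0//;
  exact: L2B (H1_L2 Hu) (test_fun_L2 mD tphi).
Qed.

Lemma approx_H10 D u G : open D -> L2 D u -> weak_grad D u G ->
  (forall eps : R, 0 < eps -> exists phi, [/\ test_fun D phi,
    l2norm D (fun x => u x - phi x) <= eps &
    vnorm2 D (fun x => G x - classical_grad phi x) <= eps ^+ 2]) -> H10 D u.
Proof.
move=> oD Lu wG h; have mD := open_measurable_rV oD.
split; first exact: weak_grad_H1 wG.
(* With eps/2, the squares of the two parts add up to at most half of eps^2, which yields the strict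
   inequality that [H10] asks for. *)
move=> eps e0; have [phi [tphi h1 h2]] := h (eps / 2) (divr_gt0 e0 (ltr0Sn _ 1)).
exists phi => //; rewrite -(@ltr_pXn2r _ 2)// ?nnegrE ?h1norm_ge0 ?(ltW e0)//.
have wB := weak_gradB oD Lu (test_fun_L2 mD tphi) wG (weak_grad_test oD tphi).
rewrite (h1norm_sqr oD _ wB); last exact: L2B Lu (test_fun_L2 mD tphi).
have h1' := lerXn2r 2 _ _ h1; rewrite !nnegrE l2norm_ge0 (divr_ge0 (ltW e0))// in h1'.
have := h1' isT isT; move: h2; have := exprn_gt0 2 e0.
rewrite expr_div_n; lra.
Qed.

Lemma test_fun_H10 D phi : open D -> test_fun D phi -> H10 D phi.
Proof.
move=> oD tphi; have mD := open_measurable_rV oD.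
apply: (approx_H10 oD (test_fun_L2 mD tphi) (weak_grad_test oD tphi)) => eps e0.
exists phi; split => //.
  rewrite (@eq_l2norm _ _ _ _ (fun x => 0 * phi x)) => [|x _]; last by rewrite subrr mul0r.
  rewrite -(@ler_pXn2r _ 2)// ?nnegrE ?l2norm_ge0 ?(ltW e0)// l2norm_sqr l2dotZl//.
  - by rewrite mul0r sqr_ge0.
  - exact: test_fun_L2 tphi.
  - by apply: L2Z => //; exact: test_fun_L2 tphi.
rewrite /vnorm2 big1 ?sqr_ge0// => i _; apply/eqP; rewrite sqrf_eq0; apply/eqP.
rewrite /l2norm /l2dot; under eq_Rintegral do rewrite subrr !mxE mul0r.
by rewrite Rintegral_cst// mul0r sqrtr0.
Qed.

End weak_gradient.

Lemma le0_eps {R : realFieldType} (x K : R) : 0 <= K ->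
  (forall eps, 0 < eps -> x <= eps * K) -> x <= 0.
Proof.
move=> K0 h; rewrite leNgt; apply/negP => x0.
have K1 : 0 < K + 1 by rewrite ltr_wpDl.
have := h (x / (K + 1)) (divr_gt0 x0 K1); rewrite mulrAC ler_pdivlMr//.
nra.
Qed.

(** * The space H10 as the closure of the test functions *)

Section H10_theory.
Context {R : realType} {n : nat}.
Local Notation mu := (lebesgue_rV R n).
Implicit Types (D W : set 'rV[R]_n) (u v phi psi : 'rV[R]_n -> R) (i : 'I_n).
Implicit Types (G : 'rV[R]_n -> 'rV[R]_n).

Lemma partial_lin (k : R) phi psi i :
  (forall x, derivable phi x (delta_mx 0 i)) ->
  (forall x, derivable psi x (delta_mx 0 i)) ->
  partial i (fun x => phi x + k * psi x) = (fun x => partial i phi x + k * partial i psi x).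
Proof.
move=> dphi dpsi; apply/funext => x.
have d := is_deriveD (derivableP (dphi x)) (is_deriveZ k (derivableP (dpsi x))).
by have := derive_val (is_derive := d).
Qed.

Lemma smooth_lin (k : R) phi psi : smooth phi -> smooth psi ->
  smooth (fun x => phi x + k * psi x).
Proof.
move=> sphi spsi s.
have -> : foldr partial (fun x => phi x + k * psi x) s =
    (fun x => foldr partial phi s x + k * foldr partial psi s x).
  elim: s => [//|i s IH] /=; rewrite IH partial_lin// => x.
    by have [_] := sphi s; exact.
  by have [_] := spsi s; exact.
have [c1 d1] := sphi s; have [c2 d2] := spsi s; split => [x|i x].
  apply: (@continuousD R _ _ _ _ x (c1 x)).
  by apply: (@continuousM R _ (cst k) _ x _ (c2 x)); exact: cst_continuous.
exact: (derivableD (d1 i x) (derivableZ (d2 i x))).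
Qed.

Lemma test_fun_lin D (k : R) phi psi : test_fun D phi -> test_fun D psi ->
  test_fun D (fun x => phi x + k * psi x).
Proof.
move=> [s1 c1 d1] [s2 c2 d2].
have sub : closure [set x | phi x + k * psi x != 0] `<=`
    closure [set x | phi x != 0] `|` closure [set x | psi x != 0].
  rewrite -closureU; apply: closure_subset => x /= h.
  have [p0|] := eqVneq (phi x) 0; last by left.
  by right; apply: contraNneq h => ->; rewrite p0 mulr0 addr0.
split; first exact: smooth_lin.
  apply: subclosed_compact sub; first exact: closed_closure.
  exact: compactU.
by apply: subset_trans sub _ => x [/d1|/d2].
Qed.

Lemma vnorm2_lin D (k : R) G G' : measurable D -> L2v D G -> L2v D G' ->
  vnorm2 D (fun x => G x + k *: G' x) <= 2 * (vnorm2 D G + k ^+ 2 * vnorm2 D G').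
Proof.
move=> mD LG LG'; rewrite /vnorm2 [k ^+ 2 * _]mulr_sumr -big_split/= mulr_sumr.
apply: ler_sum => i _.
rewrite (@eq_l2norm _ _ _ _ (fun x => G x 0 i + k * G' x 0 i)); last first.
  by move=> x _; rewrite !mxE.
apply: le_trans (l2norm_sqrD mD (LG i) (L2Z mD k (LG' i))) _.
rewrite ler_wpM2l// lerD2l [leLHS]l2norm_sqr (l2dotZl mD)//; last exact: L2Z.
by rewrite (l2dotZr mD)// l2norm_sqr mulrA expr2.
Qed.

Lemma l2normZ D (k : R) u : measurable D -> L2 D u ->
  l2norm D (fun x => k * u x) = `|k| * l2norm D u.
Proof.
move=> mD Lu; apply/eqP; rewrite -(@eqrXn2 _ 2)// ?mulr_ge0 ?l2norm_ge0//.
rewrite exprMn !l2norm_sqr (l2dotZl mD)//; last exact: L2Z.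
by rewrite (l2dotZr mD)// real_normK ?num_real// mulrA expr2.
Qed.

Lemma H10_H1 D u : H10 D u -> H1 D u. Proof. by case. Qed.

Lemma H10_L2 D u : H10 D u -> L2 D u. Proof. by move=> /H10_H1 /H1_L2. Qed.

Lemma H10_0 D : open D -> H10 D (fun=> 0).
Proof.
move=> oD; apply: test_fun_H10 => //.
have e s : foldr (@partial R n) (fun=> 0) s = fun=> 0.
  elim: s => // i s /= ->; apply/funext => x; exact: derive_cst.
have c0 : closure [set x : 'rV[R]_n | (0 : R) != 0] = set0.
  by rewrite -(closure0 'rV[R]_n); congr closure; apply/seteqP; split => x //=; rewrite eqxx.
split; rewrite ?c0//; last exact: compact0.
by move=> s; rewrite e; split => [|i x]; [exact: cst_continuous|exact: derivable_cst].
Qed.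

Lemma H10_weak_grad D u : H10 D u -> weak_grad D u (grad D u).
Proof. by move=> /H10_H1 /H1_weak_grad. Qed.

Lemma H10_closed D u G : open D -> L2 D u -> weak_grad D u G ->
  (forall eps : R, 0 < eps -> exists v G', [/\ H10 D v, weak_grad D v G',
    l2norm D (fun x => u x - v x) <= eps &
    vnorm2 D (fun x => G x - G' x) <= eps ^+ 2]) -> H10 D u.
Proof.
move=> oD Lu wG h; have mD := open_measurable_rV oD.
apply: (approx_H10 oD Lu wG) => eps e0; have e2 : 0 < eps / 2 by rewrite divr_gt0.
have [v [G' [Hv wG' h1 h2]]] := h _ e2.
have [phi [tphi h3 h4]] := H10_approx oD Hv wG' e2.
have wp := weak_grad_test oD tphi.
exists phi; split => //.
  rewrite (@eq_l2norm _ _ _ _ (fun x => (u x - v x) + (v x - phi x))); last first.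
    by move=> x _; ring.
  apply: le_trans (l2normD mD _ _) _.
  - by apply: L2B => //; exact: H10_L2.
  - by apply: L2B => //; [exact: H10_L2|exact: test_fun_L2 tphi].
  - by rewrite (splitr eps) lerD.
have := vnorm2_lin 1 mD (L2vB mD (L2v_weak wG) (L2v_weak wG'))
  (L2vB mD (L2v_weak wG') (L2v_weak wp)).
rewrite expr1n mul1r (_ : (fun x => _) = (fun x => G x - classical_grad phi x)).
  move=> /le_trans; apply; move: h2 h4; rewrite expr_div_n.
  rewrite (_ : (2 : R) ^+ 2 = 4); last by ring.
  by move: (vnorm2 _ _) (vnorm2 _ _) => a b; clear; lra.
by apply/funext => x; rewrite scale1r addrA subrK.
Qed.

Lemma H10_lin D (k : R) u v : open D -> H10 D u -> H10 D v ->
  H10 D (fun x => u x + k * v x).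
Proof.
move=> oD Hu Hv; have mD := open_measurable_rV oD.
have wu := H10_weak_grad Hu; have wv := H10_weak_grad Hv.
have wuv := weak_grad_lin k oD (H10_L2 Hu) (H10_L2 Hv) wu wv.
apply: (H10_closed oD _ wuv); first by apply: L2D (H10_L2 Hu) (L2Z _ _ (H10_L2 Hv)).
(* This [c] satisfies c (1 + |k|) = eps/2. That suffices for the function by the triangle
   inequality, and for the gradient since 2 (1 + k^2) c^2 <= eps^2/2. *)
move=> eps e0; pose c := eps / (2 * (1 + `|k|)).
have k1 : 0 < 1 + `|k| by rewrite ltr_pwDl.
have c0 : 0 < c by rewrite divr_gt0// mulr_gt0.
have ce : c * (1 + `|k|) = eps / 2 by rewrite /c; field; rewrite gt_eqF.
have [phi [tphi h1 h2]] := H10_approx oD Hu wu c0.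
have [psi [tpsi h3 h4]] := H10_approx oD Hv wv c0.
have wp := weak_grad_test oD tphi; have wq := weak_grad_test oD tpsi.
have Lp := test_fun_L2 mD tphi; have Lq := test_fun_L2 mD tpsi.
exists (fun x => phi x + k * psi x), (fun x => classical_grad phi x + k *: classical_grad psi x).
split.
- by apply: test_fun_H10 => //; exact: test_fun_lin.
- exact: weak_grad_lin.
- have L1 := L2B mD (H10_L2 Hu) Lp; have L2' := L2B mD (H10_L2 Hv) Lq.
  rewrite (@eq_l2norm _ _ _ _ (fun x => (u x - phi x) + k * (v x - psi x))); last first.
    by move=> x _; ring.
  apply: le_trans (l2normD mD L1 (L2Z mD k L2')) _; rewrite l2normZ//.
  have := ler_wpM2l (normr_ge0 k) h3; move: h1 ce (e0).
  by move: (l2norm _ _) (l2norm _ _) (c) => a b c'; clear; lra.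
- have := vnorm2_lin k mD (L2vB mD (L2v_weak wu) (L2v_weak wp))
    (L2vB mD (L2v_weak wv) (L2v_weak wq)).
  rewrite (_ : (fun x => _) = (fun x => grad D u x + k *: grad D v x -
      (classical_grad phi x + k *: classical_grad psi x))); last first.
    by apply/funext => x; apply/rowP => i; rewrite !mxE; ring.
  move=> /le_trans; apply; rewrite -(real_normK (num_real k)).
  have kk := sqr_ge0 `|k|.
  have := ler_wpM2l kk h4.
  have : (c * (1 + `|k|)) ^+ 2 = eps ^+ 2 / 4 by rewrite ce; field.
  have := mulr_ge0 (normr_ge0 k) (sqr_ge0 c); move: h2; have := sqr_ge0 eps.
  move: (vnorm2 _ _) (vnorm2 _ _) => a b; move: (`|k|) (c); clear => q c'.
  by nra.
Qed.

Lemma H10Z D (k : R) v : open D -> H10 D v -> H10 D (fun x => k * v x).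
Proof.
move=> oD Hv; have := H10_lin (k - 1) oD Hv Hv.
by rewrite (_ : (fun x => v x + _) = (fun x => k * v x))//; apply/funext => x; ring.
Qed.

Lemma H10B D u v : open D -> H10 D u -> H10 D v -> H10 D (fun x => u x - v x).
Proof.
move=> oD Hu Hv; have := H10_lin (-1) oD Hu Hv.
by rewrite (_ : (fun x => u x + _) = (fun x => u x - v x))//; apply/funext => x; ring.
Qed.

(** The inequality passes from test functions to their closure. Its constant depends on the cube
    alone, so one M serves Omega and every patch. *)
Lemma H10_friedrichs D (M : R) u G i : open D -> D `<=` cube M -> 0 <= M ->
  H10 D u -> weak_grad D u G ->
  l2norm D u <= 2 * M * l2norm D (fun x => G x 0 i).
Proof.
move=> oD DM M0 Hu wG; have mD := open_measurable_rV oD.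
rewrite -subr_le0; apply: (@le0_eps _ _ (1 + 2 * M)); first by lra.
move=> eps e0; have [phi [tphi h1 h2]] := H10_approx oD Hu wG e0.
have Lp := test_fun_L2 mD tphi; have Ld := test_fun_partial_L2 i mD tphi.
have LG := L2v_weak wG i.
have t1 := l2normD mD (L2B mD (H10_L2 Hu) Lp) Lp.
rewrite (@eq_l2norm _ _ _ _ u) in t1; last by move=> x _; rewrite subrK.
have t2 := l2normD mD (L2B mD Ld LG) LG.
rewrite (@eq_l2norm _ _ _ _ (partial i phi)) in t2; last by move=> x _; rewrite subrK.
have t3 := test_fun_friedrichs i mD DM M0 tphi.
have t4 : l2norm D (fun x => partial i phi x - G x 0 i) <= eps.
  rewrite -(@ler_pXn2r _ 2)// ?nnegrE ?l2norm_ge0 ?(ltW e0)//.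
  apply: le_trans h2; apply: le_trans (le_vnorm2 D _ i).
  rewrite -l2normN le_eqVlt; apply/orP; left; apply/eqP; congr (_ ^+ 2).
  by apply: eq_l2norm => x _; rewrite !mxE opprB.
have := ler_wpM2l (mulr_ge0 (ler0n R 2) M0) (le_trans t2 (lerD t4 (lexx _))).
move: h1 t1 t3; move: (l2norm _ _) (l2norm _ _) (l2norm _ _) (l2norm _ _).
by move: (l2norm _ _) => a b c f g; clear; lra.
Qed.

(* Weak differentiability passes to limits, tested with functions that need not
   vanish on the boundary of W. *)
Lemma by_parts_limit W psi i u (g : 'rV[R]_n -> R) : measurable W ->
  L2 W u -> L2 W g -> L2 W psi -> L2 W (partial i psi) ->
  (forall eps : R, 0 < eps -> exists v h, [/\ L2 W v, L2 W h,
     \int[mu]_(x in W) (v x * partial i psi x) = - \int[mu]_(x in W) (h x * psi x),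
     l2norm W (fun x => u x - v x) <= eps & l2norm W (fun x => g x - h x) <= eps]) ->
  \int[mu]_(x in W) (u x * partial i psi x) = - \int[mu]_(x in W) (g x * psi x).
Proof.
move=> mW Lu Lg Lp Ld h; apply/eqP; rewrite -subr_eq0 opprK -normr_le0; apply/eqP.
apply/eqP; apply: (@le0_eps _ _ (l2norm W (partial i psi) + l2norm W psi)).
  by rewrite addr_ge0 ?l2norm_ge0.
move=> eps e0; have [v [k [Lv Lk e h1 h2]]] := h _ e0.
rewrite -/(l2dot W u (partial i psi)) -/(l2dot W g psi).
have -> : l2dot W u (partial i psi) + l2dot W g psi =
    l2dot W (fun x => u x - v x) (partial i psi) + l2dot W (fun x => g x - k x) psi.
  rewrite !(l2dotBl mW)// /l2dot e; ring.
apply: le_trans (ler_normD _ _) _; rewrite mulrDr; apply: lerD.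
  apply: le_trans (cauchy_schwarz mW (L2B mW Lu Lv) Ld) _.
  by rewrite ler_wpM2r ?l2norm_ge0.
apply: le_trans (cauchy_schwarz mW (L2B mW Lg Lk) Lp) _.
by rewrite ler_wpM2r ?l2norm_ge0.
Qed.

Lemma L2v_comp_le D G (eps : R) i : 0 <= eps -> vnorm2 D G <= eps ^+ 2 ->
  l2norm D (fun x => G x 0 i) <= eps.
Proof.
move=> e0 h; rewrite -(@ler_pXn2r _ 2)// ?nnegrE ?l2norm_ge0//.
exact: le_trans (le_vnorm2 D G i) h.
Qed.

Lemma weak_grad_closed D u G : open D -> L2 D u -> L2v D G ->
  (forall eps : R, 0 < eps -> exists v G', [/\ L2 D v, weak_grad D v G',
    l2norm D (fun x => u x - v x) <= eps &
    vnorm2 D (fun x => G x - G' x) <= eps ^+ 2]) -> weak_grad D u G.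
Proof.
move=> oD Lu LG h; have mD := open_measurable_rV oD; split => // psi tpsi i.
apply: by_parts_limit => //; first exact: test_fun_L2 tpsi.
  exact: test_fun_partial_L2 tpsi.
move=> eps e0; have [v [G' [Lv wG' h1 h2]]] := h _ e0.
exists v, (fun x => G' x 0 i); split => //.
- exact: L2v_weak wG' i.
- by case: wG' => _; exact.
- have := L2v_comp_le i (ltW e0) h2.
  by rewrite (@eq_l2norm _ _ _ _ (fun x => G x 0 i - G' x 0 i))// => x _; rewrite !mxE.
Qed.

Definition zero_ext W G : 'rV[R]_n -> 'rV[R]_n := fun x => if x \in W then G x else 0.

Lemma zero_extE W G i : (fun x => zero_ext W G x 0 i) = (fun x => G x 0 i) \_ W.
Proof.
by apply/funext => x; rewrite /zero_ext patchE; case: ifP; rewrite ?mxE.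
Qed.

Lemma L2v_zero_ext D W G : measurable D -> measurable W -> W `<=` D -> L2v W G ->
  L2v D (zero_ext W G).
Proof. by move=> mD mW WD LG i; rewrite zero_extE; exact: L2_mkcond. Qed.

Lemma l2norm_mkcond D W u : W `<=` D -> l2norm D (u \_ W) = l2norm W u.
Proof.
move=> WD; congr Num.sqrt; rewrite l2dot_mkcondl// l2dotC.
by apply: eq_Rintegral => x xW; rewrite patchE xW.
Qed.

Lemma vnorm2_zero_ext D W G : W `<=` D -> vnorm2 D (zero_ext W G) = vnorm2 W G.
Proof. by move=> WD; apply: eq_bigr => i _; rewrite zero_extE l2norm_mkcond. Qed.

(** The extension creates no jump across the boundary of [W]: a test function of [W] can be
    integrated by parts against any smooth [psi] on [D], even one that does not vanish on that
    boundary, and [u] is a limit of such functions. *)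
Lemma weak_grad_zero_ext D W u G : open D -> open W -> W `<=` D ->
  H10 W u -> weak_grad W u G -> weak_grad D (u \_ W) (zero_ext W G).
Proof.
move=> oD oW WD Hu wG.
have mD := open_measurable_rV oD; have mW := open_measurable_rV oW.
have LG := L2v_weak wG.
split => [|psi tpsi i]; first exact: L2v_zero_ext.
have [spsi _ _] := tpsi.
rewrite -/(l2dot D (u \_ W) (partial i psi)) l2dot_mkcondl//.
rewrite -/(l2dot D (fun x => zero_ext W G x 0 i) psi).
have -> : l2dot D (fun x => zero_ext W G x 0 i) psi = l2dot W (fun x => G x 0 i) psi.
  by rewrite zero_extE l2dot_mkcondl.
apply: by_parts_limit => //; first exact: H10_L2.
- exact: test_fun_L2 tpsi.
- exact: test_fun_partial_L2 tpsi.
move=> eps e0; have [phi [tphi h1 h2]] := H10_approx oW Hu wG e0.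
exists phi, (partial i phi); split => //.
- exact: test_fun_L2 tphi.
- exact: test_fun_partial_L2 tphi.
- exact: test_fun_by_parts.
- have := L2v_comp_le i (ltW e0) h2.
  by rewrite (@eq_l2norm _ _ _ _ (fun x => G x 0 i - partial i phi x))// => x _; rewrite !mxE.
Qed.

Lemma H10_zero_ext D W u : open D -> open W -> W `<=` D -> H10 W u -> H10 D (u \_ W).
Proof.
move=> oD oW WD Hu; have wG := H10_weak_grad Hu.
have mD := open_measurable_rV oD; have mW := open_measurable_rV oW.
have wE := weak_grad_zero_ext oD oW WD Hu wG.
apply: (approx_H10 oD _ wE); first exact: L2_mkcond (H10_L2 Hu).
move=> eps e0; have [phi [tphi h1 h2]] := H10_approx oW Hu wG e0.
exists phi; split; first exact: test_fun_subset tphi.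
  rewrite (@eq_l2norm _ _ _ _ ((fun x => u x - phi x) \_ W)) ?l2norm_mkcond// => x _.
  rewrite !patchE; case: ifPn => // /negP xW.
  by rewrite (test_fun_eq0 tphi) ?subr0// => Wx; apply: xW; exact/mem_set.
rewrite (_ : (fun x => _) = zero_ext W (fun x => grad W u x - classical_grad phi x)).
  by rewrite vnorm2_zero_ext.
apply/funext => x; rewrite /zero_ext; case: ifPn => // /negP xW.
rewrite sub0r -[RHS]oppr0; congr (- _); apply/rowP => i; rewrite !mxE.
by rewrite (test_fun_partial_eq0 i tphi)// => Wx; apply: xW; exact/mem_set.
Qed.

End H10_theory.

(** * The energy form *)

Lemma ae_le_integrable d (T : measurableType d) (R : realType)
    (mu : {measure set T -> \bar R}) (D : set T) (f g : T -> R) :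
  measurable D -> measurable_fun D f -> mu.-integrable D (EFin \o g) ->
  {ae mu, forall x, D x -> `|f x| <= `|g x|} -> mu.-integrable D (EFin \o f).
Proof.
move=> mD mf /integrableP[mg gi] fg; apply/integrableP; split.
  exact/measurable_EFinP.
apply: le_lt_trans gi; apply: ae_ge0_le_integral => //.
- by do 2 apply: measurableT_comp => //.
- exact: measurableT_comp.
Qed.

Section form.
Context {R : realType} {n : nat}.
Local Notation mu := (lebesgue_rV R n).
Variables (A : 'rV[R]_n -> 'M[R]_n) (D : set 'rV[R]_n) (alpha beta : R).
Hypotheses (mD : measurable D) (HA : coefficient D alpha beta A) (alpha0 : 0 < alpha).
Implicit Types (G X Y Z : 'rV[R]_n -> 'rV[R]_n).

(** The energy form on arbitrary L2 vector fields. By [energy_form] it computes [energy] from any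
    weak gradients, and [energy_projection] applies it to fields that need not be gradients. *)
Definition form X Y : R := \int[mu]_(x in D) (Y x *m A x *m (X x)^T) 0 0.

Lemma L2_coef X k j : L2v D X -> L2 D (fun x => X x 0 k * A x k j).
Proof.
move=> LX; have [mA [M hM] _ _] := HA; have [mX iX] := LX k.
have mXA : measurable_fun D (fun x => X x 0 k * A x k j) by exact: measurable_funM.
split => //.
apply: (@ae_le_integrable _ _ _ _ _ (fun x => (X x 0 k * A x k j) ^+ 2)
  (fun x => M ^+ 2 * X x 0 k ^+ 2)) => //; first exact: measurable_funX.
  exact: (integrableZl mD (M ^+ 2) iX).
apply: filterS hM => x hx Dx.
have p : 0 <= M ^+ 2 * X x 0 k ^+ 2 by rewrite mulr_ge0 ?sqr_ge0.
rewrite (ger0_norm (sqr_ge0 _)) (ger0_norm p).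
rewrite exprMn mulrC ler_wpM2r ?sqr_ge0// -(real_normK (num_real (A x k j))).
by rewrite lerXn2r ?nnegrE ?hx//; exact: le_trans (normr_ge0 _) (hx Dx k j).
Qed.

Lemma form_integrable X Y : L2v D X -> L2v D Y ->
  mu.-integrable D (EFin \o (fun x => (Y x *m A x *m (X x)^T) 0 0)).
Proof.
move=> LX LY.
rewrite (_ : (fun x => _) = (fun x => \sum_j (\sum_k Y x 0 k * A x k j) * X x 0 j)).
  apply: (Rintegral_sum (index_enum _) mD _).1 => j; apply: L2_mul_integrable => //.
  by apply: L2_sum => // k; exact: L2_coef.
apply/funext => x; rewrite mxE; apply: eq_bigr => j _.
by rewrite !mxE.
Qed.

Lemma form_linl (t : R) X Y Z : L2v D X -> L2v D Y -> L2v D Z ->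
  form (fun x => X x + t *: Y x) Z = form X Z + t * form Y Z.
Proof.
move=> LX LY LZ; rewrite /form -RintegralZl//; last exact: form_integrable.
rewrite -RintegralD//; [|exact: form_integrable|
  exact: (integrableZl mD t (form_integrable LY LZ))].
apply: eq_Rintegral => x _.
by rewrite linearD linearZ/= mulmxDr -scalemxAr !mxE.
Qed.

Lemma formC X Y : L2v D X -> L2v D Y -> form X Y = form Y X.
Proof.
move=> LX LY; have [_ _ sA _] := HA; apply: Rintegral_ae_eq => //.
- by apply/measurable_EFinP; exact: measurable_int (form_integrable LX LY).
- by apply/measurable_EFinP; exact: measurable_int (form_integrable LY LX).
- apply: filterS sA => x hx Dx.
  have -> : (Y x *m A x *m (X x)^T) 0 0 = (Y x *m A x *m (X x)^T)^T 0 0 by rewrite [RHS]mxE.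
  by rewrite !trmx_mul trmxK hx// mulmxA.
Qed.

Lemma form_linr (t : R) X Y Z : L2v D X -> L2v D Y -> L2v D Z ->
  form Z (fun x => X x + t *: Y x) = form Z X + t * form Z Y.
Proof.
move=> LX LY LZ; rewrite formC//; last by apply: L2vD => //; exact: L2vZ.
by rewrite form_linl// (formC LX)// (formC LY).
Qed.

Lemma formBl X Y Z : L2v D X -> L2v D Y -> L2v D Z ->
  form (fun x => X x - Y x) Z = form X Z - form Y Z.
Proof.
move=> LX LY LZ; have := form_linl (-1) LX LY LZ.
rewrite (_ : (fun x => _) = (fun x => X x - Y x)); first by rewrite mulN1r.
by apply/funext => x; rewrite scaleN1r.
Qed.

Lemma formBr X Y Z : L2v D X -> L2v D Y -> L2v D Z ->
  form Z (fun x => X x - Y x) = form Z X - form Z Y.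
Proof.
move=> LX LY LZ; rewrite formC//; last exact: L2vB.
by rewrite formBl// (formC LX)// (formC LY).
Qed.

Lemma enorm_integrable X : L2v D X ->
  mu.-integrable D (EFin \o (fun x => enorm (X x) ^+ 2)).
Proof.
move=> LX; have [h _] := Rintegral_sum (index_enum _) mD (fun i => (LX i).2).
by rewrite (_ : (fun x => _) = (fun x => \sum_i X x 0 i ^+ 2))//;
  apply/funext => x; rewrite enorm_sqr.
Qed.

Lemma form_lower X : L2v D X -> alpha * vnorm2 D X <= form X X.
Proof.
move=> LX; have [_ _ _ eA] := HA.
rewrite vnorm2E// -RintegralZl//; last exact: enorm_integrable.
apply: ae_le_Rintegral => //.
- exact: (integrableZl mD alpha (enorm_integrable LX)).
- exact: form_integrable.
- by apply: filterS eA => x hx Dx; case/andP: (hx Dx (X x)).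
Qed.

Lemma form_upper X : L2v D X -> form X X <= beta * vnorm2 D X.
Proof.
move=> LX; have [_ _ _ eA] := HA.
rewrite vnorm2E// -RintegralZl//; last exact: enorm_integrable.
apply: ae_le_Rintegral => //.
- exact: form_integrable.
- exact: (integrableZl mD beta (enorm_integrable LX)).
- by apply: filterS eA => x hx Dx; case/andP: (hx Dx (X x)).
Qed.

Lemma form_ge0 X : L2v D X -> 0 <= form X X.
Proof.
by move=> LX; apply: le_trans (form_lower LX); rewrite mulr_ge0 ?vnorm2_ge0 ?ltW.
Qed.

Lemma form_sqr (t : R) X Y : L2v D X -> L2v D Y ->
  form (fun x => X x + t *: Y x) (fun x => X x + t *: Y x) =
  form X X + t * form X Y *+ 2 + t ^+ 2 * form Y Y.
Proof.
move=> LX LY; have LtY := L2vZ t mD LY; have LS := L2vD mD LX LtY.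
rewrite form_linl// !form_linr// (formC LY LX).
by move: (form _ _) (form _ _) (form _ _) => a b c; ring.
Qed.

Lemma form_CS X Y : L2v D X -> L2v D Y -> form X Y ^+ 2 <= form X X * form Y Y.
Proof.
move=> LX LY; apply: quadratic_ge0_discr; first exact: form_ge0.
move=> t; rewrite -form_sqr//; apply: form_ge0; apply: L2vD => //; exact: L2vZ.
Qed.

Lemma form_ae X X' Y Y' : L2v D X -> L2v D Y -> L2v D X' -> L2v D Y' ->
  {ae mu, forall x, D x -> X x = X' x} -> {ae mu, forall x, D x -> Y x = Y' x} ->
  form X Y = form X' Y'.
Proof.
move=> LX LY LX' LY' hX hY; apply: Rintegral_ae_eq => //.
- by apply/measurable_EFinP; exact: measurable_int (form_integrable LX LY).
- by apply/measurable_EFinP; exact: measurable_int (form_integrable LX' LY').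
- by apply: filterS2 hX hY => x h h' Dx; rewrite h// h'.
Qed.

Lemma energy_form u v Gu Gv : open D -> weak_grad D u Gu -> weak_grad D v Gv ->
  energy A D u v = form Gu Gv.
Proof.
move=> oD wu wv.
have wu' : weak_grad D u (grad D u) by apply: (@xgetPex _ _ [set G | weak_grad D u G]); exists Gu.
have wv' : weak_grad D v (grad D v) by apply: (@xgetPex _ _ [set G | weak_grad D v G]); exists Gv.
apply: form_ae; [exact: L2v_weak wu'|exact: L2v_weak wv'|exact: L2v_weak wu|
  exact: L2v_weak wv|exact: grad_ae|exact: grad_ae].
Qed.

End form.

(** Used at the end of [energy_projection]: [x] pairs a test gradient with the residual of the k-th
    near minimizer, [y] pairs it with the remaining distance to the limit, and [e] and [f] are 8^-k
    and 4^-k. *)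
Lemma sqr_defect {R : realType} (x y z c b e f : R) : x ^+ 2 <= e * c -> y ^+ 2 <= z * c ->
  z * c <= b * f * c -> e * c <= f * c -> (x - y) ^+ 2 <= (2 * c + 2 * b * c) * f.
Proof.
move=> h1 h2 h3 h4; apply: (@le_trans _ _ (2 * x ^+ 2 + 2 * y ^+ 2)); last by lra.
by have := sqr_ge0 (x + y); lra.
Qed.

(** The parallelogram argument behind the Cauchy property. Two near minimizers have values within
    [p] and [p/8] of the infimum [t], while their midpoint has value at least [t]; this forces the
    squared distance [r] to be at most 9p/4. *)
Lemma parallelogram_gap {R : realType} (p q r s t : R) : 0 < p ->
  q - 1 * s *+ 2 + 1 ^+ 2 * r <= t + 8^-1 * p -> q <= t + p ->
  t <= q - 2^-1 * s *+ 2 + 2^-1 ^+ 2 * r -> r <= 4 * p.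
Proof. by rewrite expr1n exprVn -natrX; lra. Qed.

(** * The energy projection onto H10 *)

Section projection.
Context {R : realType} {n : nat}.
Local Notation mu := (lebesgue_rV R n).
Variables (A : 'rV[R]_n -> 'M[R]_n) (D : set 'rV[R]_n) (alpha beta M : R).
Hypotheses (oD : open D) (HA : coefficient D alpha beta A) (alpha0 : 0 < alpha).
Hypotheses (alpha_le_beta : alpha <= beta) (n0 : (0 < n)%N) (DM : D `<=` cube M) (M0 : 0 <= M).
Implicit Types (G X Y Z : 'rV[R]_n -> 'rV[R]_n).

Let mD : measurable D := open_measurable_rV oD.
Let a X Y := form A D X Y.

Lemma eq0_pow4 (x C : R) : (forall k, x ^+ 2 <= C / 4 ^+ k) -> x = 0.
Proof.
move=> h; apply/eqP; rewrite -sqrf_eq0 eq_le sqr_ge0 andbT.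
have lim0 : (fun k => C / 4 ^+ k) @ \oo --> (0 : R).
  have := @cvg_geometric R C 4^-1.
  rewrite ger0_norm ?invr_ge0// invf_lt1 ?ltr1n// => /(_ isT).
  by apply: cvg_trans; apply: near_eq_cvg; apply: nearW => k; rewrite /geometric /= exprVn.
rewrite -(cvg_lim _ lim0)//; apply: limr_ge; first by apply/cvg_ex; exists 0.
exact: nearW.
Qed.

(* The projection of E onto the gradients of H10, as the limit of a minimizing
   sequence. *)
Lemma energy_projection E : L2v D E -> exists u G,
  [/\ H10 D u, weak_grad D u G &
      forall w Gw, H10 D w -> weak_grad D w Gw -> a (fun x => E x - G x) Gw = 0].
Proof.
move=> LE.
pose V := [set u | H10 D u].
pose J u := a (fun x => E x - grad D u x) (fun x => E x - grad D u x).
have Lg u : H10 D u -> L2v D (grad D u) by move=> Hu; exact: L2v_weak (H10_weak_grad Hu).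
have LEg u : H10 D u -> L2v D (fun x => E x - grad D u x).
  by move=> Hu; exact: L2vB mD LE (Lg u Hu).
have J0 u : H10 D u -> 0 <= J u by move=> Hu; apply: (form_ge0 mD HA alpha0) => //; exact: LEg.
have V0 : H10 D (fun=> 0) by exact: H10_0.
pose S := [set J u | u in V].
have infS : has_inf S.
  split; first by exists (J (fun=> 0)), (fun=> 0).
  by exists 0 => _ [u Hu <-]; exact: J0.
pose m := inf S.
have mJ u : H10 D u -> m <= J u.
  by move=> Hu; apply: ge_inf; [exact: infS.2|exists u].
(* The accuracy 8^-k leads to increments that decay at the rate required by [riesz_fischer]. *)
have ex k : exists u, H10 D u /\ J u <= m + 8^-1 ^+ k.
  have e8 : 0 < 8^-1 ^+ k :> R by rewrite exprn_gt0.
  have [_ [u Hu <-] h] := inf_adherent e8 infS.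
  by exists u; split => //; exact: ltW.
have [u_ hu_] := choice ex.
have Hu k : H10 D (u_ k) by case: (hu_ k).
have Ju k : J (u_ k) <= m + 8^-1 ^+ k by case: (hu_ k).
have Jlin u w (t : R) : H10 D u -> H10 D w ->
    J (fun x => u x + t * w x) = J u - t * a (fun x => E x - grad D u x) (grad D w) *+ 2
      + t ^+ 2 * a (grad D w) (grad D w).
  move=> Hu' Hw; have wl := weak_grad_lin t oD (H10_L2 Hu') (H10_L2 Hw)
    (H10_weak_grad Hu') (H10_weak_grad Hw).
  have Hl := H10_lin t oD Hu' Hw.
  have aeg := grad_ae oD wl.
  have LX := LEg _ Hu'; have LY := Lg _ Hw.
  have := form_sqr mD HA (- t) LX LY; rewrite -/a => e.
  rewrite sqrrN mulNr mulNrn in e; rewrite -e /J.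
  have L1 := L2vD mD LX (L2vZ (- t) mD LY).
  have aeE : {ae mu, forall x, D x -> E x - grad D (fun x => u x + t * w x) x =
      (E x - grad D u x) + - t *: grad D w x}.
    by apply: filterS aeg => x hx Dx; rewrite hx// opprD scaleNr addrA.
  exact: (form_ae mD HA (LEg _ Hl) (LEg _ Hl) L1 L1 aeE aeE).
(* An almost minimizer is almost orthogonal to H10, by the discriminant. *)
have near u w (e : R) : H10 D u -> J u <= m + e -> H10 D w ->
    a (fun x => E x - grad D u x) (grad D w) ^+ 2 <= e * a (grad D w) (grad D w).
  move=> Hu' hJ Hw; apply: quadratic_ge0_discr.
    exact: (form_ge0 mD HA alpha0 (Lg _ Hw)).
  move=> t; have := mJ _ (H10_lin (- t) oD Hu' Hw); rewrite Jlin// sqrrN mulNr mulNrn.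
  move: hJ; move: (J u) (a _ _) (a _ _) (inf S : R) => p q r s; clear; lra.
pose w_ k x := u_ k.+1 x - u_ k x.
have Hw k : H10 D (w_ k) := H10B oD (Hu k.+1) (Hu k).
have p8 k : 0 < 8 ^+ k :> R by rewrite exprn_gt0.
have cauchy k : a (grad D (w_ k)) (grad D (w_ k)) <= 4 / 8 ^+ k.
  have e1 := Jlin (u_ k) (w_ k) 1 (Hu k) (Hw k).
  have e2 := Jlin (u_ k) (w_ k) 2^-1 (Hu k) (Hw k).
  have : (fun x => u_ k x + 1 * w_ k x) = u_ k.+1.
    by apply/funext => x; rewrite /w_ mul1r addrC subrK.
  move=> e3; rewrite e3 in e1.
  have h1 := Ju k.+1; rewrite e1 [8^-1 ^+ k.+1]exprS in h1.
  have h2 := mJ _ (H10_lin 2^-1 oD (Hu k) (Hw k)); rewrite e2 in h2.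
  have h0 : 0 < 8^-1 ^+ k :> R by rewrite exprn_gt0.
  rewrite -exprVn; exact: parallelogram_gap h0 h1 (Ju k) h2.
have aegw k : {ae mu, forall x, D x -> grad D (w_ k) x = grad D (u_ k.+1) x - grad D (u_ k) x}.
  apply: grad_ae => //.
  exact: (weak_gradB oD (H10_L2 (Hu k.+1)) (H10_L2 (Hu k)) (H10_weak_grad (Hu k.+1))
    (H10_weak_grad (Hu k))).
have gradK k i : l2norm D ((fun x => grad D (u_ k.+1) x 0 i) \- (fun x => grad D (u_ k) x 0 i)) ^+ 2
    <= (4 / alpha) / 8 ^+ k.
  have LB := L2vB mD (Lg _ (Hu k.+1)) (Lg _ (Hu k)).
  have -> : l2norm D ((fun x => grad D (u_ k.+1) x 0 i) \- (fun x => grad D (u_ k) x 0 i)) =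
      l2norm D (fun x => grad D (w_ k) x 0 i).
    apply: l2norm_ae => //.
    - by have [] := L2B mD (Lg _ (Hu k.+1) i) (Lg _ (Hu k) i).
    - by have [] := Lg _ (Hw k) i.
    - by apply: filterS (aegw k) => x hx Dx; rewrite hx// !mxE.
  apply: le_trans (le_vnorm2 D (grad D (w_ k)) i) _.
  rewrite mulrAC ler_pdivlMr// mulrC.
  exact: le_trans (form_lower mD HA (Lg _ (Hw k))) (cauchy k).
(* Friedrichs' inequality transfers the rate from the gradients to the functions themselves. *)
have uK k : l2norm D (u_ k.+1 \- u_ k) ^+ 2 <= ((2 * M) ^+ 2 * (4 / alpha)) / 8 ^+ k.
  have := H10_friedrichs (Ordinal n0) oD DM M0 (Hw k) (H10_weak_grad (Hw k)).
  rewrite -(@ler_pXn2r _ 2)// ?nnegrE ?mulr_ge0 ?l2norm_ge0// exprMn => /le_trans; apply.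
  rewrite -mulrA ler_wpM2l ?sqr_ge0//.
  apply: le_trans (le_vnorm2 D (grad D (w_ k)) _) _.
  rewrite mulrAC ler_pdivlMr// mulrC.
  exact: le_trans (form_lower mD HA (Lg _ (Hw k))) (cauchy k).
have [u [Lu [Cu Cu0 hu]]] := riesz_fischer mD (fun k => H10_L2 (Hu k)) uK.
have RF i : exists gC : ('rV[R]_n -> R) * R, [/\ L2 D gC.1, 0 <= gC.2 &
    forall k, l2norm D (gC.1 \- (fun x => grad D (u_ k) x 0 i)) ^+ 2 <= gC.2 / 4 ^+ k].
  have [g [Lg' [C C0 hg]]] := riesz_fischer mD (fun k => Lg _ (Hu k) i) (fun k => gradK k i).
  by exists (g, C).
have [gC hgC] := choice RF.
pose G (x : 'rV[R]_n) : 'rV[R]_n := \row_i (gC i).1 x.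
have LG : L2v D G.
  move=> i; rewrite (_ : (fun x => _) = (gC i).1); first by have [] := hgC i.
  by apply/funext => x; rewrite mxE.
pose CG := \sum_i (gC i).2.
have CG0 : 0 <= CG by apply: sumr_ge0 => i _; have [] := hgC i.
have hG k : vnorm2 D (fun x => G x - grad D (u_ k) x) <= CG / 4 ^+ k.
  rewrite /vnorm2 /CG mulr_suml; apply: ler_sum => i _.
  have [_ _ /(_ k)] := hgC i.
  by rewrite (@eq_l2norm _ _ _ _ (fun x => (G x - grad D (u_ k) x) 0 i))// => x _; rewrite !mxE.
have small (C eps : R) : 0 <= C -> 0 < eps -> exists k, C / 4 ^+ k <= eps ^+ 2.
  move=> C0 e0; apply: contrapT => /forallNP h.
  have : eps = 0.
    apply: (@eq0_pow4 _ C) => k.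
    by have /negP := h k; rewrite -ltNge => /ltW.
  by move=> e; rewrite e ltxx in e0.
have approx eps : 0 < eps -> exists k, l2norm D (fun x => u x - u_ k x) <= eps /\
    vnorm2 D (fun x => G x - grad D (u_ k) x) <= eps ^+ 2.
  move=> e0; have [k hk] := small (Cu + CG) eps (addr_ge0 Cu0 CG0) e0.
  have i4 : 0 <= (4 ^+ k)^-1 :> R by rewrite invr_ge0 exprn_ge0.
  rewrite mulrDl in hk; exists k; split.
    rewrite -(@ler_pXn2r _ 2)// ?nnegrE ?l2norm_ge0 ?(ltW e0)//.
    apply: le_trans (hu k) _; apply: le_trans hk; rewrite lerDl.
    exact: mulr_ge0.
  apply: le_trans (hG k) _; apply: le_trans hk; rewrite lerDr.
  exact: mulr_ge0.
have wG : weak_grad D u G.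
  apply: weak_grad_closed => // eps /approx[k [h1 h2]].
  exists (u_ k), (grad D (u_ k)).
  by split; [exact: H10_L2 (Hu k)|exact: H10_weak_grad (Hu k)|exact: h1|exact: h2].
have Huu : H10 D u.
  apply: (H10_closed oD Lu wG) => eps /approx[k [h1 h2]].
  exists (u_ k), (grad D (u_ k)).
  by split; [exact: Hu|exact: H10_weak_grad (Hu k)|exact: h1|exact: h2].
exists u, G; split; [exact: Huu|exact: wG|move=> w Gw Hw' wGw].
have LEG := L2vB mD LE LG.
have LGw := L2v_weak wGw.
have -> : a (fun x => E x - G x) Gw = a (fun x => E x - G x) (grad D w).
  apply: (form_ae mD HA LEG LGw LEG (Lg _ Hw')); first exact: aeW.
  by apply: filterS (grad_ae oD wGw) => x hx Dx; rewrite hx.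
have Lgw := Lg _ Hw'.
pose c := a (grad D w) (grad D w).
have c0 : 0 <= c := form_ge0 mD HA alpha0 Lgw.
apply: (@eq0_pow4 _ (2 * c + 2 * (beta * CG) * c)) => k.
have LGk := L2vB mD LG (Lg _ (Hu k)).
have eEG : (fun x => E x - G x) =
    fun x => (E x - grad D (u_ k) x) - (G x - grad D (u_ k) x).
  by apply/funext => x; rewrite opprB addrA subrK.
have split_k : a (fun x => E x - G x) (grad D w) =
    a (fun x => E x - grad D (u_ k) x) (grad D w) - a (fun x => G x - grad D (u_ k) x) (grad D w).
  by rewrite eEG; exact: (formBl mD HA (LEg _ (Hu k)) LGk Lgw).
rewrite split_k.
have h1 := near _ _ _ (Hu k) (Ju k) Hw'; rewrite -/c in h1.
have h2 := form_CS mD HA alpha0 LGk Lgw; rewrite -/a -/c in h2.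
have h3 : a (fun x => G x - grad D (u_ k) x) (fun x => G x - grad D (u_ k) x) <= beta * CG / 4 ^+ k.
  apply: le_trans (form_upper mD HA LGk) _.
  have b0 : 0 <= beta := le_trans (ltW alpha0) alpha_le_beta.
  by rewrite -mulrA ler_wpM2l.
have h4 : 8^-1 ^+ k <= (4 ^+ k)^-1 :> R.
  rewrite -exprVn lerXn2r ?nnegrE ?invr_ge0// lef_pV2 ?posrE//.
  by rewrite ler_nat.
have h5 := ler_wpM2r c0 h3; have h6 := ler_wpM2r c0 h4.
exact: sqr_defect h1 h2 h5 h6.
Qed.

End projection.

(** * Difference quotients and mean values on convex sets *)

Section fubini_shift.
Context {R : realType} {n : nat}.
Local Notation mu := (lebesgue_rV R n).
Local Notation nu := (@lebesgue_measure R).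
Local Notation I := (`[0, 1]%classic : set R).
Variable h : 'rV[R]_n.
Implicit Types (f g : 'rV[R]_n -> R).

Lemma measurable_line :
  measurable_fun setT (fun z : R * 'rV[R]_n => z.2 + z.1 *: h).
Proof.
apply: measurable_fun_coordP => i.
rewrite (_ : _ \o _ = fun z => coordV i z.2 + z.1 * h 0 i).
  apply: measurable_funD; last by apply: measurable_funM.
  by apply: measurableT_comp => //; exact: measurable_coord.
by apply/funext => x; rewrite /coordV /= !mxE.
Qed.

Lemma measurable_translate f (c : 'rV[R]_n) : measurable_fun setT f ->
  measurable_fun setT (fun x : 'rV[R]_n => f (x + c)).
Proof.
move=> mf; apply: (measurableT_comp mf).
have := measurable_affine 1 c.
by rewrite (_ : (fun x => _) = (fun x => x + c))//; apply/funext => x; rewrite scale1r.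
Qed.

Lemma L2_translate f (c : 'rV[R]_n) : L2 setT f -> L2 setT (fun x : 'rV[R]_n => f (x + c)).
Proof.
move=> [mf fi]; split; first exact: measurable_translate.
apply/integrableP; split.
  apply/measurable_EFinP; apply: measurable_funX; exact: measurable_translate.
case/integrableP : fi => m2 fi.
by rewrite (ge0_integral_translate c (f := fun x => `|(f x ^+ 2)%:E|%E))//;
  exact: measurableT_comp.
Qed.

Lemma l2norm_translate f (c : 'rV[R]_n) : measurable_fun setT f ->
  l2norm setT (fun x : 'rV[R]_n => f (x + c)) = l2norm setT f.
Proof.
move=> mf; congr (Num.sqrt (fine _)).
rewrite (integral_translate c (f := fun x => (f x * f x)%:E))//.
by apply/measurable_EFinP; exact: measurable_funM.
Qed.

Let k f g (z : R * 'rV[R]_n) : \bar R := (\1_I z.1 * (f (z.2 + z.1 *: h) * g z.2))%:E.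

Let mk f g : measurable_fun setT f -> measurable_fun setT g ->
  measurable_fun setT (k f g).
Proof.
move=> mf mg; apply/measurable_EFinP; apply: measurable_funM.
  apply: (@measurableT_comp _ _ _ _ _ _ (\1_I : R -> R)) => //.
apply: measurable_funM.
  exact: (measurableT_comp mf measurable_line).
exact: measurableT_comp.
Qed.

Let mI : @measurable _ (measurableTypeR R) I. Proof. exact: measurable_itv. Qed.

Let ki f g : L2 setT f -> L2 setT g -> (nu \x mu)%E.-integrable setT (k f g).
Proof.
move=> Lf Lg; have [mf fi] := Lf; have [mg gi] := Lg.
apply/integrable12ltyP; first exact: mk.
pose N := (\int[mu]_x (f x ^+ 2)%:E + \int[mu]_x (g x ^+ 2)%:E)%E.
have N0 : (0 <= N)%E by apply: adde_ge0; apply: integral_ge0 => x _; rewrite lee_fin sqr_ge0.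
have Nfin : N \is a fin_num by rewrite fin_numD !integrable_fin_num.
apply: (@le_lt_trans _ _ (\int[nu]_t ((\1_I t)%:E * N)))%E.
  apply: ge0_le_integral => //.
  - by move=> t _; apply: integral_ge0.
  - have mm : measurable_fun setT (abse \o k f g).
      by apply: measurableT_comp => //; exact: mk.
    exact: (measurable_fun_fubini_tonelli_F (abse \o k f g) mm (fun z => abse_ge0 _)).
  - by apply: emeasurable_funM => //; apply/measurable_EFinP.
  - move=> t _; rewrite /N.
    have e1 : (\int[mu]_x (f x ^+ 2)%:E = \int[mu]_x (f (x + t *: h)%R ^+ 2)%:E)%E.
      rewrite (integral_translate (t *: h) (f := fun x => (f x ^+ 2)%:E))//.
      by apply/measurable_EFinP; exact: measurable_funX.
    rewrite e1 -ge0_integralD//; last 4 first.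
    + by move=> x _; rewrite lee_fin sqr_ge0.
    + by apply/measurable_EFinP; apply: measurable_funX; exact: measurable_translate.
    + by move=> x _; rewrite lee_fin sqr_ge0.
    + by apply/measurable_EFinP; exact: measurable_funX.
    rewrite -ge0_integralZl//; last 2 first.
    + by apply: emeasurable_funD; apply/measurable_EFinP; apply: measurable_funX => //;
        exact: measurable_translate.
    + by move=> x _; rewrite adde_ge0// lee_fin sqr_ge0.
    apply: ge0_le_integral => //.
    + have m1 : measurable_fun setT (fun x : 'rV[R]_n => \1_I t * (f (x + t *: h) * g x)).
        apply: measurable_funM => //; apply: measurable_funM => //.
        exact: measurable_translate.
      have m2 : measurable_fun setT (EFin \o
          (fun x : 'rV[R]_n => \1_I t * (f (x + t *: h) * g x))) by exact/measurable_EFinP.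
      exact: (measurableT_comp (@abse_measurable R setT) m2).
    + apply: emeasurable_funM => //.
      by apply: emeasurable_funD; apply/measurable_EFinP; apply: measurable_funX => //;
        exact: measurable_translate.
    + move=> x _; rewrite /k /= -EFinD -EFinM lee_fin normrM ger0_norm//.
      rewrite ler_wpM2l// normrM.
      rewrite -(real_normK (num_real (f _))) -(real_normK (num_real (g x))).
      move: (normr_ge0 (f (x + t *: h))) (normr_ge0 (g x)).
      move: (`|f _|) (`|g x|) => p q; clear => p0 q0.
      by have := sqr_ge0 (p - q); nra.
rewrite -(fineK Nfin); under eq_integral do rewrite muleC.
rewrite ge0_integralZl//; [|by apply/measurable_EFinP|exact: fine_ge0].
rewrite integral_indic// setIT /= lebesgue_measure_itv/= lte_fin ltr01.
by rewrite -EFinB -EFinM ltry.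
Qed.

(** The integral along a line need not converge for every x, so measurability is obtained for the
    positive and the negative part separately, by Tonelli. *)
Lemma measurable_line_average f : measurable_fun setT f ->
  measurable_fun setT (fun x : 'rV[R]_n => \int[nu]_(t in I) f (x + t *: h)).
Proof.
move=> mf; apply: measurableT_comp => //.
have mz : measurable_fun setT (fun z : R * 'rV[R]_n => (\1_I z.1 * f (z.2 + z.1 *: h))%:E).
  apply/measurable_EFinP; apply: measurable_funM.
    exact: (@measurableT_comp _ _ _ _ _ _ (\1_I : R -> R)).
  exact: (measurableT_comp mf measurable_line).
rewrite (_ : (fun x => _) = (fun x =>
   (fubini_G nu ((fun z : R * 'rV[R]_n => (\1_I z.1 * f (z.2 + z.1 *: h))%:E)^\+) x -
    fubini_G nu ((fun z : R * 'rV[R]_n => (\1_I z.1 * f (z.2 + z.1 *: h))%:E)^\-) x)%E)).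
  apply: emeasurable_funB.
    by apply: measurable_fun_fubini_tonelli_G => //; exact: measurable_funepos.
  by apply: measurable_fun_fubini_tonelli_G => //; exact: measurable_funeneg.
apply/funext => x; rewrite integral_mkcond integralE /fubini_G; congr (_ - _)%E.
  by apply: eq_integral => t _; rewrite !funeposE patchE indicE;
    case: ifP => _; rewrite ?mul1r ?mul0r.
by apply: eq_integral => t _; rewrite !funenegE patchE indicE;
  case: ifP => _; rewrite ?mul1r ?mul0r.
Qed.

(** Fubini on the product of [0, 1] with the space. Absolute integrability follows from |f(x + t h)
    g(x)| <= f(x + t h)^2 + g(x)^2, as the integral of the first square does not depend on t. *)
Lemma fubini_shift f g : L2 setT f -> L2 setT g ->
  mu.-integrable setT (EFin \o (fun x : 'rV[R]_n => (\int[nu]_(t in I) f (x + t *: h)) * g x)) /\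
  \int[mu]_x ((\int[nu]_(t in I) f (x + t *: h)) * g x) =
  \int[nu]_(t in I) \int[mu]_x (f (x + t *: h) * g x) /\
  nu.-integrable I (EFin \o (fun t : R => \int[mu]_x (f (x + t *: h) * g x))).
Proof.
move=> Lf Lg; have [mf fi] := Lf; have [mg gi] := Lg.
have kfg := ki Lf Lg.
have mFg : measurable_fun setT (fun x : 'rV[R]_n => (\int[nu]_(t in I) f (x + t *: h)) * g x).
  by apply: measurable_funM => //; exact: measurable_line_average.
have ae : {ae mu, forall x, setT x ->
    fubini_G nu (k f g) x = ((\int[nu]_(t in I) f (x + t *: h)) * g x)%:E}.
  have := ae_integrable2 kfg; apply: filterS => x ix _; rewrite /fubini_G /k /=.
  (* Where [g] vanishes both sides are zero; elsewhere dividing by [g x] recovers the integrability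
     of [f] along the segment. *)
  have [g0|g0] := eqVneq (g x) 0.
    by rewrite g0 mulr0; under eq_integral do rewrite !mulr0; rewrite integral0.
  have ixI : nu.-integrable I (EFin \o (fun t : R => f (x + t *: h))).
    apply: (@integrable_mkcond _ _ R nu I (EFin \o (fun t : R => f (x + t *: h))) mI).2.
    have := integrableZl measurableT (g x)^-1 ix.
    apply: eq_integrable => // t _; rewrite /k /= -EFinM patchE indicE.
    by case: ifP => _; rewrite ?mul0r ?mulr0 ?mul1r// mulrC mulfK.
  rewrite -RintegralZr// /Rintegral fineK; last first.
    by apply: integrable_fin_num => //; exact: (integrableZr mI (g x) ixI).
  rewrite [RHS]integral_mkcond; apply: eq_integral => t _.
  by rewrite patchE indicE; case: ifP => _; rewrite ?mul0r ?mul1r.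
have mabs : measurable_fun setT (abse \o k f g) by apply: measurableT_comp => //; exact: mk.
have iG : mu.-integrable setT (fubini_G nu (k f g)).
  apply/integrableP; split; first exact: (measurable_fubini_G kfg).
  apply: le_lt_trans ((integrable21ltyP nu mu (mk mf mg)).1 kfg).
  apply: ge0_le_integral => //.
  - apply: measurableT_comp => //; exact: (measurable_fubini_G kfg).
  - exact: (measurable_fun_fubini_tonelli_G (m1 := nu) (abse \o k f g) mabs (fun z => abse_ge0 _)).
  - move=> x _; apply: le_abse_integral => //.
    exact: (measurableT_comp (mk mf mg) (pair2_measurable x)).
have iFg : mu.-integrable setT
    (EFin \o (fun x : 'rV[R]_n => (\int[nu]_(t in I) f (x + t *: h)) * g x)).
  apply/integrableP; split; first exact/measurable_EFinP.
  case/integrableP : iG => mG; apply: le_lt_trans.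
  apply: ae_ge0_le_integral => //.
  - by apply: measurableT_comp => //; exact/measurable_EFinP.
  - exact: measurableT_comp.
  - by apply: filterS ae => x /(_ Logic.I) -> _.
have FE t : fubini_F mu (k f g) t =
    ((EFin \o (fun t : R => \int[mu]_x (f (x + t *: h) * g x))) \_ I) t.
  rewrite /fubini_F /k /= patchE indicE; case: ifPn => tI.
    under eq_integral do rewrite mul1r.
    rewrite /= /Rintegral fineK//; apply: integrable_fin_num => //.
    exact: L2_mul_integrable (L2_translate _ Lf) Lg.
  by under eq_integral do rewrite mul0r; rewrite integral0.
split => //; split; last first.
  apply: (@integrable_mkcond _ _ R nu I _ mI).2.
  have := integrable_fubini_F kfg; apply: eq_integrable => // t _.
  exact: FE.
have eG : (\int[mu]_x ((\int[nu]_(t in I) f (x + t *: h)) * g x)%:E =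
    \int[mu]_x fubini_G nu (k f g) x)%E.
  apply: ae_eq_integral => //.
  - exact/measurable_EFinP.
  - exact: measurable_int iG.
  - by apply: filterS ae => x hx /hx ->.
rewrite /Rintegral eG integral21_prod_meas1// -integral12_prod_meas1//.
congr fine; rewrite [RHS]integral_mkcond; apply: eq_integral => t _.
exact: FE.
Qed.

End fubini_shift.

Lemma le_Rintegral01 {R : realType} (F : R -> R) (K : R) :
  (@lebesgue_measure R).-integrable `[0, 1]%classic (EFin \o F) ->
  (forall t, F t <= K) ->
  \int[@lebesgue_measure R]_(t in `[0, 1]) F t <= K.
Proof.
move=> iF FK.
have mI : @measurable _ (measurableTypeR R) `[0, 1]%classic by exact: measurable_itv.
have n1 : @lebesgue_measure R `[0, 1]%classic = 1%E.
  by rewrite lebesgue_measure_itv/= lte_fin ltr01 -EFinB subr0.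
have iK : (@lebesgue_measure R).-integrable `[0, 1]%classic (cst K%:E).
  apply/integrableP; split; first exact: measurable_cst.
  by rewrite integral_cst// [X in (_ * X)%E]n1 mule1/= ltry.
rewrite -lee_fin /Rintegral fineK; last exact: integrable_fin_num.
apply: le_trans (le_integral mI iF iK _) _.
  by move=> t _; rewrite lee_fin.
by rewrite integral_cst// [X in (_ * X)%E]n1 mule1.
Qed.

(** * Differences of a weakly differentiable function *)

Section difference.
Context {R : realType} {n : nat}.
Local Notation mu := (lebesgue_rV R n).
Local Notation nu := (@lebesgue_measure R).
Implicit Types (D : set 'rV[R]_n) (u f g psi : 'rV[R]_n -> R) (v x : 'rV[R]_n).

Lemma dotv_CS (x y : 'rV[R]_n) : dotv x y ^+ 2 <= enorm x ^+ 2 * enorm y ^+ 2.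
Proof.
rewrite !enorm_sqr; apply: quadratic_ge0_discr.
  by apply: sumr_ge0 => i _; exact: sqr_ge0.
move=> t; rewrite /dotv [t * _]mulr_sumr -sumrMnl [t ^+ 2 * _]mulr_sumr -!big_split/=.
apply: sumr_ge0 => i _.
rewrite [X in 0 <= X](_ : _ = (x 0 i + t * y 0 i) ^+ 2) ?sqr_ge0//; ring.
Qed.

Lemma partial_translate f v i x :
  partial i (fun y => f (y + v)) x = partial i f (x + v).
Proof.
rewrite /partial /derive; set g1 := fun h : R => h^-1 *: _.
set g2 := fun h : R => h^-1 *: _; suff -> : g1 = g2 by [].
by apply/funext => h; rewrite /g1 /g2 /= addrA.
Qed.

Lemma bump_translate (c : R) a b v x :
  bump c a b (x - v) = bump c (a + v) (b + v) x :> R.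
Proof.
by apply: eq_bigr => i _; rewrite !mxE bump1_shift.
Qed.

Definition dir_derive v psi x : R := \sum_i v 0 i * partial i psi x.

Lemma bump_line_derive (c : R) a b v x (t : R) : 0 < c ->
  is_derive t 1 (fun s : R => bump c a b (x + s *: v)) (dir_derive v (bump c a b) (x + t *: v)).
Proof.
move=> c0; have [psi' spsi' dpsi] :=
  smooth1_choice (fun i => smooth1_bump1 (a 0 i) (b 0 i) c0).
have := is_derive_prodf_line x v t dpsi.
rewrite (_ : (fun h : R => _) = (fun s : R => bump c a b (x + s *: v))); last first.
  by apply/funext => s; rewrite addrC.
move=> h; apply: is_derive_eq h _; apply: eq_bigr => j _.
by rewrite (partial_prodf j dpsi) addrC.
Qed.

Lemma ccont_dir_derive D v psi : test_fun D psi -> ccont (dir_derive v psi).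
Proof.
move=> tpsi; rewrite /dir_derive; elim: (index_enum _) => [|j r IH].
  under eq_fun do rewrite big_nil.
  by split; [exact: cst_continuous|exists 0].
under eq_fun do rewrite big_cons.
apply: ccontD => //; under eq_fun do rewrite mulrC.
by apply: ccontM; [exact: test_fun_partial_ccont tpsi|exact: cst_continuous].
Qed.

Lemma bump_FTC (c : R) a b v x : 0 < c ->
  \int[nu]_(t in `[0, 1]) dir_derive v (bump c a b) (x + t *: v) =
  bump c a b (x + v) - bump c a b x.
Proof.
move=> c0.
have tb : test_fun (cbox a b) (bump c a b) by exact: test_fun_bump.
have cline : continuous (fun t : R => x + t *: v).
  move=> t; apply: (@continuousD R _ _ (cst x) (fun t : R => t *: v)).
    exact: cst_continuous.
  exact: scalel_continuous.
have d t := bump_line_derive a b v x t c0.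
have dcont t : {for t, continuous (fun s : R => bump c a b (x + s *: v))}.
  by apply: derivable_ext_at; case: (d t).
rewrite /Rintegral (@continuous_FTC2 R _ (fun s : R => bump c a b (x + s *: v)))//.
- by rewrite /= scale1r scale0r addr0.
- apply: continuous_subspaceT => t.
  apply: (@continuous_comp _ _ _ (fun t : R => x + t *: v)); first exact: cline.
  by case: (ccont_dir_derive v tb) => + _; apply.
- split; first by move=> t _; case: (d t).
    by apply: cvg_at_right_filter; exact: dcont.
  by apply: cvg_at_left_filter; exact: dcont.
- by move=> t _; rewrite derive1E (derive_val (is_derive := d t)).
Qed.

Lemma Rintegral_translate f v : measurable_fun setT f ->
  \int[mu]_x f (x + v) = \int[mu]_x f x.
Proof.
move=> mf; congr fine.
by apply: (integral_translate v (f := EFin \o f)); exact/measurable_EFinP.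
Qed.

Lemma l2dot_translate f g v : measurable_fun setT f -> measurable_fun setT g ->
  l2dot setT (fun x => f (x + v)) g = l2dot setT f (fun x => g (x - v)).
Proof.
move=> mf mg; rewrite /l2dot.
rewrite -(@Rintegral_translate (fun x => f x * g (x - v)) v).
  by apply: eq_Rintegral => x _; rewrite addrK.
by apply: measurable_funM => //; exact: measurable_translate.
Qed.

Definition convexV D := forall x y (t : R), D x -> D y -> 0 <= t <= 1 ->
  D ((1 - t) *: x + t *: y).

(** The derivative of u in direction [h], with the gradient extended by zero so that it may be
    evaluated at all x + t h. *)
Definition hdot D (h : 'rV[R]_n) (G : 'rV[R]_n -> 'rV[R]_n) x : R :=
  dotv h (zero_ext D G x).

Lemma hdotE D h G x : hdot D h G x = \sum_i h 0 i * ((fun y => G y 0 i) \_ D) x.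
Proof.
by apply: eq_bigr => i _; rewrite -(zero_extE D G i).
Qed.

Lemma L2_hdot D h G : measurable D -> L2v D G -> L2 setT (hdot D h G).
Proof.
move=> mD LG; rewrite (_ : hdot D h G = fun x => \sum_i h 0 i * zero_ext D G x 0 i)//.
apply: L2_sum => // i; apply: L2Z => //; rewrite zero_extE.
exact: L2_mkcond.
Qed.

Lemma l2norm_hdot D h G : measurable D -> L2v D G ->
  l2norm setT (hdot D h G) ^+ 2 <= enorm h ^+ 2 * vnorm2 D G.
Proof.
move=> mD LG; have LE : L2v setT (zero_ext D G) by exact: L2v_zero_ext.
rewrite -(@vnorm2_zero_ext _ _ setT)// vnorm2E// l2norm_sqrE.
have ie := (Rintegral_sum (index_enum _) measurableT (fun i => (LE i).2)).1.
have ie' : mu.-integrable setT (EFin \o (fun x => enorm (zero_ext D G x) ^+ 2)).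
  by rewrite (_ : (fun x => _) = (fun x => \sum_i zero_ext D G x 0 i ^+ 2))//;
    apply/funext => x; rewrite enorm_sqr.
rewrite -RintegralZl//; apply: le_Rintegral => //.
- by case: (L2_hdot h mD LG).
- exact: (integrableZl measurableT (enorm h ^+ 2) ie').
- by move=> x _; exact: dotv_CS.
Qed.

(** The points at which the difference u(x + h) - u(x) involves only values in [D]; if [D] is
    convex, the whole segment from x to x + h then stays in [D]. *)
Definition common D (h : 'rV[R]_n) : set 'rV[R]_n := [set x | D x /\ D (x + h)].

Lemma open_common D h : open D -> open (common D h).
Proof.
move=> oD; apply: openI => //.
apply: (@open_comp _ _ (fun x => x + h)) => // x _.
apply: (@continuousD R _ 'rV[R]_n id (cst h) x); first exact: cvg_id.
exact: cst_continuous.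
Qed.

(* The weak form of the fundamental theorem of calculus along h, tested
   with a bump. *)
Lemma difference_bump D u G h (c : R) a b : open D -> convexV D ->
  L2 D u -> weak_grad D u G -> 0 < c -> cbox a b `<=` common D h ->
  l2dot setT (fun x => (u \_ D) (x + h) - (u \_ D) x) (bump c a b) =
  l2dot setT (fun x => \int[nu]_(t in `[0, 1]) hdot D h G (x + t *: h)) (bump c a b).
Proof.
move=> oD cD Lu wG c0 abB; have mD := open_measurable_rV oD.
have [LG hG] := wG.
set u0 := u \_ D; set psi := bump c a b.
have Lu0 : L2 setT u0 by exact: L2_mkcond.
have tpsi : test_fun (cbox a b) psi by exact: test_fun_bump.
have Lpsi : L2 setT psi by exact: test_fun_L2 tpsi.
have Ldpsi : L2 setT (dir_derive (- h) psi) by apply: ccont_L2 => //; exact: ccont_dir_derive tpsi.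
have Lgh := L2_hdot h mD LG.
have [mu0 _] := Lu0; have [mpsi _] := Lpsi; have [mgh _] := Lgh.
have Lu0h := L2_translate h Lu0.
have Lpsih := L2_translate (- h) Lpsi.
rewrite l2dotBl// l2dot_translate//.
(* The shift is moved onto the smooth bump, to which the classical theorem applies in direction
   [- h]. *)
transitivity (l2dot setT (fun x => \int[nu]_(t in `[0, 1]) dir_derive (- h) psi (x + t *: - h)) u0).
  rewrite (l2dotC _ u0 psi) (l2dotC _ u0) -l2dotBl//.
  by apply: eq_Rintegral => x _; rewrite bump_FTC.
have [_ [e1 _]] := fubini_shift (- h) Ldpsi Lu0.
have [_ [e2 _]] := fubini_shift h Lgh Lpsi.
rewrite /l2dot e1 e2; apply: eq_Rintegral => t; rewrite inE /= in_itv/= => t01.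
pose psit := bump c (a + t *: h) (b + t *: h).
have psitE x : psit x = psi (x + t *: - h) by rewrite /psit -bump_translate scalerN.
(* A point y of the shifted box is the convex combination of y - t h and y - t h + h, both of which
   lie in [D]; hence the shifted bump is a test function of [D]. *)
have sub : cbox (a + t *: h) (b + t *: h) `<=` D.
  move=> y hy; have [D1 D2] : common D h (y - t *: h).
    apply: abB => i; have := hy i; rewrite !mxE => /andP[h1 h2].
    by apply/andP; split; lra.
  have := cD _ _ t D1 D2 t01.
  have -> : (1 - t) *: (y - t *: h) + t *: (y - t *: h + h) = y.
    by apply/rowP => i; rewrite !mxE; ring.
  by [].
have tpsit : test_fun D psit by exact: test_fun_bump.
have Lpsit := test_fun_L2 mD tpsit.
rewrite -/(l2dot setT (fun x => hdot D h G (x + t *: h)) psi) l2dot_translate//.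
rewrite -/(l2dot setT (fun x => dir_derive (- h) psi (x + t *: - h)) u0).
have -> : l2dot setT (hdot D h G) (fun x => psi (x - t *: h)) =
    \sum_i h 0 i * l2dot D (fun x => G x 0 i) psit.
  rewrite (_ : hdot D h G = fun x => \sum_i h 0 i * ((fun y => G y 0 i) \_ D) x); last first.
    by apply/funext => x; rewrite hdotE.
  rewrite (_ : (fun x => psi (x - _)) = psit); last first.
    by apply/funext => x; rewrite psitE scalerN.
  have LT : L2 setT psit by exact: test_fun_L2 tpsit.
  have LGD i : L2 setT ((fun y => G y 0 i) \_ D) by exact: L2_mkcond.
  rewrite l2dot_suml//; last by move=> i; exact: L2Z.
  by apply: eq_bigr => i _; rewrite l2dotZl// l2dot_mkcondl.
have -> : (fun x => dir_derive (- h) psi (x + t *: - h)) =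
    (fun x => \sum_i (- h 0 i) * partial i psit x).
  apply/funext => x; apply: eq_bigr => i _; rewrite !mxE; congr (_ * _).
  by rewrite -partial_translate; congr (partial i _ x); apply/funext => y; rewrite psitE.
have Lp i : L2 setT (partial i psit) by exact: test_fun_partial_L2 tpsit.
rewrite l2dot_suml//; last by move=> i; exact: L2Z.
apply: eq_bigr => i _; rewrite l2dotZl// l2dotC l2dot_mkcondl//.
by rewrite /l2dot (hG psit tpsit i) mulrNN.
Qed.

(** The fundamental lemma removes the bump from [difference_bump]. The local integrability that it
    requires comes from pairing the line average with indicators of boxes. *)
Lemma difference_ae D u G h : open D -> convexV D -> L2 D u -> weak_grad D u G ->
  {ae mu, forall x, common D h x -> (u \_ D) (x + h) - (u \_ D) x =
    \int[nu]_(t in `[0, 1]) hdot D h G (x + t *: h)}.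
Proof.
move=> oD cD Lu wG; have mD := open_measurable_rV oD.
have oB := @open_common D h oD; have mB := open_measurable_rV oB.
set w := fun x => (u \_ D) (x + h) - (u \_ D) x.
set F := fun x => \int[nu]_(t in `[0, 1]) hdot D h G (x + t *: h).
have Lu0 : L2 setT (u \_ D) by exact: L2_mkcond.
have Lw : L2 setT w by apply: L2B => //; exact: L2_translate.
have Lgh := L2_hdot h mD (L2v_weak wG).
have iF g : L2 setT g -> mu.-integrable setT (EFin \o (fun x => F x * g x)).
  by move=> Lg; have [] := fubini_shift h Lgh Lg.
suff : {ae mu, forall x, common D h x -> w x - F x = 0}.
  by apply: filterS => x hx /hx /eqP; rewrite subr_eq0 => /eqP.
apply: fundamental_lemma => //.
  move=> a b _; have mab := @measurable_cbox R n a b.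
  have wi : mu.-integrable (cbox a b) (EFin \o w).
    apply: (L2_integrable_sub measurableT) Lw => //; exact: lebesgue_rV_cbox_lty.
  have Fi : mu.-integrable (cbox a b) (EFin \o F).
    apply: (integrable_mkcond _ mab).2.
    have L1 := L2_cst_fin 1 mab (lebesgue_rV_cbox_lty a b).
    have := iF _ (L2_mkcond measurableT mab (@subsetT _ _) L1).
    apply: eq_integrable => // x _; rewrite /= !patchE.
    by case: ifP => _; rewrite ?mulr1 ?mulr0.
  exact: (integrableB mab wi Fi).
move=> c a b c0 abB; have tb : test_fun (common D h) (bump c a b) by exact: test_fun_bump.
have Lb : L2 setT (bump c a b) by exact: test_fun_L2 tb.
rewrite Rintegral_support; last by move=> x nx; rewrite (test_fun_eq0 tb nx) mulr0.
under eq_Rintegral do rewrite mulrBl.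
rewrite RintegralB//; [|exact: L2_mul_integrable|exact: iF].
by have := difference_bump oD cD Lu wG c0 abB; rewrite /l2dot => ->; rewrite subrr.
Qed.

(** The difference w is paired with itself: by Fubini |w|^2 is the integral over t of the products
    of w with translates of [hdot D h G]. Each is at most |w| times the norm of [hdot D h G], which
    no translation changes, and one factor |w| cancels. *)
Lemma difference_l2norm D u G h : open D -> convexV D -> L2 D u -> weak_grad D u G ->
  l2norm (common D h) (fun x => (u \_ D) (x + h) - (u \_ D) x) ^+ 2
    <= enorm h ^+ 2 * vnorm2 D G.
Proof.
move=> oD cD Lu wG; have mD := open_measurable_rV oD.
have oB := @open_common D h oD; have mB := open_measurable_rV oB.
have ae := difference_ae h oD cD Lu wG.
set w := fun x => (u \_ D) (x + h) - (u \_ D) x.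
set B := common D h; set g := hdot D h G.
have Lu0 : L2 setT (u \_ D) by exact: L2_mkcond.
have Lw : L2 setT w by apply: L2B => //; exact: L2_translate.
have LwB : L2 B w by exact: L2S Lw.
have Lg : L2 setT g := L2_hdot h mD (L2v_weak wG).
have Lwx : L2 setT (w \_ B) by exact: L2_mkcond.
have [iF [e iI]] := fubini_shift h Lg Lwx.
have mF : measurable_fun setT (fun x : 'rV[R]_n => \int[nu]_(t in `[0, 1]) g (x + t *: h)).
  by apply: measurable_line_average; case: Lg.
have e1 : l2norm B w ^+ 2 =
    \int[mu]_x ((\int[nu]_(t in `[0, 1]) g (x + t *: h)) * (w \_ B) x).
  rewrite l2norm_sqr /l2dot Rintegral_mkcond; apply: Rintegral_ae_eq => //.
  - apply: (measurable_restrictT _ mB).1; apply: measurable_funM; by case: LwB.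
  - by apply: measurable_funM => //; case: Lwx.
  - apply: filterS ae => x hx _; rewrite !patchE; case: ifPn => [/set_mem Bx|_].
      by rewrite -(hx Bx).
    by rewrite mulr0.
have h1 : l2norm B w ^+ 2 <= l2norm setT g * l2norm B w.
  rewrite e1 e; apply: le_Rintegral01 => // t.
  rewrite -(l2norm_translate (t *: h) (f := g)); last by case: Lg.
  rewrite -(@l2norm_mkcond _ _ setT B)//.
  by apply: l2dot_le => //; exact: L2_translate.
have h2 := l2norm_hdot h mD (L2v_weak wG); rewrite -/g in h2.
apply: le_trans h2; rewrite lerXn2r ?nnegrE ?l2norm_ge0//.
have [->|w0] := eqVneq (l2norm B w) 0; first exact: l2norm_ge0.
have w1 : 0 < l2norm B w by rewrite lt_neqAle eq_sym w0 l2norm_ge0.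
by rewrite -(ler_pM2r w1) -expr2.
Qed.

End difference.

(** * Double integrals and mean values *)

Section double_integral.
Context {R : realType} {n : nat}.
Local Notation mu := (lebesgue_rV R n).
Implicit Types (D : set 'rV[R]_n) (u : 'rV[R]_n -> R).

Lemma double_integral_mkcond D (F : 'rV[R]_n -> 'rV[R]_n -> R) :
  (\int[mu]_(x in D) \int[mu]_(y in D) (F x y)%:E =
   \int[mu]_x \int[mu]_y (\1_D x * \1_D y * F x y)%:E)%E.
Proof.
rewrite integral_mkcond; apply: eq_integral => x _; rewrite patchE indicE.
case: ifPn => xD; last first.
  by under [RHS]eq_integral do rewrite !mul0r; rewrite integral0.
rewrite integral_mkcond; apply: eq_integral => y _; rewrite patchE indicE.
by case: ifP => _; rewrite ?mul1r ?mul0r.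
Qed.

Lemma measurable_indic_fst D : measurable D ->
  measurable_fun setT (fun z : 'rV[R]_n * 'rV[R]_n => \1_D z.1 : R).
Proof. by move=> mD; apply: (@measurableT_comp _ _ _ _ _ _ (\1_D : 'rV[R]_n -> R)). Qed.

Lemma measurable_indic_snd D : measurable D ->
  measurable_fun setT (fun z : 'rV[R]_n * 'rV[R]_n => \1_D z.2 : R).
Proof. by move=> mD; apply: (@measurableT_comp _ _ _ _ _ _ (\1_D : 'rV[R]_n -> R)). Qed.

(** The zero extension makes this measurable on the whole product; by the indicators, its values off
    [D] do not matter, see [sqdiffE]. *)
Definition sqdiff D u (z : 'rV[R]_n * 'rV[R]_n) : R :=
  \1_D z.1 * \1_D z.2 * ((u \_ D) z.1 - (u \_ D) z.2) ^+ 2.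

Lemma measurable_sqdiff D u : measurable D -> measurable_fun D u ->
  measurable_fun setT (sqdiff D u).
Proof.
move=> mD mu'; have mu0 := (measurable_restrictT u mD).1 mu'.
apply: measurable_funM.
  by apply: measurable_funM; [exact: measurable_indic_fst|exact: measurable_indic_snd].
apply: measurable_funX; apply: measurable_funB.
  exact: (measurableT_comp mu0 measurable_fst).
exact: (measurableT_comp mu0 measurable_snd).
Qed.

Lemma sqdiff_ge0 D u z : 0 <= sqdiff D u z.
Proof. by rewrite mulr_ge0 ?sqr_ge0 ?mulr_ge0. Qed.

Lemma sqdiffE D u x y : sqdiff D u (x, y) = \1_D x * \1_D y * (u x - u y) ^+ 2.
Proof.
rewrite /sqdiff /= !patchE !indicE.
by case: (x \in D); case: (y \in D); rewrite ?mul1r ?mul0r.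
Qed.

Lemma double_sqdiff D u :
  (\int[mu]_(x in D) \int[mu]_(y in D) ((u x - u y) ^+ 2)%:E =
   \int[mu]_x \int[mu]_y (sqdiff D u (x, y))%:E)%E.
Proof.
rewrite (@double_integral_mkcond D); apply: eq_integral => x _.
by apply: eq_integral => y _; rewrite sqdiffE.
Qed.

(* The mean value of u is a best constant, hence at least as good as each u y. *)
Lemma mean_double_integral D u : measurable D -> (0 < mu D < +oo)%E -> L2 D u ->
  exists c : R, ((fine (mu D) * l2norm D (fun x => u x - c) ^+ 2)%:E <=
    \int[mu]_(x in D) \int[mu]_(y in D) ((u x - u y) ^+ 2)%:E)%E.
Proof.
move=> mD /andP[D0 Doo] Lu.
have L1 k := L2_cst_fin k mD Doo.
have muD : mu D \is a fin_num by rewrite ge0_fin_numE.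
have mD0 : 0 < fine (mu D) by rewrite fine_gt0// D0.
have n1 : l2dot D (fun=> 1) (fun=> 1) = fine (mu D).
  by rewrite /l2dot; under eq_Rintegral do rewrite mulr1; rewrite Rintegral_cst// mul1r.
pose c := l2dot D u (fun=> 1) / fine (mu D).
pose v x := u x - c.
have Lv : L2 D v by apply: L2B.
have v1 : l2dot D v (fun=> 1) = 0.
  rewrite /v l2dotBl//.
  have -> : l2dot D (fun=> c) (fun=> 1) = c * l2dot D (fun=> 1) (fun=> 1).
    by rewrite -l2dotZl//; apply: eq_Rintegral => x _; rewrite !mulr1.
  by rewrite n1 /c divfK ?subrr// gt_eqF.
exists c.
have best k : l2norm D v ^+ 2 <= l2norm D (fun x => u x - k) ^+ 2.
  rewrite (@eq_l2norm _ _ _ (fun x => u x - k) (fun x => v x + (c - k) * 1)); last first.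
    by move=> x _; rewrite /v; ring.
  rewrite [leRHS]l2norm_sqr (l2dot_sqr mD (c - k) Lv (L1 1)) v1 n1 l2norm_sqr.
  by rewrite mulr0 mul0rn addr0 lerDl mulr_ge0 ?sqr_ge0// ltW.
rewrite mulrC EFinM fineK// -integral_cst//.
apply: ge0_le_integral => //.
- by move=> x _; rewrite lee_fin sqr_ge0.
- have mk : measurable_fun setT (EFin \o sqdiff D u).
    by apply/measurable_EFinP; apply: measurable_sqdiff => //; case: Lu.
  have := measurable_fun_fubini_tonelli_F (m2 := mu) _ mk (fun z => _).
  move=> /(_ (fun z => sqdiff_ge0 D u z)) h.
  apply: (@eq_measurable_fun _ _ _ _ _ (fubini_F mu (EFin \o sqdiff D u)));
    last exact: measurable_funTS.
  move=> x xD; rewrite /fubini_F [RHS]integral_mkcond; apply: eq_integral => y _.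
  rewrite /= sqdiffE patchE !indicE xD mul1r.
  by case: ifP => _; rewrite ?mul1r ?mul0r.
- move=> x Dx; have Lx : L2 D (fun y => u y - u x) by exact: L2B.
  have -> : (\int[mu]_(y in D) ((u x - u y) ^+ 2)%:E =
      (l2norm D (fun y => u y - u x) ^+ 2)%:E)%E.
    rewrite l2norm_sqrE /Rintegral fineK; last by apply: integrable_fin_num => //; case: Lx.
    by apply: eq_integral => y _; rewrite -sqrrN opprB.
  by rewrite lee_fin best.
Qed.

(** After the substitution y = x + h and Tonelli, the inner integral is the squared norm of u(x + h)
    - u(x) over [common D h]. It is at most H^2 times that of the gradient, and it vanishes unless
    |h| <= H; the volume of a cube of such h gives the remaining factor. *)
Lemma convex_double_integral D u G (H : R) : open D -> convexV D -> 0 < H ->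
  (forall x y, D x -> D y -> enorm (x - y) <= H) -> L2 D u -> weak_grad D u G ->
  (\int[mu]_(x in D) \int[mu]_(y in D) ((u x - u y) ^+ 2)%:E <=
    ((4 * H) ^+ n * (H ^+ 2 * vnorm2 D G))%:E)%E.
Proof.
move=> oD cD H0 dH Lu wG; have mD := open_measurable_rV oD.
have [mu' _] := Lu; have mu0 := (measurable_restrictT u mD).1 mu'.
rewrite double_sqdiff.
have mk := measurable_sqdiff mD mu'.
pose k (z : 'rV[R]_n * 'rV[R]_n) : \bar R := (sqdiff D u (z.1, z.2 + z.1))%:E.
have mz : measurable_fun setT (fun z : 'rV[R]_n * 'rV[R]_n => z.2 + z.1).
  apply: measurable_fun_coordP => i.
  rewrite (_ : _ \o _ = fun z => coordV i z.2 + coordV i z.1).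
    by apply: measurable_funD; apply: measurableT_comp => //; exact: measurable_coord.
  by apply/funext => z; rewrite /coordV /= !mxE.
have mkk : measurable_fun setT k.
  apply/measurable_EFinP; apply: (measurableT_comp mk).
  by apply: measurable_fun_pair.
have k0 z : (0 <= k z)%E by rewrite lee_fin sqdiff_ge0.
have -> : (\int[mu]_x \int[mu]_y (sqdiff D u (x, y))%:E = \int[mu]_x \int[mu]_h k (x, h))%E.
  apply: eq_integral => x _.
  rewrite -(ge0_integral_translate x (f := fun y => (sqdiff D u (x, y))%:E))//.
    apply/measurable_EFinP; apply: (measurableT_comp mk).
    exact: pair1_measurable.
  by move=> y; rewrite lee_fin sqdiff_ge0.
rewrite (fubini_tonelli k mkk k0).
pose V := H ^+ 2 * vnorm2 D G.
have V0 : 0 <= V by rewrite mulr_ge0 ?sqr_ge0 ?vnorm2_ge0.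
apply: (@le_trans _ _ (\int[mu]_h (V * \1_(cube (2 * H)) h)%:E)%E); last first.
  under eq_integral do rewrite EFinM.
  rewrite ge0_integralZl//; last by apply/measurable_EFinP; apply: measurable_indic;
    exact: measurable_box.
  rewrite integral_indic//; last exact: measurable_box.
  rewrite setIT [X in (_ * X)%E]lebesgue_rV_obox -EFinM lee_fin mulrC ler_wpM2r//.
  rewrite -[n in leRHS]card_ord -prodr_const; apply: ler_prod => i _.
  rewrite !mxE le_max lexx /= max_r; last by lra.
  by rewrite le_eqVlt; apply/orP; left; apply/eqP; ring.
apply: ge0_le_integral => //.
- by move=> h _; apply: integral_ge0 => x _.
- exact: (measurable_fun_fubini_tonelli_G (m1 := mu) k mkk k0).
- apply/measurable_EFinP; apply: measurable_funM => //; apply: measurable_indic.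
  exact: measurable_box.
move=> h _.
have oB := @open_common R n D h oD; have mB := open_measurable_rV oB.
have Lw : L2 (common D h) (fun x => (u \_ D) (x + h) - (u \_ D) x).
  apply: (@L2S _ _ setT) => //.
  have Lu0 : L2 setT (u \_ D) by exact: L2_mkcond.
  by apply: L2B => //; exact: L2_translate.
have -> : (\int[mu]_x k (x, h) =
    (l2norm (common D h) (fun x => (u \_ D) (x + h) - (u \_ D) x) ^+ 2)%:E)%E.
  rewrite l2norm_sqrE /Rintegral fineK; last by apply: integrable_fin_num => //; case: Lw.
  rewrite [RHS]integral_mkcond; apply: eq_integral => x _; rewrite patchE /k /=.
  rewrite [h + x]addrC sqdiffE !indicE.
  case: ifPn => [/set_mem[Dx Dxh]|nB].
    by rewrite !mem_set// !mul1r !patchE !mem_set// -sqrrN opprB.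
  case: (boolP (x \in D)) => [/set_mem Dx|_]; last by rewrite !mul0r.
  case: (boolP (x + h \in D)) => [/set_mem Dxh|_]; last by rewrite mulr0 mul0r.
  by move/negP: nB; case; apply/mem_set.
rewrite lee_fin.
have [[x [Dx Dxh]]|nB] := pselect (common D h !=set0); last first.
  have -> : common D h = set0 by apply/seteqP; split => // x Bx; apply: nB; exists x.
  rewrite l2norm_sqrE Rintegral_set0.
  by apply: mulr_ge0.
have hH : enorm h <= H by have := dH _ _ Dxh Dx; rewrite addrAC subrr add0r.
(* The half-width is twice [H] because the cube is open and |h| may equal [H]. *)
have hc : cube (2 * H) h.
  move=> i; rewrite !mxE -ltr_norml; apply: (@le_lt_trans _ _ H); last by lra.
  apply: le_trans hH; rewrite -(@ler_pXn2r _ 2)// ?nnegrE ?sqrtr_ge0//.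
  rewrite real_normK ?num_real// enorm_sqr (bigD1 i)//= lerDl sumr_ge0// => j _.
  exact: sqr_ge0.
rewrite indicE mem_set// mulr1.
apply: le_trans (difference_l2norm h oD cD Lu wG) _.
by rewrite ler_wpM2r ?vnorm2_ge0// lerXn2r ?nnegrE ?sqrtr_ge0// ltW.
Qed.

(** Only the diameter bound and the volume of [D] enter the constant, which makes it uniform over
    the elements of a shape-regular mesh. *)
Lemma convex_poincare D u G (H : R) : open D -> convexV D -> 0 < H ->
  (forall x y, D x -> D y -> enorm (x - y) <= H) -> (0 < mu D < +oo)%E ->
  L2 D u -> weak_grad D u G ->
  exists c : R, fine (mu D) * l2norm D (fun x => u x - c) ^+ 2 <=
    (4 * H) ^+ n * (H ^+ 2 * vnorm2 D G).
Proof.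
move=> oD cD H0 dH muD Lu wG; have mD := open_measurable_rV oD.
have [c hc] := mean_double_integral mD muD Lu; exists c.
by rewrite -lee_fin; apply: le_trans hc _; exact: convex_double_integral.
Qed.

Definition slob (s : R) u (x y : 'rV[R]_n) : R :=
  (u x - u y) ^+ 2 / enorm (x - y) `^ (n%:R + 2 * s).

Lemma slob_ge0 s u x y : 0 <= slob s u x y.
Proof. by rewrite divr_ge0 ?sqr_ge0 ?powR_ge0. Qed.

Lemma measurable_enorm_sub :
  measurable_fun setT (fun z : 'rV[R]_n * 'rV[R]_n => enorm (z.1 - z.2)).
Proof.
apply: (@measurableT_comp _ _ _ _ _ _ (@Num.sqrt R)).
  by apply: continuous_measurable_fun; exact: sqrt_continuous.
rewrite /dotv; apply: measurable_sum => i.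
have m1 : measurable_fun setT (fun z : 'rV[R]_n * 'rV[R]_n => (z.1 - z.2) 0 i).
  rewrite (_ : (fun z => _) = fun z => coordV i z.1 - coordV i z.2).
    by apply: measurable_funB; apply: measurableT_comp => //; exact: measurable_coord.
  by apply/funext => z; rewrite /coordV /= !mxE.
exact: measurable_funM.
Qed.

Lemma measurable_slob D s u : measurable D -> measurable_fun D u ->
  measurable_fun setT (fun z : 'rV[R]_n * 'rV[R]_n => \1_D z.1 * \1_D z.2 * slob s u z.1 z.2).
Proof.
move=> mD mu'.
rewrite (_ : (fun z => _) = fun z => sqdiff D u z * enorm (z.1 - z.2) `^ (- (n%:R + 2 * s))).
  apply: measurable_funM; first exact: measurable_sqdiff.
  apply: (@measurableT_comp _ _ _ _ _ _ (fun y : R => y `^ (- (n%:R + 2 * s)))).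
    exact: measurable_powR.
  exact: measurable_enorm_sub.
by apply/funext => -[x y]; rewrite sqdiffE /slob powRN /= mulrA.
Qed.

(** The comparison is pointwise: |x - y| <= H off the diagonal, and on the diagonal both integrands
    are zero. *)
Lemma slob_double_integral D s u (H : R) : measurable D -> 0 <= s -> 0 < H ->
  (forall x y, D x -> D y -> enorm (x - y) <= H) -> measurable_fun D u ->
  (\int[mu]_(x in D) \int[mu]_(y in D) ((u x - u y) ^+ 2)%:E <=
   (H `^ (n%:R + 2 * s))%:E * \int[mu]_(x in D) \int[mu]_(y in D) (slob s u x y)%:E)%E.
Proof.
move=> mD s0 H0 dH mu'.
have p0 : 0 <= n%:R + 2 * s by rewrite addr_ge0// mulr_ge0.
rewrite double_sqdiff (@double_integral_mkcond D).
have mk := measurable_sqdiff mD mu'; have ms := measurable_slob s mD mu'.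
pose k (z : 'rV[R]_n * 'rV[R]_n) : \bar R := (sqdiff D u z)%:E.
pose l (z : 'rV[R]_n * 'rV[R]_n) : \bar R := (\1_D z.1 * \1_D z.2 * slob s u z.1 z.2)%:E.
have k0 z : (0 <= k z)%E by rewrite lee_fin sqdiff_ge0.
have l0 z : (0 <= l z)%E by rewrite lee_fin mulr_ge0 ?slob_ge0 ?mulr_ge0.
have mk' : measurable_fun setT k by exact/measurable_EFinP.
have ml' : measurable_fun setT l by exact/measurable_EFinP.
have e1 : (\int[mu]_x \int[mu]_y (sqdiff D u (x, y))%:E = \int[mu \x mu]_z k z)%E.
  by rewrite (fubini_tonelli1 k mk' k0).
have e2 : (\int[mu]_x \int[mu]_y (\1_D x * \1_D y * slob s u x y)%:E = \int[mu \x mu]_z l z)%E.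
  by rewrite (fubini_tonelli1 l ml' l0).
rewrite e1 e2 -ge0_integralZl//; last by rewrite lee_fin powR_ge0.
apply: ge0_le_integral => //; first exact: measurable_funeM.
move=> [x y] _; rewrite /k /l /= -EFinM lee_fin sqdiffE.
rewrite [leRHS]mulrCA; case: (boolP (x \in D)) => [/set_mem Dx|xD]; last first.
  by rewrite !indicE (negbTE xD) !mul0r.
case: (boolP (y \in D)) => [/set_mem Dy|yD]; last first.
  by rewrite !indicE (negbTE yD) mulr0 !mul0r.
apply: ler_wpM2l; first by rewrite mulr_ge0.
rewrite /slob; have [->|xy] := eqVneq x y.
  by rewrite !subrr expr0n /= mul0r mulr0.
have exy : 0 < enorm (x - y).
  rewrite lt_neqAle sqrtr_ge0 andbT eq_sym; apply: contra_neq xy => e.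
  apply/rowP => i; apply/eqP; rewrite -subr_eq0 -sqrf_eq0; apply/eqP.
  have := enorm_sqr (x - y); rewrite e expr0n /= => /esym/eqP.
  rewrite psumr_eq0; last by move=> j _; exact: sqr_ge0.
  by move=> /allP /(_ i (mem_index_enum _)) /=; rewrite !mxE => /eqP.
have e0 : 0 < enorm (x - y) `^ (n%:R + 2 * s) by exact: powR_gt0.
rewrite mulrCA ler_peMr ?sqr_ge0// ler_pdivlMr// mul1r.
by apply: ge0_ler_powR => //; rewrite ?nnegrE ?sqrtr_ge0 ?(ltW H0)//; exact: dH.
Qed.

End double_integral.

(** * Mesh geometry and piecewise constants *)

Section euclidean_norm.
Context {R : realType} {n : nat}.
Implicit Types (x y : 'rV[R]_n) (t : R).

Lemma enorm_ge0 x : 0 <= enorm x.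
Proof. exact: sqrtr_ge0. Qed.

Lemma enormZ t x : enorm (t *: x) = `|t| * enorm x.
Proof.
apply/eqP; rewrite -(@eqrXn2 _ 2)// ?mulr_ge0 ?enorm_ge0// exprMn !enorm_sqr.
rewrite real_normK ?num_real// mulr_sumr; apply/eqP; apply: eq_bigr => i _.
by rewrite mxE exprMn.
Qed.

Lemma enorm_subC x y : enorm (x - y) = enorm (y - x).
Proof. by rewrite -[x - y]opprB -scaleN1r enormZ normrN1 mul1r. Qed.

Lemma dotv_le x y : dotv x y <= enorm x * enorm y.
Proof.
apply: le_trans (ler_norm _) _; rewrite -(@ler_pXn2r _ 2)// ?nnegrE ?mulr_ge0 ?enorm_ge0//.
by rewrite exprMn real_normK ?num_real// dotv_CS.
Qed.

Lemma dotvBl x y e : dotv (x - y) e = dotv x e - dotv y e.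
Proof. by rewrite /dotv -sumrB; apply: eq_bigr => i _; rewrite !mxE mulrBl. Qed.

Lemma enormD x y : enorm (x + y) <= enorm x + enorm y.
Proof.
rewrite -(@ler_pXn2r _ 2)// ?nnegrE ?addr_ge0 ?enorm_ge0// sqrrD.
have -> : enorm (x + y) ^+ 2 = enorm x ^+ 2 + dotv x y *+ 2 + enorm y ^+ 2.
  rewrite !enorm_sqr /dotv -sumrMnl -!big_split/=.
  by apply: eq_bigr => i _; rewrite mxE sqrrD.
by rewrite lerD2r lerD2l lerMn2r /= dotv_le.
Qed.

Lemma coord_le_enorm x i : `|x 0 i| <= enorm x.
Proof.
rewrite -(@ler_pXn2r _ 2)// ?nnegrE ?enorm_ge0// real_normK ?num_real//.
by rewrite enorm_sqr (bigD1 i)//= lerDl sumr_ge0// => j _; exact: sqr_ge0.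
Qed.

Lemma enorm_le_coord x t : 0 <= t -> (forall i, `|x 0 i| <= t) -> enorm x <= n%:R * t.
Proof.
move=> t0 h; rewrite -(@ler_pXn2r _ 2)// ?nnegrE ?enorm_ge0 ?mulr_ge0//.
rewrite enorm_sqr; apply: (@le_trans _ _ (\sum_(i < n) t ^+ 2)).
  by apply: ler_sum => i _; rewrite -(real_normK (num_real _)) lerXn2r ?nnegrE ?h.
rewrite sumr_const card_ord -[t ^+ 2 *+ n]mulr_natl exprMn ler_wpM2r ?sqr_ge0//.
by rewrite -natrX ler_nat; case: (n) => // m; rewrite expnS expn1 leq_pmulr.
Qed.

Lemma coord_le_norm x i : `|x 0 i| <= `|x|.
Proof.
rewrite [leRHS]mx_normrE; apply/bigmax_geP; right => /=.
by exists (0, i).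
Qed.

Lemma norm_le_enorm x : `|x| <= enorm x.
Proof.
rewrite [leLHS]mx_normrE; apply/bigmax_leP; split; first exact: enorm_ge0.
by move=> [i j] _ /=; rewrite ord1 coord_le_enorm.
Qed.

Lemma enorm_le_norm x : enorm x <= n%:R * `|x|.
Proof. by apply: enorm_le_coord => // i; exact: coord_le_norm. Qed.

Lemma enorm_ball_nbhs x (r : R) : 0 < r -> nbhs x [set y | enorm (y - x) < r].
Proof.
move=> r0; have n1 : 0 < n%:R + 1 :> R by rewrite ltr_wpDl.
apply/nbhs_ballP; exists (r / (n%:R + 1)) => /=; first by rewrite divr_gt0.
move=> y; rewrite -ball_normE /= => h; rewrite enorm_subC.
apply: le_lt_trans (enorm_le_norm _) _.
move: h; rewrite ltr_pdivlMr//; move: (normr_ge0 (x - y)).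
move: `|x - y| => p p0; clear -p0 n1; move: (ler0n R n) => q; nra.
Qed.

End euclidean_norm.

(** * Interior and boundary of convex sets *)

Section convex_sets.
Context {R : realType} {n : nat}.
Local Notation mu := (lebesgue_rV R n).
Implicit Types (T D : set 'rV[R]_n) (x y c : 'rV[R]_n).

(** Moving x and y by the same small vector moves their convex combination by that vector. *)
Lemma convexV_interior T : convexV T -> convexV T°.
Proof.
move=> cT x y t; rewrite /interior => /nbhs_ballP[e1 /= e10 h1] /nbhs_ballP[e2 /= e20 h2] t01.
set z := _ + _; apply/nbhs_ballP; exists (Num.min e1 e2); first by rewrite /= lt_min e10.
move=> w; rewrite -ball_normE /= lt_min => /andP[w1 w2].
have -> : w = (1 - t) *: (x + (w - z)) + t *: (y + (w - z)).
  by apply/rowP => i; rewrite /z !mxE; ring.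
apply: cT => //; [apply: h1|apply: h2]; rewrite -ball_normE /= opprD addrA subrr sub0r;
  by rewrite opprB.
Qed.

(** A point within (1 - s) e of s x + (1 - s) c has the form s x + (1 - s) c' with c' within e of
    c. *)
Lemma convexV_scale_interior T c x (s : R) : convexV T -> T° c -> T x -> 0 < s < 1 ->
  T° (s *: x + (1 - s) *: c).
Proof.
move=> cT /nbhs_ballP[e /= e0 h] Tx /andP[s0 s1].
have s1' : 0 < 1 - s by rewrite subr_gt0.
apply/nbhs_ballP; exists ((1 - s) * e); first by rewrite /= mulr_gt0.
set z := _ + _ => w; rewrite -ball_normE /= => hw.
have -> : w = (1 - (1 - s)) *: x + (1 - s) *: (c + (1 - s)^-1 *: (w - z)).
  apply/rowP => i; rewrite /z !mxE; field; by rewrite gt_eqF.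
apply: cT => //; last by apply/andP; split; [exact: ltW|rewrite gerBl ltW].
apply: h; rewrite -ball_normE /= opprD addrA subrr sub0r normrN normrZ.
rewrite ger0_norm ?invr_ge0 ?(ltW s1')// ltr_pdivrMl//.
by rewrite distrC.
Qed.

(* Shrinking T towards an interior point maps it into its interior and multiplies
   its volume by [(1 - eps) ^+ n]. *)
Lemma convexV_boundary_null T : closed T -> convexV T -> T° !=set0 ->
  (mu T < +oo)%E -> mu (T `\` T°) = 0%E.
Proof.
move=> clT cT [c Tc] Too.
have mT := closed_measurable_rV clT.
have oT := @open_interior _ T; have mTi := open_measurable_rV oT.
have sT : T° `<=` T by exact: interior_subset.
have Tioo : (mu T° < +oo)%E by apply: le_lt_trans Too; apply: le_measure; rewrite ?inE.
have fT : mu T \is a fin_num by rewrite ge0_fin_numE.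
have fTi : mu T° \is a fin_num by rewrite ge0_fin_numE.
rewrite measureD//.
have -> : T `&` T° = T° by apply/setIidPr.
suff h : mu T = mu T° by rewrite [X in (X - _)%E]h subee.
apply/eqP; rewrite eq_le; apply/andP; split; last by apply: le_measure; rewrite ?inE.
rewrite -(fineK fT) -(fineK fTi) lee_fin -subr_le0.
apply: (@le0_eps _ _ (n%:R * fine (mu T) + fine (mu T))).
  by rewrite addr_ge0 ?mulr_ge0// fine_ge0.
move=> eps e0.
have a0 : 0 <= fine (mu T) by rewrite fine_ge0.
have a1 : 0 <= fine (mu T°) by rewrite fine_ge0.
have a2 : fine (mu T°) <= fine (mu T) by apply: fine_le => //; apply: le_measure; rewrite ?inE.
case: (leP 1 eps) => [e1|e1].
  move: a0 a1 a2 e0 e1; move: (fine (mu T)) (fine (mu T°)) (n%:R) (ler0n R n).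
  move=> a b q; clear => q0 a0 b0 ab e0 e1.
  have := mulr_ge0 q0 a0; have := mulr_ge0 a0 (ltW e0); nra.
pose s := 1 - eps.
have s01 : 0 < s < 1 by rewrite /s; apply/andP; split; lra.
have s0 : 0 < s by case/andP: s01.
have : (mu T <= mu ((fun x => s *: x + (1 - s) *: c)%R @^-1` T°))%E.
  apply: le_measure; rewrite ?inE//.
    rewrite -[X in measurable X]setTI; exact: measurable_affine.
  by move=> x Tx; exact: convexV_scale_interior.
rewrite lebesgue_rV_affine// -(fineK fT) -(fineK fTi) -EFinM lee_fin.
rewrite ler_pdivlMl ?exprn_gt0// => h.
(* Bernoulli's inequality bounds the loss of volume under shrinking by n eps times the volume of
   [T]. *)
have bern : 1 - n%:R * eps <= s ^+ n.
  have e1' : eps <= 1 by exact: ltW.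
  rewrite /s; elim: (n) => [|k IH]; first by rewrite expr0 mul0r subr0.
  rewrite exprS; apply: (@le_trans _ _ ((1 - eps) * (1 - k%:R * eps))); last first.
    by rewrite ler_wpM2l// subr_ge0.
  have := mulr_ge0 (ler0n R k) (sqr_ge0 eps); rewrite -natr1.
  move: (k%:R : R) => q; clear; lra.
have := ler_wpM2r a0 bern.
have := mulr_ge0 (ltW e0) a0.
move: h; move: (fine (mu T)) (fine (mu T°)) (s ^+ n) => a b p; clear => h1 h2 h3.
move: (n%:R : R) h3 => q h3 /=; nra.
Qed.

End convex_sets.

Section mesh_geometry.
Context {R : realType} {n : nat}.
Local Notation mu := (lebesgue_rV R n).
Implicit Types (Omega D S : set 'rV[R]_n) (x y c : 'rV[R]_n).

(* A point of the boundary lies on or below the graph; a small step along [- e]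
   leaves the closure. *)
Lemma lipschitz_interior_closure Omega : lipschitz_boundary Omega ->
  (closure Omega)° `<=` Omega.
Proof.
move=> lip p ip; apply: contrapT => nOp.
have cp : closure Omega p by exact: interior_subset.
have [e [r [L [gam [e1 r0 gam_e gam_L hp]]]]] := lip p cp nOp.
have gp : dotv p e <= gam p.
  rewrite leNgt; apply/negP => h; apply: nOp; apply/hp => //.
  by rewrite subrr -(scale0r e) enormZ normr0 mul0r.
move: ip => /nbhs_ballP[eps /= eps0 hb].
(* The bound t < eps keeps q in the closure of Omega, and 2 t < r keeps the points near q inside the
   chart of the graph. *)
pose t := Num.min r eps / 4.
have m0 : 0 < Num.min r eps by rewrite lt_min r0.
have t0 : 0 < t by rewrite divr_gt0.
have [tr teps] : t + t < r /\ t < eps.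
  rewrite /t.
  have h1 : Num.min r eps <= r by rewrite ge_min lexx.
  have h2 : Num.min r eps <= eps by rewrite ge_min lexx orbT.
  move: (Num.min r eps) m0 h1 h2 => m; clear; lra.
pose q := p - t *: e.
have cq : closure Omega q.
  apply: hb; rewrite -ball_normE /= /q opprB addrC subrK normrZ gtr0_norm//.
  apply: le_lt_trans teps; rewrite ler_piMr ?(ltW t0)//.
  by rewrite -e1 norm_le_enorm.
have L1 : 0 < `|L| + 1 by rewrite ltr_wpDl.
(* For a point x of Omega this close to q, (|L| + 1) |x - q| < t. So the graph drops by at most |L|
   |x - q| from its height at p, while x lies more than that below p in direction e: x is under the
   graph, a contradiction. *)
have d0 : 0 < t / (`|L| + 1) by rewrite divr_gt0.
have [x [Ox /= xq]] := cq _ (enorm_ball_nbhs q d0).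
have qp : enorm (q - p) = t.
  by rewrite /q addrAC subrr sub0r -scaleNr enormZ e1 mulr1 normrN gtr0_norm.
have dt : t / (`|L| + 1) <= t.
  by rewrite ler_pdivrMr// ler_peMr ?(ltW t0)// lerDr.
have xp : enorm (x - p) < r.
  have -> : x - p = (x - q) + (q - p) by rewrite addrA subrK.
  apply: le_lt_trans (enormD _ _) _; rewrite qp; apply: le_lt_trans tr.
  by rewrite lerD2r; apply: le_trans dt; exact: ltW.
have /(hp x xp) := Ox; apply/negP; rewrite -leNgt.
have gq : gam q = gam p by rewrite /q -scaleNr gam_e.
have := gam_L x q; rewrite gq => gx.
have dx : dotv x e <= dotv q e + enorm (x - q).
  by rewrite -lerBlDl -dotvBl; apply: le_trans (dotv_le _ _) _; rewrite e1 mulr1.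
have dq : dotv q e = dotv p e - t.
  rewrite /q dotvBl; congr (_ - _); rewrite /dotv.
  transitivity (t * enorm e ^+ 2); last by rewrite e1 expr1n mulr1.
  rewrite enorm_sqr mulr_sumr; apply: eq_bigr => i _; rewrite mxE; ring.
move: xq; rewrite ltr_pdivlMr// => xq.
have gx' : gam p - `|L| * enorm (x - q) <= gam x.
  have : gam p - gam x <= L * enorm (x - q).
    by apply: le_trans gx; rewrite distrC ler_norm.
  have : L * enorm (x - q) <= `|L| * enorm (x - q).
    by rewrite ler_wpM2r ?enorm_ge0// ler_norm.
  move: (L * _) (`|L| * _) (gam p) (gam x); clear; move=> *; lra.
move: gp gx' dx xq; rewrite dq; move: (gam x) (gam p) (dotv x e) (dotv p e).
move: (enorm (x - q)) (`|L|); clear => z k a b v w; nra.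
Qed.

Lemma lebesgue_rV_box_center c (w : R) : 0 <= w ->
  mu (box (c - const_mx w) (c + const_mx w)) = ((2 * w) ^+ n)%:E.
Proof.
move=> w0; rewrite lebesgue_rV_obox; congr EFin.
rewrite (eq_bigr (fun=> 2 * w)) => [|i _]; first by rewrite prodr_const card_ord.
rewrite !mxE max_r; first ring.
have -> : c 0 i + w - (c 0 i - w) = 2 * w by ring.
by rewrite mulr_ge0.
Qed.

Section mesh.
Variables (N : nat) (T : 'I_N -> set 'rV[R]_n) (Omega : set 'rV[R]_n).
Variables (H rho tau : R).
Hypothesis H0 : 0 < H.
Hypothesis mT : mesh T Omega H rho tau.

Lemma mesh_subset i : T i `<=` closure Omega.
Proof. by case: mT => _ _ [-> _] _ _ x Tx; exists i. Qed.

Lemma mesh_open i : open (T i)°.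
Proof. exact: open_interior. Qed.

Lemma mesh_convex i : convexV (T i)°.
Proof. by case: mT => _ h _ _ _; apply: convexV_interior; exact: h. Qed.

Lemma mesh_diam i x y : (T i)° x -> (T i)° y -> enorm (x - y) <= H.
Proof. by case: mT => _ _ _ h _ /interior_subset Tx /interior_subset Ty; exact: (h i). Qed.

Lemma elt_patch_subset l i : elt_patch T l i `<=` closure Omega.
Proof.
case: l => [|l]; first exact: mesh_subset.
by move=> x [j _]; exact: mesh_subset.
Qed.

Lemma elt_patch_near l i x : elt_patch T l i x ->
  exists2 y, T i y & enorm (x - y) <= l%:R * H.
Proof.
elim: l x => [|l IH] x.
  by move=> Tx; exists x => //; rewrite subrr -(scale0r x) enormZ normr0 !mul0r.
move=> [j [z [Tz pz]] Tx]; have [y Ty zy] := IH z pz.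
exists y => //; rewrite -natr1 mulrDl mul1r [leRHS]addrC.
have -> : x - y = (x - z) + (z - y) by rewrite addrA subrK.
apply: le_trans (enormD _ _) _; apply: lerD => //.
by case: mT => _ _ _ h _; exact: (h j).
Qed.

Hypothesis rho0 : 0 < rho.
Hypothesis tau0 : 0 < tau.
Hypothesis n0 : (0 < n)%N.

Let nR0 : 0 < n%:R :> R. Proof. by rewrite ltr0n. Qed.

(** The regularity parameters put a Euclidean ball of radius rho tau H into each element; the factor
    1/n fits a cube into that ball. *)
Lemma mesh_box i : exists c, box (c - const_mx (rho * tau * H / n%:R))
  (c + const_mx (rho * tau * H / n%:R)) `<=` (T i)°.
Proof.
case: mT => _ _ _ _ /(_ i)[tH [c [r [r0 rr hc]]]]; exists c.
have tr : rho * tau * H <= r.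
  by apply: le_trans rr; rewrite -mulrA ler_wpM2l ?(ltW rho0).
rewrite -open_subsetE; last exact: open_box.
move=> x /= h; apply: hc.
apply: (@le_trans _ _ (n%:R * (rho * tau * H / n%:R))).
  apply: enorm_le_coord => [|i'].
    by rewrite !mulr_ge0 ?invr_ge0 ?(ltW rho0) ?(ltW tau0) ?(ltW H0).
  have := h i'; rewrite !mxE => /andP[h1 h2]; rewrite ler_norml.
  by apply/andP; split; move: h1 h2; move: (_ / _) => w *; lra.
by rewrite mulrC divfK ?gt_eqF.
Qed.

Let w0 : 0 < rho * tau * H / n%:R.
Proof. by rewrite divr_gt0 ?mulr_gt0. Qed.

Lemma mesh_measure_ge i : (((2 * (rho * tau * H / n%:R)) ^+ n)%:E <= mu (T i)°)%E.
Proof.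
have [c h] := mesh_box i.
rewrite -(lebesgue_rV_box_center c (ltW w0)); apply: le_measure; rewrite ?inE//.
  exact: measurable_box.
exact: (open_measurable_rV (@mesh_open i)).
Qed.

Lemma mesh_measure_gt0 i : (0 < mu (T i)°)%E.
Proof.
by apply: lt_le_trans (mesh_measure_ge i); rewrite lte_fin exprn_gt0// mulr_gt0.
Qed.

Lemma mesh_interior_neq0 i : (T i)° !=set0.
Proof.
apply/set0P/eqP => e; have := mesh_measure_gt0 i.
by rewrite e measure0 ltxx.
Qed.

Lemma mesh_measurable i : measurable (T i)°.
Proof. exact: (open_measurable_rV (@mesh_open i)). Qed.

Hypothesis bO : bounded_set Omega.
Hypothesis lipO : lipschitz_boundary Omega.

(** The elements only fill the closure of Omega. A Lipschitz boundary has no slits, which places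
    their interiors in Omega itself. *)
Lemma mesh_sub i : (T i)° `<=` Omega.
Proof.
apply: subset_trans (lipschitz_interior_closure lipO).
by apply: interiorS; exact: mesh_subset.
Qed.

Lemma elt_patch_interior_sub l i : (elt_patch T l i)° `<=` Omega.
Proof.
apply: subset_trans (lipschitz_interior_closure lipO).
by apply: interiorS; exact: elt_patch_subset.
Qed.

End mesh.
End mesh_geometry.

(** * Sums over overlapping, covering or disjoint sets *)

Section overlap.
Context {R : realType} {n N : nat}.
Local Notation mu := (lebesgue_rV R n).
Variables (D : set 'rV[R]_n) (E : 'I_N -> set 'rV[R]_n).
Hypotheses (mD : measurable D) (mE : forall i, measurable (E i)).
Hypothesis ED : forall i, E i `<=` D.
Implicit Types u : 'rV[R]_n -> R.

(** The sum becomes one integral weighted by the number of sets through x, so a bound on this count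
    yields the overlap estimate and the covering estimate alike. *)
Lemma sum_l2norm_sqr u : L2 D u ->
  mu.-integrable D (EFin \o (fun x => (\sum_i \1_(E i) x) * u x ^+ 2)) /\
  \sum_i l2norm (E i) u ^+ 2 = \int[mu]_(x in D) ((\sum_i \1_(E i) x) * u x ^+ 2).
Proof.
move=> Lu; have LE i : L2 D (u \_ (E i)).
  by apply: L2_mkcond => //; exact: (L2S mD (mE i) (@ED i)).
have [i1 i2] := Rintegral_sum (index_enum _) mD (fun i => L2_mul_integrable mD (LE i) (LE i)).
have e : (fun x => \sum_i (u \_ (E i)) x * (u \_ (E i)) x) =
    (fun x => (\sum_i \1_(E i) x) * u x ^+ 2).
  apply/funext => x; rewrite mulr_suml; apply: eq_bigr => i _.
  by rewrite patchE indicE; case: ifP; rewrite ?mul1r ?mul0r ?mulr0// expr2.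
rewrite -e; split => //; rewrite i2; apply: eq_bigr => i _.
by rewrite -(l2norm_mkcond u (@ED i)) l2norm_sqr.
Qed.

Lemma l2norm_overlap (k : R) u : (forall x, \sum_i \1_(E i) x <= k) -> L2 D u ->
  \sum_i l2norm (E i) u ^+ 2 <= k * l2norm D u ^+ 2.
Proof.
move=> hk Lu; have [i1 ->] := sum_l2norm_sqr Lu; have iu := L2_mul_integrable mD Lu Lu.
rewrite l2norm_sqr /l2dot -RintegralZl//; apply: le_Rintegral => //.
  by apply: eq_integrable (integrableZl mD k iu).
by move=> x _ /=; rewrite -expr2 ler_wpM2r ?sqr_ge0.
Qed.

Lemma l2norm_cover u : {ae mu, forall x, D x -> exists i, E i x} -> L2 D u ->
  l2norm D u ^+ 2 <= \sum_i l2norm (E i) u ^+ 2.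
Proof.
move=> cov Lu; have [i1 ->] := sum_l2norm_sqr Lu; have iu := L2_mul_integrable mD Lu Lu.
rewrite l2norm_sqr /l2dot; apply: ae_le_Rintegral => //.
apply: filterS cov => x h Dx; have [i Ei] := h Dx.
rewrite -expr2 ler_peMl ?sqr_ge0// (bigD1 i)//= indicE mem_set// lerDl.
by apply: sumr_ge0 => j _; rewrite indicE.
Qed.

Lemma vnorm2_overlap (k : R) G : (forall x, \sum_i \1_(E i) x <= k) -> L2v D G ->
  \sum_i vnorm2 (E i) G <= k * vnorm2 D G.
Proof.
move=> hk LG; rewrite /vnorm2 exchange_big mulr_sumr /=.
by apply: ler_sum => j _; exact: l2norm_overlap.
Qed.

Lemma sum_indic_disjoint (x : 'rV[R]_n) : (forall i j, i != j -> E i `&` E j = set0) ->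
  \sum_i \1_(E i) x <= 1 :> R.
Proof.
move=> dis; have [[i Ei]|h] := pselect (exists i, E i x).
  rewrite (bigD1 i)//= [X in _ + X]big1 ?addr0 ?indicE ?mem_set//.
  move=> j ji; rewrite indicE memNset// => Ej.
  by have := dis _ _ ji; rewrite -subset0 => /(_ x); apply.
by rewrite big1// => i _; rewrite indicE memNset// => Ei; apply: h; exists i.
Qed.

(** Only an inequality: the double integral over [D] also contains the nonnegative contributions of
    pairs of points from different sets. *)
Lemma slobodeckij_disjoint s u : (forall i j, i != j -> E i `&` E j = set0) ->
  measurable_fun D u ->
  (\sum_i slobodeckij (E i) s u <= slobodeckij D s u)%E.
Proof.
move=> dis mu'.
have mEu i : measurable_fun (E i) u by exact: measurable_funS mu'.
pose F S (x y : 'rV[R]_n) : \bar R := (\1_S x * \1_S y * slob s u x y)%:E.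
have F0 S x y : (0 <= F S x y)%E.
  by rewrite lee_fin; apply: mulr_ge0; [exact: mulr_ge0|exact: slob_ge0].
have mF S x : measurable S -> measurable_fun S u -> measurable_fun setT (F S x).
  move=> mS mSu; apply/measurable_EFinP.
  have h := measurable_slob s mS mSu.
  exact: (@measurableT_comp _ _ _ _ _ _ _ _ (pair x) h (pair1_measurable x)).
have mFF S : measurable S -> measurable_fun S u ->
    measurable_fun setT (fun x => \int[mu]_y F S x y)%E.
  move=> mS mSu.
  apply: (@measurable_fun_fubini_tonelli_F _ _ _ _ _ mu (fun z => F S z.1 z.2)) => //.
  by apply/measurable_EFinP; exact: measurable_slob.
have e S : slobodeckij S s u = (\int[mu]_x \int[mu]_y F S x y)%E.
  exact: (@double_integral_mkcond _ _ S (slob s u)).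
rewrite e (eq_bigr (fun i => \int[mu]_x \int[mu]_y F (E i) x y)%E); last by move=> i _; exact: e.
rewrite -ge0_integral_sum//=; last 2 first.
- by move=> i; exact: mFF.
- by move=> i x _; apply: integral_ge0.
apply: ge0_le_integral => //.
- by move=> x _; apply: sume_ge0 => i _; exact: integral_ge0.
- by apply: emeasurable_sum => i; exact: mFF.
- exact: mFF.
move=> x _; rewrite -ge0_integral_sum//=; last by move=> i; exact: mF.
apply: ge0_le_integral => //.
- by move=> y _; apply: sume_ge0.
- by apply: emeasurable_sum => i; exact: mF.
- exact: mF.
move=> y _; rewrite sumEFin lee_fin.
rewrite -mulr_suml ler_wpM2r ?slob_ge0//.
have le1 i (z : 'rV[R]_n) : \1_(E i) z <= \1_D z :> R.
  rewrite !indicE; case: (boolP (z \in E i)) => [/set_mem/ED/mem_set ->//|_].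
  by rewrite ler0n.
apply: (@le_trans _ _ (\sum_i \1_(E i) x * (\1_D x * \1_D y))).
  apply: ler_sum => i _; rewrite [\1_(E i) x]indicE.
  case: (boolP (x \in E i)) => [xi|]; last by rewrite !mul0r.
  rewrite !mul1r; have -> : \1_D x = 1 :> R.
    by rewrite indicE; have /set_mem/ED/mem_set -> := xi.
  by rewrite mul1r.
by rewrite -mulr_suml ler_piMl ?mulr_ge0//; exact: sum_indic_disjoint.
Qed.

End overlap.

Lemma bounded_sub_cube {R : realType} {n : nat} (D : set 'rV[R]_n) : bounded_set D ->
  exists2 M : R, 0 <= M & closure D `<=` cube M.
Proof.
move=> [M [_ h]]; exists (`|M| + 3); first by rewrite addr_ge0.
have hD x : D x -> `|x| <= `|M| + 1 by apply: h; rewrite (le_lt_trans (ler_norm M))// ltrDl.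
move=> x cx i; have [y [Dy yx]] := cx _ (enorm_ball_nbhs x (@ltr01 R)).
rewrite !mxE -ltr_norml; have := hD y Dy; have := coord_le_norm y i.
have := coord_le_enorm (y - x) i; rewrite !mxE; have /= := yx.
have : `|x 0 i| <= `|y 0 i| + `|y 0 i - x 0 i|.
  by rewrite [`|y 0 i - _|]distrC; have := ler_normD (y 0 i) (x 0 i - y 0 i); rewrite addrC subrK.
move: `|x 0 i| `|y 0 i| `|y 0 i - x 0 i| `|M| `|y| (enorm _); clear=> *; lra.
Qed.

Lemma sqr_le_mul {R : realType} (a b : R) : 0 <= a -> 0 <= b -> a ^+ 2 <= a * b -> a <= b.
Proof.
rewrite le_eqVlt expr2 => /predU1P[<-//|a0] _.
by rewrite ler_pM2l.
Qed.

(** * Approximation by piecewise constants *)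

Section mesh_approximation.
Context {R : realType} {n N : nat}.
Local Notation mu := (lebesgue_rV R n).
Variables (T : 'I_N -> set 'rV[R]_n) (Omega : set 'rV[R]_n).
Variables (H rho tau : R).
Hypothesis H0 : 0 < H.
Hypothesis mT : mesh T Omega H rho tau.
Hypothesis rho0 : 0 < rho.
Hypothesis tau0 : 0 < tau.
Hypothesis n0 : (0 < n)%N.
Hypothesis bO : bounded_set Omega.
Hypothesis oO : open Omega.
Hypothesis lipO : lipschitz_boundary Omega.
Implicit Types (u p q f : 'rV[R]_n -> R).

Let nR0 : 0 < n%:R :> R. Proof. by rewrite ltr0n. Qed.
Let mO : measurable Omega. Proof. exact: open_measurable_rV. Qed.
Let sub i : (T i)° `<=` Omega. Proof. exact: (mesh_sub mT lipO). Qed.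
Let mTi i : measurable (T i)°. Proof. exact: mesh_measurable. Qed.

Lemma mesh_disjoint i j : i != j -> (T i)° `&` (T j)° = set0.
Proof. by case: mT => _ _ [_ h] _ _; exact: h. Qed.

Lemma mesh_finite : (mu (closure Omega) < +oo)%E.
Proof.
have [M _ h] := bounded_sub_cube bO.
apply: le_lt_trans (lebesgue_rV_box_lty (const_mx (- M)) (const_mx M)).
apply: le_measure; rewrite ?inE//; last exact: measurable_box.
by apply: closed_measurable_rV; exact: closed_closure.
Qed.

Lemma mesh_measure_lty i : (mu (T i)° < +oo)%E.
Proof.
apply: le_lt_trans mesh_finite; apply: le_measure; rewrite ?inE//.
  by apply: closed_measurable_rV; exact: closed_closure.
by move=> x /interior_subset; exact: (mesh_subset mT).
Qed.

(** The elements cover the closure of Omega, and each of these finitely many convex sets has a null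
    boundary. *)
Lemma mesh_cover : {ae mu, forall x, Omega x -> exists i, (T i)° x}.
Proof.
have nul i : mu (T i `\` (T i)°) = 0%E.
  case: (mT) => cl cv _ _ _; apply: convexV_boundary_null => //.
  - exact: cv.
  - exact: (mesh_interior_neq0 H0 mT).
  apply: le_lt_trans mesh_finite; apply: le_measure; rewrite ?inE//.
  + exact: closed_measurable_rV.
  + by apply: closed_measurable_rV; exact: closed_closure.
  + exact: (mesh_subset mT).
have ae i : {ae mu, forall x, T i x -> (T i)° x}.
  case: (mT) => cl _ _ _ _; exists (T i `\` (T i)°); split => //.
    by apply: measurableD => //; exact: closed_measurable_rV.
  by move=> x /= /not_implyP.
have : {ae mu, forall x i, T i x -> (T i)° x}.
  exact: filter_forall.
apply: filterS => x h Ox; case: (mT) => _ _ [cO _] _ _.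
have [i _ Ti] : (\bigcup_i T i) x by rewrite -cO; exact: subset_closure.
by exists i; exact: h.
Qed.

(* The elements whose patch contains x lie in a box of side [6 * l * H], and each
   contains a box of side [2 * (rho * tau * H / n)]. *)
Lemma patch_overlap l x : (0 < l)%N ->
  \sum_i \1_((elt_patch T l i)°) x <= (3 * n%:R / (rho * tau)) ^+ n * l%:R ^+ n :> R.
Proof.
move=> l0; have l1 : 1 <= l%:R :> R by rewrite ler1n.
pose w := rho * tau * H / n%:R.
pose P : pred 'I_N := fun i => x \in ((elt_patch T l i)° : set 'rV[R]_n).
have w0 : 0 < w by rewrite divr_gt0 ?mulr_gt0.
(* Every point of such an element has distance at most (l + 1) H <= 2 l H from x; the factor 3 gives
   strict inequalities, as the box is open. *)
pose r : R := 3 * (l%:R * H); have r0 : 0 < r by rewrite !mulr_gt0// ltr0n.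
have le : ((\sum_(i | P i) (2 * w) ^+ n)%:E <= ((2 * r) ^+ n)%:E)%E.
  rewrite -sumEFin -(lebesgue_rV_box_center x (ltW r0)).
  apply: (@le_trans _ _ (\sum_(i | P i) mu (T i)°)%E).
    by apply: lee_sum => i _; exact: (mesh_measure_ge H0 mT).
  rewrite -measure_bigsetU_ord_cond//; last first.
    apply/trivIsetP => i j _ _ ij; exact: mesh_disjoint.
  apply: le_measure; rewrite ?inE//.
  - exact: bigsetU_measurable.
  - exact: measurable_box.
  apply: (big_ind (fun S => S `<=` box (x - const_mx r) (x + const_mx r))) => //.
    by move=> A B hA hB z [/hA|/hB].
  move=> i /set_mem/interior_subset/(elt_patch_near mT) [y Ty xy].
  move=> z /interior_subset Tz k; rewrite !mxE.
  have zy : enorm (z - y) <= H by case: mT => _ _ _ h _; exact: (h i).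
  have h1 := le_trans (coord_le_enorm (x - y) k) xy.
  have h2 := le_trans (coord_le_enorm (z - y) k) zy.
  rewrite !mxE in h1 h2; rewrite -ltr_distl.
  have : `|z 0 k - x 0 k| <= `|x 0 k - y 0 k| + `|z 0 k - y 0 k|.
    rewrite [leRHS]addrC [`|x 0 k - _|]distrC.
    by have := ler_normD (z 0 k - y 0 k) (y 0 k - x 0 k); rewrite addrA subrK.
  have lH : H <= l%:R * H by rewrite ler_peMl// ltW.
  rewrite /r; move: `|z 0 k - x 0 k| `|x 0 k - y 0 k| `|z 0 k - y 0 k| h1 h2 lH H0.
  by move: (l%:R * H) => *; lra.
have w2 : 0 < (2 * w) ^+ n by rewrite exprn_gt0// mulr_gt0.
have e : \sum_i \1_((elt_patch T l i)°) x = \sum_(i | P i) 1 :> R.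
  by rewrite [RHS]big_mkcond; apply: eq_bigr => i _; rewrite indicE /P; case: ifP.
rewrite e -(ler_pM2r w2) mulr_suml.
rewrite (eq_bigr (fun=> (2 * w) ^+ n)); last by move=> i _; rewrite mul1r.
rewrite -lee_fin; apply: le_trans le _; rewrite lee_fin -!exprMn.
rewrite le_eqVlt; apply/orP; left; apply/eqP; congr (_ ^+ _); rewrite /r /w; field.
by rewrite !gt_eqF.
Qed.

Lemma P0_L2 S p : P0 T S p -> L2 Omega p.
Proof.
move=> [c _ ->]; apply: L2_sum => // i; apply: L2Z => //.
have -> : \1_(T i)° = (fun=> 1 : R) \_ (T i)°.
  by apply/funext => x; rewrite patchE indicE; case: ifP.
apply: L2_mkcond => //; apply: L2_cst_fin => //; exact: mesh_measure_lty.
Qed.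

Lemma P0_value (c : 'I_N -> R) i x : (T i)° x -> \sum_j c j * \1_((T j)°) x = c i.
Proof.
move=> Ti; rewrite (bigD1 i)//= indicE mem_set// mulr1 big1 ?addr0// => j ji.
rewrite indicE memNset ?mulr0// => Tj.
by have := mesh_disjoint ji; rewrite -subset0 => /(_ x); apply.
Qed.

Lemma P0_approximation u (F : 'I_N -> R) : L2 Omega u ->
  (forall i, exists c : R, l2norm (T i)° (fun x => u x - c) ^+ 2 <= F i) ->
  exists2 p, P0 T (closure Omega) p & l2norm Omega (fun x => u x - p x) ^+ 2 <= \sum_i F i.
Proof.
move=> Lu /choice[c hc].
have Pp : P0 T (closure Omega) (fun x => \sum_j c j * \1_((T j)°) x).
  by exists c => // i; case; exact: (mesh_subset mT).
exists (fun x => \sum_j c j * \1_((T j)°) x) => //.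
apply: le_trans (l2norm_cover mO mTi sub mesh_cover _) _.
  by apply: L2B => //; exact: P0_L2 Pp.
apply: ler_sum => i _; apply: le_trans (hc i).
rewrite (eq_l2norm (g := fun x => u x - c i))// => x Ti.
by rewrite (P0_value c Ti).
Qed.

Let w0 : 0 < rho * tau * H / n%:R.
Proof. by rewrite divr_gt0 ?mulr_gt0. Qed.

Let muT i : (0 < mu (T i)° < +oo)%E.
Proof. by rewrite mesh_measure_lty (mesh_measure_gt0 H0 mT). Qed.

Let muTge i : (2 * (rho * tau * H / n%:R)) ^+ n <= fine (mu (T i)°).
Proof.
rewrite -lee_fin fineK ?(mesh_measure_ge H0 mT)//.
by rewrite ge0_fin_numE//; exact: mesh_measure_lty.
Qed.

(** The constant is the quotient of the volume (4 H)^n from the double integral and the lower bound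
    (2 rho tau H/n)^n for the volume of an element, in which H cancels. *)
Lemma mesh_poincare u G : L2 Omega u -> weak_grad Omega u G ->
  exists2 p, P0 T (closure Omega) p &
    l2norm Omega (fun x => u x - p x) ^+ 2 <=
    (2 * n%:R / (rho * tau)) ^+ n * (H ^+ 2 * vnorm2 Omega G).
Proof.
move=> Lu wu; set K := _ ^+ n.
have K0 : 0 <= K by rewrite exprn_ge0// !mulr_ge0// invr_ge0 mulr_ge0// ltW.
have [|p Pp hp] := @P0_approximation u (fun i => K * (H ^+ 2 * vnorm2 (T i)° G)) Lu.
  move=> i; have LTu : L2 (T i)° u by exact: (L2S mO (mTi i) (@sub i)).
  have wT := weak_grad_subset oO (@mesh_open _ _ _ T i) (@sub i) wu.
  have [c hc] := convex_poincare (@mesh_open _ _ _ T i) (@mesh_convex _ _ _ _ _ _ _ _ mT i)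
    H0 (@mesh_diam _ _ _ _ _ _ _ _ mT i) (muT i) LTu wT.
  exists c; move: hc (muTge i) (sqr_ge0 (l2norm (T i)° (fun x => u x - c))).
  move: (fine _) (_ ^+ 2) => m a; move: (H ^+ 2 * _) => b h1 h2 a0.
  have p0 : 0 < (2 * (rho * tau * H / n%:R)) ^+ n by rewrite exprn_gt0// mulr_gt0.
  rewrite -(ler_pM2l p0); apply: le_trans (le_trans (ler_wpM2r a0 h2) h1) _.
  rewrite [leRHS]mulrA /K -exprMn le_eqVlt; apply/orP; left; apply/eqP.
  congr (_ ^+ _ * _); field.
  by rewrite !gt_eqF.
exists p => //; apply: le_trans hp _; rewrite -mulr_sumr ler_wpM2l// -mulr_sumr.
rewrite ler_wpM2l ?sqr_ge0// -[leRHS]mul1r; apply: vnorm2_overlap => //.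
  by move=> x; apply: sum_indic_disjoint; exact: mesh_disjoint.
by case: wu => h _ i; exact: h.
Qed.

(** The fractional counterpart: H^(n + 2 s) divided by the lower volume bound (2 rho tau H/n)^n
    leaves H^(2 s). *)
Lemma mesh_slobodeckij u s : 0 <= s -> L2 Omega u -> (slobodeckij Omega s u < +oo)%E ->
  exists2 p, P0 T (closure Omega) p &
    l2norm Omega (fun x => u x - p x) ^+ 2 <=
    (n%:R / (2 * (rho * tau))) ^+ n * ((H `^ s) ^+ 2 * fine (slobodeckij Omega s u)).
Proof.
move=> s0 Lu Su; set K := _ ^+ n.
have K0 : 0 <= K by rewrite exprn_ge0// !mulr_ge0// invr_ge0 !mulr_ge0// ltW.
have mu' : measurable_fun Omega u by case: Lu.
have S0 D : (0 <= slobodeckij D s u)%E.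
  by apply: integral_ge0 => x _; apply: integral_ge0 => y _; exact: slob_ge0.
have le := slobodeckij_disjoint mO mTi sub s mesh_disjoint mu'.
have Si i : (slobodeckij (T i)° s u < +oo)%E.
  apply: le_lt_trans Su; apply: le_trans le.
  by rewrite (bigD1 i)//= leeDl// sume_ge0.
have [|p Pp hp] := @P0_approximation u
    (fun i => K * ((H `^ s) ^+ 2 * fine (slobodeckij (T i)° s u))) Lu.
  move=> i; have LTu : L2 (T i)° u by exact: (L2S mO (mTi i) (@sub i)).
  have [c hc] := mean_double_integral (mTi i) (muT i) LTu.
  have mTu : measurable_fun (T i)° u by case: LTu.
  have h3 := slob_double_integral (mTi i) s0 H0 (@mesh_diam _ _ _ _ _ _ _ _ mT i) mTu.
  exists c; move: (le_trans hc h3) (muTge i) (sqr_ge0 (l2norm (T i)° (fun x => u x - c))).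
  rewrite -[X in (_ * X)%E]/(slobodeckij _ _ _) -(fineK (x := slobodeckij _ _ _)); last first.
    by rewrite (ge0_fin_numE (S0 _)).
  rewrite -EFinM lee_fin; move: (fine (mu _)) (_ ^+ 2) => m a.
  move: (fine _) => b h1 h2 a0.
  have p0 : 0 < (2 * (rho * tau * H / n%:R)) ^+ n by rewrite exprn_gt0// mulr_gt0.
  rewrite -(ler_pM2l p0); apply: le_trans (le_trans (ler_wpM2r a0 h2) h1) _.
  have -> : H `^ (n%:R + 2 * s) = H ^+ n * (H `^ s) ^+ 2.
    rewrite powRD; last by rewrite (gt_eqF H0) implybT.
    by rewrite powR_mulrn ?(ltW H0)// mulrC [2 * s]mulrC powRrM powR_mulrn ?powR_ge0// mulrC.
  rewrite -[leLHS]mulrA [leRHS]mulrA /K -exprMn le_eqVlt; apply/orP; left; apply/eqP.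
  congr (_ ^+ _ * _); field.
  by rewrite !gt_eqF.
exists p => //; apply: le_trans hp _; rewrite -mulr_sumr ler_wpM2l// -mulr_sumr.
rewrite ler_wpM2l ?sqr_ge0// -lee_fin fineK ?(ge0_fin_numE (S0 _))//; apply: le_trans le.
rewrite -sumEFin le_eqVlt; apply/orP; left; apply/eqP.
by apply: eq_bigr => i _; rewrite fineK// (ge0_fin_numE (S0 _)).
Qed.

Lemma P0_sub S p q : P0 T S p -> P0 T S q -> P0 T S (fun x => p x - q x).
Proof.
move=> [c c0 ->] [c' c0' ->]; exists (fun i => c i - c' i).
  by move=> i h; rewrite c0// c0'// subrr.
by apply/funext => x; rewrite -sumrB; apply: eq_bigr => i _; rewrite mulrBl.
Qed.

Lemma l2proj_L2 f p : l2proj T Omega f p -> L2 Omega p.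
Proof. by case=> /P0_L2. Qed.

Lemma l2proj_dot f p q e : L2 Omega f -> L2 Omega e -> l2proj T Omega f p ->
  P0 T (closure Omega) q ->
  l2dot Omega (fun x => f x - p x) e = l2dot Omega (fun x => f x - p x) (fun x => e x - q x).
Proof.
move=> Lf Le hp Pq; have Lp := l2proj_L2 hp; have Lq := P0_L2 Pq.
have Lfp := L2B mO Lf Lp.
by rewrite l2dotBr//; case: hp => _ /(_ q Pq) /= ->; rewrite subr0.
Qed.

(** Since f - p is orthogonal to q - p, its squared norm equals its product with f - q. *)
Lemma l2proj_best f p q : L2 Omega f -> l2proj T Omega f p -> P0 T (closure Omega) q ->
  l2norm Omega (f \- p) <= l2norm Omega (fun x => f x - q x).
Proof.
move=> Lf hp Pq; have Lp := l2proj_L2 hp; have Lq := P0_L2 Pq.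
have Lfp := L2B mO Lf Lp; have Lfq := L2B mO Lf Lq.
have h : l2norm Omega (f \- p) ^+ 2 <= l2norm Omega (f \- p) * l2norm Omega (fun x => f x - q x).
  rewrite l2norm_sqr (l2proj_dot (q := fun x => q x - p x) Lf Lfp hp); last first.
    by apply: P0_sub => //; case: hp.
  have -> : (fun x => f x - p x - (q x - p x)) = (fun x => f x - q x).
    by apply/funext => x; ring.
  exact: l2dot_le.
by apply: sqr_le_mul h; exact: l2norm_ge0.
Qed.

Lemma l2proj_norm f p : L2 Omega f -> l2proj T Omega f p -> l2norm Omega p <= l2norm Omega f.
Proof.
move=> Lf hp; have Lp := l2proj_L2 hp; have [Pp /(_ p Pp)] := hp.
rewrite l2dotBl// => /eqP; rewrite subr_eq0 => /eqP h.
apply: sqr_le_mul; rewrite ?l2norm_ge0// mulrC l2norm_sqr -h.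
exact: l2dot_le.
Qed.

End mesh_approximation.

(** * The localized method *)

Lemma coefficient_subset {R : realType} {n : nat} (A : 'rV[R]_n -> 'M[R]_n)
    (alpha beta : R) (D W : set 'rV[R]_n) : measurable D -> measurable W -> W `<=` D ->
  coefficient D alpha beta A -> coefficient W alpha beta A.
Proof.
move=> mD mW WD [mA [M hM] sA eA]; split.
- by move=> i j; exact: measurable_funS (mA i j).
- by exists M; apply: filterS hM => x h /WD.
- by apply: filterS sA => x h /WD.
- by apply: filterS eA => x h /WD.
Qed.

Lemma eq_weak_grad {R : realType} {n : nat} (D : set 'rV[R]_n) (u v : 'rV[R]_n -> R)
    (G : 'rV[R]_n -> 'rV[R]_n) :
  (forall x, D x -> u x = v x) -> weak_grad D u G -> weak_grad D v G.
Proof.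
move=> uv [LG hG]; split => // phi tphi i; rewrite -(hG phi tphi i).
by apply: eq_Rintegral => x /set_mem Dx; rewrite uv.
Qed.

Lemma form_zero_ext {R : realType} {n : nat} (A : 'rV[R]_n -> 'M[R]_n)
    (D W : set 'rV[R]_n) (X Y : 'rV[R]_n -> 'rV[R]_n) : W `<=` D ->
  form A D (zero_ext W X) Y = form A W X Y.
Proof.
move=> WD; rewrite /form Rintegral_mkcond [RHS]Rintegral_mkcond.
congr (Rintegral _ _ _); apply/funext => x; rewrite !patchE /zero_ext.
case: (boolP (x \in W)) => xW; last by rewrite trmx0 mulmx0 mxE; case: ifP.
by rewrite ifT//; apply/mem_set/WD/set_mem.
Qed.

(** Used in [local_basis_defect] with [m = M ^+ 2] and [k = beta / alpha]: [a] and [p] are the two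
    parts of the squared H1 norm of the harmonic rest, [c] and [q] those of the energy
    projection. *)
Lemma bound_split {R : realType} (a b c p q r m k : R) :
  a <= 2 * (b + c) -> c <= 4 * m * q -> p <= k * r -> q <= k * r ->
  0 <= b -> 0 <= r -> 0 <= m -> 0 <= k ->
  a + p <= (2 + (8 * m + 1) * k) * (b + r).
Proof.
move=> n1 n2 q1 q2 b0 r0 m0 k0.
have n3 := ler_wpM2l (mulr_ge0 (ler0n R 4) m0) q2.
have h1 := mulr_ge0 (mulr_ge0 m0 k0) b0; have h2 := mulr_ge0 k0 b0.
lra.
Qed.

(** * The defect of one local basis function *)

Section local_estimate.
Context {R : realType} {n : nat}.
Variables (A : 'rV[R]_n -> 'M[R]_n) (Omega W : set 'rV[R]_n) (alpha beta M : R).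
Hypotheses (oO : open Omega) (oW : open W) (WO : W `<=` Omega).
Hypotheses (HA : coefficient Omega alpha beta A) (alpha0 : 0 < alpha).
Hypotheses (alpha_le_beta : alpha <= beta) (n0 : (0 < n)%N).
Hypotheses (OM : Omega `<=` cube M) (M0 : 0 <= M).
Implicit Types (u v g e phi : 'rV[R]_n -> R) (G : 'rV[R]_n -> 'rV[R]_n).

Let mO : measurable Omega. Proof. exact: open_measurable_rV. Qed.
Let mW : measurable W. Proof. exact: open_measurable_rV. Qed.
Let HAW : coefficient W alpha beta A. Proof. exact: coefficient_subset HA. Qed.
Let WM : W `<=` cube M. Proof. exact: subset_trans OM. Qed.

Lemma H10_vnorm2_friedrichs u G : H10 Omega u -> weak_grad Omega u G ->
  l2norm Omega u ^+ 2 <= 4 * M ^+ 2 * vnorm2 Omega G.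
Proof.
move=> Hu wG; have := H10_friedrichs (Ordinal n0) oO OM M0 Hu wG.
have := le_vnorm2 Omega G (Ordinal n0); have := l2norm_ge0 Omega u.
have := l2norm_ge0 Omega (fun x => G x 0 (Ordinal n0)).
move: (l2norm _ _) (l2norm _ _) (vnorm2 _ _) => a b c; move=> b0 a0 h1 h2.
apply: (@le_trans _ _ ((2 * M * b) ^+ 2)); first by rewrite lerXn2r ?nnegrE ?mulr_ge0 ?mulr_ge0.
have -> : (2 * M * b) ^+ 2 = 4 * M ^+ 2 * b ^+ 2 by ring.
by rewrite ler_wpM2l// mulr_ge0// sqr_ge0.
Qed.


Lemma restricted_weak_grad v : restricted Omega W v -> L2 W v /\ exists G, weak_grad W v G.
Proof.
move=> [v0 Hv0 <-]; have e x : W x -> v0 x = (v0 \_ W) x.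
  by move=> Wx; rewrite patchE mem_set.
have Hv := H1_subset oO oW WO (H10_H1 Hv0); split.
  exact: (eq_L2 mW e (H1_L2 Hv)).
by exists (grad W v0); exact: eq_weak_grad e (H1_weak_grad Hv).
Qed.

Lemma harmonic_spaceZ (k : R) v : harmonic_space A Omega W v ->
  harmonic_space A Omega W (fun x => k * v x) /\
  h1norm W (fun x => k * v x) = `|k| * h1norm W v.
Proof.
move=> [rv hv]; have [Lv [G wG]] := restricted_weak_grad rv; have LG := L2v_weak wG.
have wZ : weak_grad W (fun x => k * v x) (fun x => 0 + k *: G x).
  have w0 : weak_grad W (fun=> 0) (fun=> 0 : 'rV[R]_n).
    have := weak_gradB oW Lv Lv wG wG.
    by under eq_fun do rewrite subrr; under [X in weak_grad _ _ X]eq_fun do rewrite subrr.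
  have := weak_grad_lin k oW (L20 mW) Lv w0 wG.
  by under eq_fun do rewrite add0r.
have L0 : L2v W (fun=> 0 : 'rV[R]_n).
  by move=> i; under eq_fun do rewrite mxE; exact: L20.
split; first split.
- case: rv => v0 Hv0 <-; exists (fun x => k * v0 x); first exact: H10Z.
  by apply/funext => x; rewrite !patchE; case: ifP => //; rewrite mulr0.
- move=> w Hw; have ww := H10_weak_grad Hw; have Lw := L2v_weak ww.
  rewrite (energy_form mW HAW oW wZ ww) (form_linl mW HAW)//.
  rewrite -(energy_form mW HAW oW wG ww) hv// mulr0 addr0.
  have := form_linl mW HAW (-1) L0 L0 Lw.
  by under eq_fun do rewrite scaler0 addr0; rewrite mulN1r subrr.
have h1 := h1norm_sqr oW Lv wG; have h2 := h1norm_sqr oW (L2Z mW k Lv) wZ.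
have lk : l2norm W (fun x => k * v x) ^+ 2 = k ^+ 2 * l2norm W v ^+ 2.
  by rewrite (l2normZ k mW Lv) exprMn real_normK ?num_real.
have vk : vnorm2 W (fun x => 0 + k *: G x) = k ^+ 2 * vnorm2 W G.
  rewrite /vnorm2 mulr_sumr; apply: eq_bigr => i _.
  rewrite -(real_normK (num_real k)) -exprMn -(l2normZ k mW (LG i)); congr (_ ^+ 2).
  by apply: eq_l2norm => x _; rewrite add0r mxE.
rewrite lk vk -mulrDr -h1 in h2.
move: h2 (h1norm_ge0 W (fun x => k * v x)) (h1norm_ge0 W v).
move: (h1norm _ _) (h1norm _ _) => a b; move=> h a0 b0.
apply/eqP; rewrite -(@eqrXn2 _ 2)// ?mulr_ge0//.
by rewrite exprMn real_normK ?num_real// h.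
Qed.

(** Normalizing [v] suffices unless its H1 norm is zero, in which case its L2 norm is zero too. The
    set under the supremum is bounded by the L2 norm of [g]; this has to be checked, as [sup] is a
    default value on unbounded sets. *)
Lemma harmonic_sup_ge g v : L2 W g -> harmonic_space A Omega W v ->
  l2dot W g v <= harmonic_sup A Omega W g * h1norm W v.
Proof.
move=> Lg hv; have [Lv [G wG]] := restricted_weak_grad hv.1.
have le_h1 u G' : L2 W u -> weak_grad W u G' -> l2norm W u <= h1norm W u.
  move=> Lu wu; rewrite -(@ler_pXn2r _ 2)// ?nnegrE ?l2norm_ge0 ?h1norm_ge0//.
  by rewrite (h1norm_sqr oW Lu wu) lerDl vnorm2_ge0.
have [h0|h0] := eqVneq (h1norm W v) 0.
  rewrite h0 mulr0; apply: le_trans (l2dot_le mW Lg Lv) _.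
  have := le_h1 v G Lv wG; rewrite h0 => /(ler_wpM2l (l2norm_ge0 W g)).
  by rewrite mulr0.
have h1 : 0 < h1norm W v by rewrite lt_neqAle eq_sym h0 h1norm_ge0.
have [hz nz] := harmonic_spaceZ (h1norm W v)^-1 hv.
have : l2dot W g (fun x => (h1norm W v)^-1 * v x) <= harmonic_sup A Omega W g.
  apply: ub_le_sup.
    exists (l2norm W g) => _ [w [hw w1] <-].
    have [Lw [Gw ww]] := restricted_weak_grad hw.1.
    apply: le_trans (l2dot_le mW Lg Lw) _.
    by rewrite ler_piMr ?l2norm_ge0// -w1; exact: le_h1 ww.
  exists (fun x => (h1norm W v)^-1 * v x) => //; split => //.
  by rewrite nz gtr0_norm ?invr_gt0// mulVf.
by rewrite l2dotZr// -ler_pdivlMl ?invr_gt0// invrK mulrC.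
Qed.

Lemma harmonic_sup_norm g v (S : R) : L2 W g -> harmonic_space A Omega W v ->
  harmonic_sup A Omega W g <= S -> `|l2dot W g v| <= S * h1norm W v.
Proof.
move=> Lg hv hS; have [Lv _] := restricted_weak_grad hv.1.
have [hz nz] := harmonic_spaceZ (-1) hv.
have h1 := harmonic_sup_ge Lg hv; have h2 := harmonic_sup_ge Lg hz.
have hm := ler_wpM2r (h1norm_ge0 W v) hS.
move: h2; rewrite nz normrN1 mul1r l2dotZr// mulN1r => h2.
by rewrite ler_norml lerNl (le_trans h2 hm) (le_trans h1 hm).
Qed.

(* Split e on W into its energy projection e0 onto H10 W, on which g and phi agree,
   and an A-harmonic part, which phi does not see. *)
Lemma local_basis_defect g phi e Gp Ge (S : R) : L2 W g ->
  H10 W phi -> weak_grad W phi Gp ->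
  (forall v, H10 W v -> energy A W phi v = l2dot W g v) ->
  H10 Omega e -> weak_grad Omega e Ge ->
  harmonic_sup A Omega W g <= S ->
  (l2dot W g e - form A W Gp Ge) ^+ 2 <=
  S ^+ 2 * ((2 + (8 * M ^+ 2 + 1) * (beta / alpha)) * (l2norm W e ^+ 2 + vnorm2 W Ge)).
Proof.
move=> Lg Hp wp ep He we hS.
have weW := weak_grad_subset oO oW WO we.
have LeW : L2 W e by apply: (L2S mO mW WO); exact: H10_L2.
have LGe := L2v_weak weW; have LGp := L2v_weak wp.
have [e0 [G0 [H0 w0 orth]]] := energy_projection oW HAW alpha0 alpha_le_beta n0 WM M0 LGe.
have LG0 := L2v_weak w0; have L0 := H10_L2 H0.
have LB := L2vB mW LGe LG0.
(* Subtracting the extension by zero keeps [v] in [H10 Omega], so its restriction to [W] belongs to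
   the space over which the supremum is taken. *)
pose v x := e x - (e0 \_ W) x.
have Hv : H10 Omega v := H10B oO He (H10_zero_ext oO oW WO H0).
have ev x : W x -> e x - e0 x = (v \_ W) x.
  by move=> Wx; rewrite patchE mem_set// /v patchE mem_set.
have wv : weak_grad W (v \_ W) (fun x => Ge x - G0 x).
  exact: eq_weak_grad ev (weak_gradB oW LeW L0 weW w0).
have Lv : L2 W (v \_ W) by apply: (@eq_L2 _ _ W mW _ _ ev); exact: L2B.
have hv : harmonic_space A Omega W (v \_ W).
  split; first by exists v.
  move=> w Hw; have ww := H10_weak_grad Hw.
  by rewrite (energy_form mW HAW oW wv ww) (orth _ _ Hw ww).
have defect : l2dot W g e - form A W Gp Ge = l2dot W g (v \_ W).
  have -> : l2dot W g (v \_ W) = l2dot W g (fun x => e x - e0 x).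
    by apply: eq_Rintegral => x /set_mem Wx; rewrite ev.
  rewrite (l2dotBr mW LeW L0 Lg) -(ep _ H0) (energy_form mW HAW oW wp w0).
  have := orth _ _ Hp wp; rewrite (formBl mW HAW LGe LG0 LGp) => /eqP.
  rewrite subr_eq0 => /eqP h.
  by rewrite (formC mW HAW LGp LGe) h (formC mW HAW LG0 LGp).
have h1 := harmonic_sup_norm Lg hv hS; rewrite defect.
have h2 : h1norm W (v \_ W) ^+ 2 <=
    (2 + (8 * M ^+ 2 + 1) * (beta / alpha)) * (l2norm W e ^+ 2 + vnorm2 W Ge).
  rewrite (h1norm_sqr oW Lv wv).
  have n1 : l2norm W (v \_ W) ^+ 2 <= 2 * (l2norm W e ^+ 2 + l2norm W e0 ^+ 2).
    rewrite (eq_l2norm (g := fun x => e x + - e0 x)); last by move=> x Wx; rewrite -ev.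
    by rewrite -(l2normN W e0); apply: l2norm_sqrD => //; exact: L2N.
  have n2 : l2norm W e0 ^+ 2 <= 4 * M ^+ 2 * vnorm2 W G0.
    have := @H10_friedrichs _ _ W M e0 G0 (Ordinal n0) oW WM M0 H0 w0.
    have := le_vnorm2 W G0 (Ordinal n0); have := l2norm_ge0 W e0.
    have := l2norm_ge0 W (fun x => G0 x 0 (Ordinal n0)).
    move: (l2norm _ _) (l2norm _ _) (vnorm2 _ _) => a b c; move=> b0 a0 k1 k2.
    apply: (@le_trans _ _ ((2 * M * b) ^+ 2)); first by rewrite lerXn2r ?nnegrE ?mulr_ge0 ?mulr_ge0.
    have -> : (2 * M * b) ^+ 2 = 4 * M ^+ 2 * b ^+ 2 by ring.
    by rewrite ler_wpM2l// mulr_ge0// sqr_ge0.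
  (* By orthogonality the energy splits, so each of the two gradients is controlled by that of [e],
     up to the factor beta/alpha. *)
  have pyth : form A W Ge Ge = form A W (fun x => Ge x - G0 x) (fun x => Ge x - G0 x) +
      form A W G0 G0.
    have o := orth _ _ H0 w0.
    rewrite (formBr mW HAW LGe LG0 LB) o subr0 (formBl mW HAW)//.
    move: o; rewrite (formBl mW HAW)// (formC mW HAW LG0 LGe).
    by move: (form _ _ _ _) (form _ _ _ _) (form _ _ _ _) => a b c; lra.
  have up := form_upper mW HAW LGe.
  have lo1 := form_lower mW HAW LB; have lo2 := form_lower mW HAW LG0.
  have ge1 := form_ge0 mW HAW alpha0 LB; have ge2 := form_ge0 mW HAW alpha0 LG0.
  have q1 : vnorm2 W (fun x => Ge x - G0 x) <= beta / alpha * vnorm2 W Ge.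
    rewrite mulrAC ler_pdivlMr// mulrC; apply: le_trans lo1 _; apply: le_trans up.
    by rewrite pyth lerDl.
  have q2 : vnorm2 W G0 <= beta / alpha * vnorm2 W Ge.
    rewrite mulrAC ler_pdivlMr// mulrC; apply: le_trans lo2 _; apply: le_trans up.
    by rewrite pyth lerDr.
  have b1 : 0 <= beta / alpha by rewrite divr_ge0 ?ltW// (lt_le_trans alpha0).
  have M2 := sqr_ge0 M; have e2 := sqr_ge0 (l2norm W e); have vge := vnorm2_ge0 W Ge.
  exact: bound_split n1 n2 q1 q2 e2 vge M2 b1.
rewrite -[leLHS]real_normK ?num_real//.
apply: le_trans (_ : (S * h1norm W (v \_ W)) ^+ 2 <= _).
  by rewrite lerXn2r ?nnegrE// (le_trans _ h1).
by rewrite exprMn ler_wpM2l// sqr_ge0.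
Qed.

End local_estimate.

Lemma sum_cauchy_schwarz {R : realType} {N : nat} (a b : 'I_N -> R) :
  \sum_i a i * b i <= Num.sqrt (\sum_i a i ^+ 2) * Num.sqrt (\sum_i b i ^+ 2).
Proof.
have := dotv_le (\row_i a i) (\row_i b i); rewrite /enorm /dotv.
under eq_bigr do rewrite !mxE; move/le_trans; apply.
rewrite le_eqVlt; apply/orP; left; apply/eqP.
by congr (Num.sqrt _ * Num.sqrt _); apply: eq_bigr => i _; rewrite !mxE expr2.
Qed.

(* The lower Riesz bound makes the coefficient matrix of g invertible. *)
Lemma riesz_span {R : realType} {n N : nat} (T : 'I_N -> set 'rV[R]_n)
    (Omega S : set 'rV[R]_n) (C : R) (g : 'I_N -> 'rV[R]_n -> R) (p : 'rV[R]_n -> R) :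
  0 < C -> riesz Omega C g -> (forall i, exists S', P0 T S' (g i)) -> P0 T S p ->
  exists c, p = lincomb g c.
Proof.
move=> C0 rg Pg [q _ ->].
have /choice[b gb] : forall i, exists b : 'I_N -> R, g i = fun x => \sum_j b j * \1_((T j)°) x.
  by move=> i; have [S' [b _ e]] := Pg i; exists b.
pose B : 'M[R]_N := \matrix_(i, j) b i j.
have lcE (c : 'rV[R]_N) :
    lincomb g (fun i => c 0 i) = fun x => \sum_j (c *m B) 0 j * \1_((T j)°) x.
  apply/funext => x; rewrite /lincomb.
  under eq_bigr do rewrite gb mulr_sumr.
  rewrite exchange_big; apply: eq_bigr => j _.
  by rewrite mxE mulr_suml; apply: eq_bigr => i _; rewrite mxE mulrA.
have uB : B \in unitmx.
  rewrite -row_free_unit; apply: inj_row_free => v vB.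
  have [/= h _] := andP (rg (fun i => v 0 i)); move: h.
  have z : (fun x => \sum_j (0 : 'rV[R]_N) 0 j * \1_((T j)°) x) = fun=> 0.
    by apply/funext => x; rewrite big1// => j _; rewrite mxE mul0r.
  rewrite lcE vB z l2norm_sqr /l2dot; under eq_Rintegral do rewrite mul0r.
  rewrite /Rintegral integral0 /= pmulr_rle0 ?invr_gt0// => h.
  apply/rowP => i; rewrite mxE; apply/eqP; rewrite -sqrf_eq0 eq_le sqr_ge0 andbT.
  apply: le_trans h; rewrite (bigD1 i)//= lerDl.
  by apply: sumr_ge0 => j _; exact: sqr_ge0.
exists (fun i => (\row_j q j *m invmx B) 0 i); rewrite lcE.
by apply/funext => x; rewrite mulmxKV//; apply: eq_bigr => j _; rewrite mxE.
Qed.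

Section lincomb.
Context {R : realType} {n N : nat}.
Variables (A : 'rV[R]_n -> 'M[R]_n) (Omega : set 'rV[R]_n) (alpha beta : R).
Hypotheses (oO : open Omega) (HA : coefficient Omega alpha beta A).
Variables (phi : 'I_N -> 'rV[R]_n -> R) (G : 'I_N -> 'rV[R]_n -> 'rV[R]_n).
Hypotheses (Hphi : forall i, H10 Omega (phi i)).
Hypotheses (wphi : forall i, weak_grad Omega (phi i) (G i)).

Let mO : measurable Omega. Proof. exact: open_measurable_rV. Qed.

Lemma lincomb_form (c : 'I_N -> R) : exists Gc,
  [/\ H10 Omega (lincomb phi c), weak_grad Omega (lincomb phi c) Gc &
      forall X, L2v Omega X ->
        form A Omega Gc X = \sum_i c i * form A Omega (G i) X].
Proof.
rewrite /lincomb; elim: (index_enum _) => [|i r [Gc [IH1 IH2 IH3]]].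
  have e : (fun x : 'rV[R]_n => \sum_(i <- [::]) c i * phi i x) = fun=> 0.
    by apply/funext => x; rewrite big_nil.
  rewrite e; have h := H10_0 oO; have w := H10_weak_grad h.
  have ww := weak_gradB oO (H10_L2 h) (H10_L2 h) w w.
  exists (fun x => grad Omega (fun=> 0) x - grad Omega (fun=> 0) x); split => //.
    by apply: eq_weak_grad ww => x _; rewrite subrr.
  move=> X LX; rewrite big_nil (formBl mO HA) ?subrr//; exact: L2v_weak w.
have e : (fun x => \sum_(j <- i :: r) c j * phi j x) =
    fun x => \sum_(j <- r) c j * phi j x + c i * phi i x.
  by apply/funext => x; rewrite big_cons addrC.
rewrite e; exists (fun x => Gc x + c i *: G i x); split.
- exact: (H10_lin (c i) oO IH1 (Hphi i)).
- exact: (weak_grad_lin (c i) oO (H10_L2 IH1) (H10_L2 (Hphi i)) IH2 (wphi i)).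
- move=> X LX; rewrite big_cons addrC (form_linl mO HA)//.
  + by rewrite IH3.
  + exact: L2v_weak IH2.
  + exact: L2v_weak (wphi i).
Qed.

End lincomb.

Lemma P0_outside {R : realType} {n N : nat} (T : 'I_N -> set 'rV[R]_n) (S : set 'rV[R]_n)
    (p : 'rV[R]_n -> R) : P0 T S p -> p = p \_ S°.
Proof.
move=> [c c0 ->]; apply/funext => x; rewrite patchE; case: ifPn => // /negP nS.
apply: big1 => i _; have [TS|/c0 ->] := pselect (T i `<=` S); last by rewrite mul0r.
rewrite indicE memNset ?mulr0// => /(interiorS TS) Sx.
by apply: nS; exact/mem_set.
Qed.

Lemma sqrtr_le {R : realType} (x y : R) : 0 <= y -> x <= y ^+ 2 -> Num.sqrt x <= y.
Proof. by move=> y0 /ler_wsqrtr; rewrite sqrtr_sqr ger0_norm. Qed.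

Lemma powR_half_sqr {R : realType} (l n : nat) : (l%:R `^ (n%:R / 2)) ^+ 2 = l%:R ^+ n :> R.
Proof. by rewrite -powR_mulrn ?powR_ge0// -powRrM divfK// powR_mulrn. Qed.

(** * The Galerkin error in the energy norm *)

Section galerkin_error.
Context {R : realType} {n N : nat}.
Variables (A : 'rV[R]_n -> 'M[R]_n) (Omega : set 'rV[R]_n) (alpha beta M : R).
Hypotheses (oO : open Omega) (bO : bounded_set Omega) (lipO : lipschitz_boundary Omega).
Hypotheses (HA : coefficient Omega alpha beta A) (alpha0 : 0 < alpha).
Hypotheses (alpha_le_beta : alpha <= beta) (n0 : (0 < n)%N).
Hypotheses (OM : Omega `<=` cube M) (M0 : 0 <= M).
Variables (T : 'I_N -> set 'rV[R]_n) (H rho tau : R) (l : nat).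
Hypotheses (H0 : 0 < H) (mT : mesh T Omega H rho tau) (rho0 : 0 < rho) (tau0 : 0 < tau).
Hypothesis l0 : (0 < l)%N.
Variables (g phi : 'I_N -> 'rV[R]_n -> R) (C : R).
Hypothesis Pg : forall i, P0 T (elt_patch T l i) (g i).
Hypothesis bphi : forall i, local_basis A (elt_patch T l i) (g i) (phi i).
Hypotheses (C0 : 0 < C) (rg : riesz Omega C g).
Variables (f Pf u uH : 'rV[R]_n -> R).
Hypotheses (Lf : L2 Omega f) (hPf : l2proj T Omega f Pf).
Hypotheses (su : solution A Omega f u) (guH : galerkin A Omega phi f uH).

Local Notation W i := ((elt_patch T l i)°).

Let mO : measurable Omega. Proof. exact: open_measurable_rV. Qed.
Let oW i : open (W i). Proof. exact: open_interior. Qed.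
Let mW i : measurable (W i). Proof. exact: open_measurable_rV. Qed.
Let WO i : W i `<=` Omega. Proof. exact: (elt_patch_interior_sub mT lipO). Qed.

Let Lg i : L2 Omega (g i).
Proof. exact: (P0_L2 mT bO oO lipO (Pg i)). Qed.

Let Lp : L2 Omega Pf.
Proof. exact: (l2proj_L2 mT bO oO lipO hPf). Qed.

Lemma galerkin_identity : exists (c : 'I_N -> R) Ge,
  [/\ H10 Omega (u \- uH), weak_grad Omega (u \- uH) Ge,
      \sum_i c i ^+ 2 <= C * l2norm Omega f ^+ 2 &
      energy A Omega (u \- uH) (u \- uH) = form A Omega Ge Ge /\
      form A Omega Ge Ge = l2dot Omega (fun x => f x - Pf x) (u \- uH) +
        \sum_i c i * (l2dot (W i) (g i) (u \- uH) -
                      form A (W i) (grad (W i) (phi i)) Ge)].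
Proof.
have [c Pfc] : exists c, Pf = lincomb g c.
  case: hPf => Pc _; apply: (riesz_span C0 rg _ Pc).
  by move=> i; exists (elt_patch T l i).
pose G i := zero_ext (W i) (grad (W i) (phi i)).
have Hphi i : H10 Omega (phi i).
  by case: (bphi i) => h -> _; exact: H10_zero_ext.
have wphi i : weak_grad Omega (phi i) (G i).
  case: (bphi i) => h e _.
  by have := weak_grad_zero_ext oO (@oW i) (@WO i) h (H10_weak_grad h); rewrite -e.
have LG i := L2v_weak (wphi i).
have [Hu eu] := su; have wu := H10_weak_grad Hu; have LGu := L2v_weak wu.
have [[b _ ub] eH] := guH.
have [GH [HH wH fH]] := lincomb_form oO HA Hphi wphi b.
have [Gv [Hv wv fv]] := lincomb_form oO HA Hphi wphi c.
rewrite ub in HH wH; have LGH := L2v_weak wH; have LGv := L2v_weak wv.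
have He : H10 Omega (u \- uH) := H10B oO Hu HH.
have we : weak_grad Omega (u \- uH) (fun x => grad Omega u x - GH x) :=
  weak_gradB oO (H10_L2 Hu) (H10_L2 HH) wu wH.
exists c, (fun x => grad Omega u x - GH x); have LGe := L2v_weak we.
have Le := H10_L2 He.
split => //.
  have [/= h _] := andP (rg c); rewrite ler_pdivrMl// in h.
  apply: le_trans h _; rewrite ler_pM2l// -Pfc lerXn2r ?nnegrE ?l2norm_ge0//.
  exact: (l2proj_norm mT bO oO lipO Lf hPf).
split; first exact: (energy_form mO HA oO we we).
have orth v Gw : H10 Omega v -> range (lincomb phi) v -> weak_grad Omega v Gw ->
    form A Omega (fun x => grad Omega u x - GH x) Gw = 0.
  move=> Hw rw ww; have LGw := L2v_weak ww.
  rewrite (formBl mO HA LGu LGH LGw) -(energy_form mO HA oO wu ww).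
  by rewrite -(energy_form mO HA oO wH ww) eu// eH// subrr.
(* Orthogonality to [uH] gives a(e, e) = a(u, e) = (f, e). *)
have oH : form A Omega GH (fun x => grad Omega u x - GH x) = 0.
  by rewrite (formC mO HA LGH LGe); apply: orth HH _ wH; exists b.
have ov : form A Omega Gv (fun x => grad Omega u x - GH x) = 0.
  by rewrite (formC mO HA LGv LGe); apply: orth Hv _ wv; exists c.
rewrite {1}(formBl mO HA LGu LGH LGe) oH subr0 -(energy_form mO HA oO wu we) (eu _ He).
rewrite (l2dotBl mO Lf Lp Le).
have -> : \sum_i c i * (l2dot (W i) (g i) (u \- uH) -
    form A (W i) (grad (W i) (phi i)) (fun x => grad Omega u x - GH x)) =
    l2dot Omega Pf (u \- uH).
  under eq_bigr do rewrite mulrBr.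
  rewrite sumrB.
  (* The forms over the patches add up to a(v, e) for the discrete v with coefficients [c], which
     vanishes as well; the brackets therefore sum to (Pi_H f, e). *)
  have -> : \sum_i c i * form A (W i) (grad (W i) (phi i))
      (fun x => grad Omega u x - GH x) = 0.
    by rewrite -[RHS]ov (fv _ LGe); apply: eq_bigr => i _; rewrite form_zero_ext.
  rewrite subr0.
  rewrite Pfc /lincomb (l2dot_suml mO _ _ Le); last by move=> i; exact: L2Z.
  apply: eq_bigr => i _; rewrite (l2dotZl mO _ (Lg i) Le); congr (_ * _).
  by rewrite (P0_outside (Pg i)) (l2dot_mkcondl _ _ (@WO i)) -(P0_outside (Pg i)).
by rewrite subrK.
Qed.


(** Both terms of [galerkin_identity] are bounded by a multiple of the energy norm E of the error,
    so that E^2 <= B E and one factor E cancels. *)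
Lemma galerkin_error (S : R) : 0 <= S ->
  (forall i, harmonic_sup A Omega (W i) (g i) <= S) ->
  energy_norm A Omega (u \- uH) <=
  Num.sqrt ((2 * n%:R / (rho * tau)) ^+ n / alpha) * (H * l2norm Omega (f \- Pf)) +
  Num.sqrt ((2 + (8 * M ^+ 2 + 1) * (beta / alpha)) * (3 * n%:R / (rho * tau)) ^+ n *
            (4 * M ^+ 2 + 1) / alpha) *
  (Num.sqrt C * l%:R `^ (n%:R / 2) * S * l2norm Omega f).
Proof.
move=> S0 hS; have [c [Ge [He we hc [eE id]]]] := galerkin_identity.
have Le := H10_L2 He; have LGe := L2v_weak we.
(* [K1] is the constant of [mesh_poincare], [KW] that of [local_basis_defect], [K3] that of
   [patch_overlap], and [KF] comes from Friedrichs' inequality. Division by alpha passes from the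
   gradient to the energy. *)
set K1 := _ ^+ n; set KW := 2 + _; set K3 := _ ^+ n; set KF := _ + 1.
have rt0 : 0 < rho * tau by rewrite mulr_gt0.
have K10 : 0 <= K1 by rewrite exprn_ge0// divr_ge0 ?mulr_ge0// ltW.
have K30 : 0 <= K3 by rewrite exprn_ge0// divr_ge0 ?mulr_ge0// ltW.
have KW0 : 0 <= KW.
  have b0 : 0 <= beta by rewrite ltW// (lt_le_trans alpha0).
  by rewrite addr_ge0// mulr_ge0 ?divr_ge0 ?(ltW alpha0)// addr_ge0// mulr_ge0// sqr_ge0.
have KF0 : 0 <= KF by rewrite addr_ge0// mulr_ge0// sqr_ge0.
set E := energy_norm A Omega (u \- uH).
have E0 : 0 <= E by exact: sqrtr_ge0.
have E2 : E ^+ 2 = form A Omega Ge Ge.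
  by rewrite /E /energy_norm eE sqr_sqrtr// (form_ge0 mO HA alpha0 LGe).
have V0 := vnorm2_ge0 Omega Ge.
have VE : vnorm2 Omega Ge <= E ^+ 2 / alpha.
  by rewrite ler_pdivlMr// mulrC E2; exact: (form_lower mO HA LGe).
have a0 := l2norm_ge0 Omega (f \- Pf); have f0 := l2norm_ge0 Omega f.
have Lfp : L2 Omega (fun x => f x - Pf x) := L2B mO Lf Lp.
have bound1 : l2dot Omega (fun x => f x - Pf x) (u \- uH) <=
    Num.sqrt (K1 / alpha) * (H * l2norm Omega (f \- Pf)) * E.
  have [p Pp hp] := mesh_poincare H0 mT rho0 tau0 n0 bO oO lipO Le we.
  have Lq := P0_L2 mT bO oO lipO Pp.
  rewrite (l2proj_dot mT bO oO lipO Lf Le hPf Pp).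
  apply: le_trans (l2dot_le mO Lfp (L2B mO Le Lq)) _.
  have -> : Num.sqrt (K1 / alpha) * (H * l2norm Omega (f \- Pf)) * E =
      l2norm Omega (f \- Pf) * (Num.sqrt (K1 / alpha) * H * E) by ring.
  apply: ler_wpM2l => //; rewrite -(@ler_pXn2r _ 2)// ?nnegrE ?l2norm_ge0//; last first.
    by rewrite !mulr_ge0 ?sqrtr_ge0// ltW.
  apply: le_trans hp _; rewrite -/K1 [leRHS]exprMn (exprMn _ (Num.sqrt _)) sqr_sqrtr; last first.
    by rewrite divr_ge0// ltW.
  have -> : K1 / alpha * H ^+ 2 * E ^+ 2 = K1 * (H ^+ 2 * (E ^+ 2 / alpha)) by ring.
  by rewrite -/K1 !ler_wpM2l// sqr_ge0.
have WeV : l2norm Omega (u \- uH) ^+ 2 + vnorm2 Omega Ge <= KF * (E ^+ 2 / alpha).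
  apply: (@le_trans _ _ (KF * vnorm2 Omega Ge)); last exact: ler_wpM2l.
  by rewrite /KF mulrDl mul1r lerD2r; exact: (H10_vnorm2_friedrichs oO n0 OM M0 He we).
have over x : \sum_i \1_(W i) x <= K3 * l%:R ^+ n.
  exact: (patch_overlap H0 mT rho0 tau0 n0 x l0).
pose br i := l2dot (W i) (g i) (u \- uH) - form A (W i) (grad (W i) (phi i)) Ge.
have sum_br : \sum_i br i ^+ 2 <= S ^+ 2 * (KW * (K3 * l%:R ^+ n * (KF * (E ^+ 2 / alpha)))).
  apply: (@le_trans _ _ (S ^+ 2 * (KW *
      (\sum_i (l2norm (W i) (u \- uH) ^+ 2 + vnorm2 (W i) Ge))))).
    rewrite mulrA mulr_sumr; apply: ler_sum => i _; rewrite -mulrA.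
    case: (bphi i) => hp _ ep; have Lgi := L2S mO (mW i) (@WO i) (Lg i).
    exact: (local_basis_defect oO (@oW i) (@WO i) HA alpha0 alpha_le_beta n0 OM M0
      Lgi hp (H10_weak_grad hp) ep He we (hS i)).
  apply: ler_wpM2l; first exact: sqr_ge0.
  apply: ler_wpM2l => //; apply: le_trans (ler_wpM2l _ WeV); last first.
    by rewrite mulr_ge0// exprn_ge0.
  rewrite big_split mulrDr; apply: lerD.
    exact: (l2norm_overlap mO mW WO over Le).
  exact: (vnorm2_overlap mO mW WO over LGe).
(* Cauchy-Schwarz over the elements: the Riesz bound on the coefficients contributes sqrt(C) times
   the norm of f, and the square root of the overlap count contributes l^(n/2). *)
have bound2 : \sum_i c i * br i <= Num.sqrt (KW * K3 * KF / alpha) *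
    (Num.sqrt C * l%:R `^ (n%:R / 2) * S * l2norm Omega f) * E.
  apply: le_trans (sum_cauchy_schwarz _ _) _.
  have P0' := powR_ge0 (l%:R : R) (n%:R / 2).
  have s1 : Num.sqrt (\sum_i c i ^+ 2) <= Num.sqrt C * l2norm Omega f.
    apply: sqrtr_le; first by rewrite mulr_ge0 ?sqrtr_ge0.
    by rewrite exprMn sqr_sqrtr// ltW.
  have s2 : Num.sqrt (\sum_i br i ^+ 2) <=
      Num.sqrt (KW * K3 * KF / alpha) * (l%:R `^ (n%:R / 2) * S) * E.
    apply: sqrtr_le; first by rewrite !mulr_ge0 ?sqrtr_ge0.
    have sq : Num.sqrt (KW * K3 * KF / alpha) ^+ 2 = KW * K3 * KF / alpha.
      by apply: sqr_sqrtr; rewrite divr_ge0 ?(ltW alpha0)// !mulr_ge0.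
    apply: le_trans sum_br _; rewrite !exprMn powR_half_sqr sq.
    by rewrite le_eqVlt; apply/orP; left; apply/eqP; ring.
  apply: le_trans (ler_pM (sqrtr_ge0 _) (sqrtr_ge0 _) s1 s2) _.
  by rewrite le_eqVlt; apply/orP; left; apply/eqP; ring.
apply: sqr_le_mul => //.
  by rewrite addr_ge0// !mulr_ge0 ?sqrtr_ge0 ?powR_ge0// ltW.
by rewrite {1}E2 id mulrC mulrDl; apply: lerD.
Qed.

End galerkin_error.

(** * Projection error for data in fractional Sobolev spaces *)

Section sobolev_slobodeckij.
Context {R : realType} {n N : nat}.
Variables (Omega : set 'rV[R]_n).
Hypotheses (oO : open Omega) (bO : bounded_set Omega) (lipO : lipschitz_boundary Omega).
Implicit Types (f Pf : 'rV[R]_n -> R) (s : R).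

Let slob_fine_ge0 s f : 0 <= fine (slobodeckij Omega s f).
Proof.
by apply: fine_ge0; apply: integral_ge0 => x _; apply: integral_ge0 => y _; exact: slob_ge0.
Qed.

Lemma l2norm_le_hsnorm s f : Hs Omega s f -> l2norm Omega f <= hsnorm Omega s f.
Proof.
move=> [Lf h1 _]; rewrite /hsnorm; case: ifP => // _; case: ifP => [/eqP/h1 Hf|_].
  rewrite -(@ler_pXn2r _ 2)// ?nnegrE ?l2norm_ge0 ?h1norm_ge0//.
  by rewrite (h1norm_sqr oO Lf (H1_weak_grad Hf)) lerDl vnorm2_ge0.
rewrite -[leLHS]ger0_norm ?l2norm_ge0// -sqrtr_sqr; apply: ler_wsqrtr.
by rewrite lerDl.
Qed.

Variables (T : 'I_N -> set 'rV[R]_n) (H rho tau : R).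
Hypotheses (n0 : (0 < n)%N).
Hypotheses (H0 : 0 < H) (mT : mesh T Omega H rho tau) (rho0 : 0 < rho) (tau0 : 0 < tau).

(** One constant serves all s: the three summands are the constants of the cases s = 0, s = 1 and 0
    < s < 1, in which [hsnorm] has different definitions. *)
Lemma l2proj_hsnorm s f Pf : 0 <= s <= 1 -> Hs Omega s f -> l2proj T Omega f Pf ->
  l2norm Omega (f \- Pf) <=
  (1 + Num.sqrt ((2 * n%:R / (rho * tau)) ^+ n) +
   Num.sqrt ((n%:R / (2 * (rho * tau))) ^+ n)) * (H `^ s * hsnorm Omega s f).
Proof.
move=> /andP[s0 s1] hs hP; have [Lf h1 hsl] := hs.
set K1 := _ ^+ n; set K2 := _ ^+ n.
have rt0 : 0 < rho * tau by rewrite mulr_gt0.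
have K10 : 0 <= K1 by rewrite exprn_ge0// divr_ge0 ?mulr_ge0// ltW.
have K20 : 0 <= K2 by rewrite exprn_ge0// divr_ge0 ?mulr_ge0// ltW.
have q1 := sqrtr_ge0 K1; have q2 := sqrtr_ge0 K2.
have hn0 : 0 <= H `^ s * hsnorm Omega s f.
  by rewrite mulr_ge0 ?powR_ge0// (le_trans (l2norm_ge0 Omega f))//; exact: l2norm_le_hsnorm.
have widen k : 0 <= k -> k <= 1 + Num.sqrt K1 + Num.sqrt K2 ->
    l2norm Omega (f \- Pf) <= k * (H `^ s * hsnorm Omega s f) ->
    l2norm Omega (f \- Pf) <= (1 + Num.sqrt K1 + Num.sqrt K2) * (H `^ s * hsnorm Omega s f).
  by move=> k0 kK /le_trans; apply; rewrite ler_wpM2r.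
have best q K y : P0 T (closure Omega) q -> 0 <= K -> 0 <= y ->
    l2norm Omega (fun x => f x - q x) ^+ 2 <= K * y ^+ 2 ->
    l2norm Omega (f \- Pf) <= Num.sqrt K * y.
  move=> Pq K0 y0 h; apply: le_trans (l2proj_best mT bO oO lipO Lf hP Pq) _.
  rewrite -(@ler_pXn2r _ 2)// ?nnegrE ?l2norm_ge0 ?mulr_ge0 ?sqrtr_ge0//.
  by rewrite exprMn (sqr_sqrtr K0).
have [z0|sn0] := eqVneq s 0.
  apply: (widen 1) => //; first by rewrite -addrA lerDl addr_ge0.
  rewrite mul1r z0 powRr0 mul1r /hsnorm eqxx.
  have P0q : P0 T (closure Omega) (fun=> 0).
    by exists (fun=> 0) => //; apply/funext => x; rewrite big1// => i _; rewrite mul0r.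
  apply: le_trans (l2proj_best mT bO oO lipO Lf hP P0q) _.
  by rewrite (eq_l2norm (g := f))// => x _; rewrite subr0.
have sgt0 : 0 < s by rewrite lt_neqAle eq_sym sn0.
have [e1|sn1] := eqVneq s 1.
  apply: (widen (Num.sqrt K1)) => //; first by rewrite addrAC lerDr addr_ge0.
  have Hf := h1 e1; have wf := H1_weak_grad Hf.
  have [q Pq hq] := mesh_poincare H0 mT rho0 tau0 n0 bO oO lipO Lf wf.
  apply: (best q) => //; apply: le_trans hq _; apply: ler_wpM2l => //.
  rewrite /hsnorm (negPf sn0) e1 eqxx powRr1 ?(ltW H0)// exprMn ler_wpM2l ?sqr_ge0//.
  by rewrite (h1norm_sqr oO Lf wf) lerDr sqr_ge0.
apply: (widen (Num.sqrt K2)) => //; first by rewrite lerDr addr_ge0.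
have slt1 : 0 < s < 1 by rewrite sgt0 lt_neqAle sn1 s1.
have [q Pq hq] := mesh_slobodeckij H0 mT rho0 tau0 n0 bO oO lipO s0 Lf (hsl slt1).
apply: (best q) => //; apply: le_trans hq _; apply: ler_wpM2l => //.
rewrite /hsnorm (negPf sn0) (negPf sn1) exprMn ler_wpM2l ?sqr_ge0// sqr_sqrtr.
  by rewrite lerDr sqr_ge0.
by rewrite addr_ge0// sqr_ge0.
Qed.

End sobolev_slobodeckij.

Theorem theorem6p1 (R : realType) (d : nat) (Omega : set 'rV[R]_d)
    (alpha beta rho tau : R) :
  (0 < d)%N -> polyhedral_lipschitz_domain Omega ->
  0 < alpha -> alpha <= beta -> 0 < rho -> 0 < tau ->
  exists C C' : R, [/\ 0 < C, 0 < C' &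
    forall (A : 'rV[R]_d -> 'M[R]_d), coefficient Omega alpha beta A ->
    forall (adm : set (R * nat)) (N : R -> nat)
      (T : forall H : R, 'I_(N H) -> set 'rV[R]_d)
      (g phi : forall (H : R) (l : nat), 'I_(N H) -> 'rV[R]_d -> R)
      (Crb : R -> nat -> R),
    (forall H l, adm (H, l) ->
      [/\ 0 < H, (0 < l)%N, mesh (T H) Omega H rho tau &
        forall i, let omega := elt_patch (T H) l i in
          [/\ omega <> closure Omega,
              source_term A Omega (T H) omega (g H l i) &
              local_basis A omega (g H l i) (phi H l i)]]) ->
    (forall H l, adm (H, l) -> 0 < Crb H l /\ riesz Omega (Crb H l) (g H l)) ->
    polynomially_bounded adm Crb ->
    forall H l, adm (H, l) ->
    forall s : R, 0 <= s <= 1 ->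
    forall f PiHf u uHl : 'rV[R]_d -> R,
      Hs Omega s f ->
      l2proj (T H) Omega f PiHf ->
      solution A Omega f u ->
      galerkin A Omega (phi H l) f uHl ->
      let err := Num.sqrt (Crb H l) * l%:R `^ (d%:R / 2) *
                 sigma A Omega (T H) l (g H l) in
      let bound := C * (H * l2norm Omega (f \- PiHf) + err * l2norm Omega f) in
      energy_norm A Omega (u \- uHl) <= bound /\
      bound <= C' * (H `^ (1 + s) + err) * hsnorm Omega s f].
Proof.
move=> d0 [[_ oO] _ bO _ lipO] alpha0 ab rho0 tau0.
(* [M] depends on Omega only, so all constants below precede the choice of [A], the mesh, [H] and
   [l]. *)
have [M M0 cM] := bounded_sub_cube bO.
have OM : Omega `<=` cube M by apply: subset_trans cM; exact: subset_closure.
pose C1 := Num.sqrt ((2 * d%:R / (rho * tau)) ^+ d / alpha).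
pose C2 := Num.sqrt ((2 + (8 * M ^+ 2 + 1) * (beta / alpha)) *
  (3 * d%:R / (rho * tau)) ^+ d * (4 * M ^+ 2 + 1) / alpha).
pose C3 := 1 + Num.sqrt ((2 * d%:R / (rho * tau)) ^+ d) +
  Num.sqrt ((d%:R / (2 * (rho * tau))) ^+ d).
have C10 : 0 <= C1 by exact: sqrtr_ge0.
have C20 : 0 <= C2 by exact: sqrtr_ge0.
have C31 : 1 <= C3 by rewrite /C3 -addrA lerDl addr_ge0 ?sqrtr_ge0.
(* The summand 1 ensures positivity. *)
pose C := C1 + C2 + 1.
have Cgt0 : 0 < C by rewrite ltr_wpDl// addr_ge0.
have C3gt0 : 0 < C3 by exact: lt_le_trans C31.
exists C, (C * C3); split => //; first exact: mulr_gt0.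
move=> A HA adm N T g phi Crb hmesh hriesz _ H l Hl s s01 f Pf u uH hs hP su gu err bound.
have [H0 l0 mT hloc] := hmesh H l Hl; have [Crb0 rg] := hriesz H l Hl.
have Lf : L2 Omega f by case: hs.
have Pg i : P0 (T H) (elt_patch (T H) l i) (g H l i) by case: (hloc i) => _ [].
have bphi i : local_basis A (elt_patch (T H) l i) (g H l i) (phi H l i) by case: (hloc i).
(* [sigma] is a maximum that starts from 0. *)
have S0 : 0 <= sigma A Omega (T H) l (g H l) by exact: bigmax_ge_id.
have hS i : harmonic_sup A Omega (elt_patch (T H) l i)° (g H l i) <=
    sigma A Omega (T H) l (g H l) by exact: le_bigmax.
have main := galerkin_error oO bO lipO HA alpha0 ab d0 OM M0 H0 mT rho0 tau0 l0 Pg bphi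
  Crb0 rg Lf hP su gu S0 hS.
rewrite -/C1 -/C2 -/err in main.
have err0 : 0 <= err by rewrite /err !mulr_ge0 ?sqrtr_ge0 ?powR_ge0.
have a0 : 0 <= H * l2norm Omega (f \- Pf) by rewrite mulr_ge0 ?l2norm_ge0 ?(ltW H0).
have b0 : 0 <= err * l2norm Omega f by rewrite mulr_ge0 ?l2norm_ge0.
split.
  apply: le_trans main _; rewrite /bound mulrDr; apply: lerD; apply: ler_wpM2r => //.
    by rewrite /C -addrA lerDl addr_ge0.
  by rewrite /C addrAC lerDr addr_ge0.
have h1 := l2norm_le_hsnorm oO hs.
have h2 := l2proj_hsnorm oO bO lipO d0 H0 mT rho0 tau0 s01 hs hP.
rewrite -/C3 in h2; rewrite /bound -[leRHS]mulrA -[leRHS]mulrA; apply: ler_wpM2l; first exact: ltW.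
rewrite [(_ + err) * _]mulrDl [leRHS]mulrDr; apply: lerD.
  have -> : H `^ (1 + s) = H * H `^ s.
    by rewrite powRD ?powRr1 ?(ltW H0)// (gt_eqF H0) implybT.
  by rewrite -[H * _ * _]mulrA [leRHS]mulrCA; apply: ler_wpM2l => //; exact: ltW.
(* The second term needs no projection estimate; here [C3] is absorbed by [1 <= C3]. *)
apply: (@le_trans _ _ (err * hsnorm Omega s f)); first exact: ler_wpM2l.
rewrite ler_peMl// mulr_ge0//.
exact: le_trans (l2norm_ge0 Omega f) h1.
Qed.
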